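(* Let $G_n$ be the adjacency matrix of an Erdős–Rényi random graph on $n$ vertices with edge probability $p_n$, let $\theta\in\mathbb R$, and let $A_n=\frac{\theta G_n}{np_n}$. Let $c_1,\dots,c_n$ be i.i.d. from a distribution $F$ on $\mathbb R$ with $\mathbb E_F\psi'(c_1)=0$, and given $c=(c_1,\dots,c_n)^\top$ and $G_n$ let $\boldsymbol\sigma$ be drawn from the quadratic interaction model with coupling matrix $A_n$, field vector $c$ and common base measure $\mu$. Assume $p_n\gg n^{-1/2}$ and $|\theta|<1$. Then, as $n\to\infty$, conditionally on $G_n$: (a) (Sample mean) $$\frac1{\sqrt n}\sum_{i=1}^n(\sigma_i-u_i)\,\Big|\,c\ \xrightarrow{d}\ N\Big(0,\frac{\mathbb E_F\psi''(c_1)}{1-\theta\,\mathbb E_F\psi''(c_1)}\Big),$$ $$\frac1{\sqrt n}\sum_{i=1}^n\sigma_i\ \xrightarrow{d}\ N\Big(0,\frac{\mathbb E_F\psi''(c_1)}{1-\theta\,\mathbb E_F\psi''(c_1)}+\frac{\mathbb E_F[\psi'(c_1)^2]}{(1-\theta\,\mathbb E_F\psi''(c_1))^2}\Big).$$ (b) (Contrasts) If $q=q^{(n)}\in\mathbb R^n$ satisfies $\|q\|=1$, $\sum_{i=1}^nq_i=o(\sqrt{np_n})$ and $\|q\|_\infty\to0$, then $$\sum_{i=1}^nq_i(\sigma_i-u_i)\,\Big|\,c\ \xrightarrow{d}\ N\big(0,\mathbb E_F\psi''(c_1)\big),\qquad\sum_{i=1}^nq_i\sigma_i\ \xrightarrow{d}\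 N\big(0,\mathbb E_F\psi''(c_1)+\mathbb E_F[\psi'(c_1)^2]\big).$$
   Context: Model: $\mu$ is a fixed non-degenerate probability measure supported on $[-1,1]$ with both $-1$ and $1$ in its support. The quadratic interaction model with coupling matrix $A_n$ (real symmetric, zero diagonal), field $c$ and base measure $\mu$ is the law on $[-1,1]^n$ with density $\frac1{Z_n}\exp(\frac12\boldsymbol\sigma^\top A_n\boldsymbol\sigma+c^\top\boldsymbol\sigma)$ with respect to $\mu^{\otimes n}$. The field $c$ is independent of $G_n$, $\mathbb E_F$ is expectation over $c$, and $q$ is deterministic. $\psi(\theta)=\log\int e^{\theta z}\,d\mu(z)$. $\|\cdot\|,\|\cdot\|_\infty$ are the $\ell_2$, $\ell_\infty$ norms. $a_n\gg b_n$ means $b_n/a_n\to0$. Mean-Field optimizer: $\phi:(-1,1)\to\mathbb R$ is the inverse of $\psi':\mathbb R\to(-1,1)$, $I(z)=z\phi(z)-\psi(\phi(z))$ (extended to $\pm1$ by its limits in $[0,\infty]$), and $u=u(A_n,c)$ is the maximizer over $[-1,1]^n$ of $z\mapsto\frac12z^\top A_nz+z^\top c-\sum_iI(z_i)$. It is unique when the $\ell_2$ operator norm of $A_n$ is less than $1$ (which here holds with probability tending to one); otherwise choose any maximizer. Convergence: all statements are conditional on $G_n$. ''$X_n\mid c\xrightarrow{d}\nu$'' means that the Kolmogorov–Smirnov distance between the conditional law of $X_n$ given $(c,G_n)$ and $\nu$ tends to $0$ in probability; ''$X_n\xrightarrow{d}\nu$'' means that the Kolmogorov–Smirnov distance between the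 conditional law of $X_n$ given $G_n$ (with $c$ averaged out) and $\nu$ tends to $0$ in probability. *)

(* Defs.v *)
From HB Require Import structures.
From mathcomp Require Import all_boot all_order all_algebra.
From mathcomp Require Import all_classical all_reals all_analysis.
From mathcomp Require Import measurable_realfun.

Set Implicit Arguments.
Unset Strict Implicit.
Unset Printing Implicit Defensive.

Import Order.TTheory GRing.Theory Num.Theory.
Import numFieldNormedType.Exports.

Local Open Scope classical_set_scope.
Local Open Scope ring_scope.

Section iid.
Context d (T : measurableType d) (R : realType).

Definition tcons n (x : T * n.-tuple T) : n.+1.-tuple T :=
  [tuple of x.1 :: x.2].

Lemma measurable_tcons n : measurable_fun [set: T * n.-tuple T] (@tcons n).
Proof. exact: measurable_cons. Qed.

HB.instance Definition _ n :=
  isMeasurableFun.Build _ _ _ _ (@tcons n) (@measurable_tcons n).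

Fixpoint iid (P : probability T R) n : probability (n.-tuple T) R :=
  if n is m.+1 then distribution (P \x iid P m)%E (@tcons m)
  else dirac [tuple].

End iid.

Section gibbs.
Context (R : realType).
Implicit Types mu : probability (measurableTypeR R) R.

Definition quad_form n (A : 'M[R]_n) (x : n.-tuple R) : R :=
  \sum_(i < n) \sum_(j < n) tnth x i * A i j * tnth x j.

Definition hamiltonian n (A : 'M[R]_n) (c s : n.-tuple R) : R :=
  2^-1 * quad_form A s + \sum_(i < n) tnth c i * tnth s i.

Lemma measurable_hamiltonian n (A : 'M[R]_n) (c : n.-tuple R) :
  measurable_fun [set: n.-tuple (measurableTypeR R)] (hamiltonian A c).
Proof.
apply: measurable_funD.
  apply: measurable_funM => //; apply: measurable_sum => i.
  apply: measurable_sum => j; apply: measurable_funM; last exact: measurable_tnth.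
  by apply: measurable_funM => //; exact: measurable_tnth.
apply: measurable_sum => i; apply: measurable_funM => //.
exact: measurable_tnth.
Qed.

Definition gibbs_weight mu n (A : 'M[R]_n) (c : n.-tuple R)
    (B : set (n.-tuple (measurableTypeR R))) : \bar R :=
  (\int[iid mu n]_(s in B) (expR (hamiltonian A c s))%:E)%E.

Section gibbs_weight_measure.
Variables (mu : probability (measurableTypeR R) R) (n : nat).
Variables (A : 'M[R]_n) (c : n.-tuple R).

Let gibbs_weight0 : gibbs_weight mu A c set0 = 0%E.
Proof. exact: integral_set0. Qed.

Let gibbs_weight_ge0 B : (0 <= gibbs_weight mu A c B)%E.
Proof. by apply: integral_ge0 => s _; rewrite lee_fin expR_ge0. Qed.

Let gibbs_weight_sigma_additive : semi_sigma_additive (gibbs_weight mu A c).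
Proof.
move=> B mB tB mUB; rewrite /gibbs_weight ge0_integral_bigcup//=.
- by apply: is_cvg_ereal_nneg_natsum_cond => k _ _; exact: gibbs_weight_ge0.
- apply/measurable_EFinP; apply: measurable_funTS.
  exact: measurableT_comp (measurable_hamiltonian A c).
Qed.

HB.instance Definition _ := isMeasure.Build _ _ _ (gibbs_weight mu A c)
  gibbs_weight0 gibbs_weight_ge0 gibbs_weight_sigma_additive.

End gibbs_weight_measure.

(* The second argument of [mnormalize] is a default value, used only when the
   normalizing constant is [0] or [+oo]; this does not happen if [mu] is
   carried by [[-1, 1]]. *)
Definition gibbs mu n (A : 'M[R]_n) (c : n.-tuple R) :
    probability (n.-tuple (measurableTypeR R)) R :=
  mnormalize (gibbs_weight mu A c) (iid mu n).

Definition measure_support mu : set R :=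
  [set x | forall e : R, 0 < e -> (0 < mu (ball x e))%E].

Definition base_measure mu : Prop :=
  [/\ forall a : R, mu [set a] != 1%E,
      mu `[-1, 1]%classic = 1%E,
      measure_support mu (-1) & measure_support mu 1].

Definition psi mu (t : R) : R := ln (fine ('M_mu idfun t)).
Definition dpsi mu : R -> R := (psi mu)^`()%classic.
Definition ddpsi mu : R -> R := (dpsi mu)^`()%classic.

Definition phi mu (z : R) : R := xget 0 [set t | dpsi mu t = z].

Definition rate_int mu (z : R) : R := z * phi mu z - psi mu (phi mu z).

(* The value outside [[-1, 1]] is irrelevant. *)
Definition rate mu (z : R) : \bar R :=
  if `|z| < 1 then (rate_int mu z)%:E
  else if z == 1 then lim ((rate_int mu x)%:E @[x --> (1 : R)^'-])
  else if z == -1 then lim ((rate_int mu x)%:E @[x --> (-1 : R)^'+])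
  else +oo%E.

Definition mf_objective mu n (A : 'M[R]_n) (c z : n.-tuple R) : \bar R :=
  ((hamiltonian A c z)%:E - \sum_(i < n) rate mu (tnth z i))%E.

Definition in_cube n (z : n.-tuple R) : Prop :=
  forall i, -1 <= tnth z i <= 1.

Definition mf_optimizer mu n (A : 'M[R]_n) (c u : n.-tuple R) : Prop :=
  in_cube u /\
  forall z, in_cube z -> (mf_objective mu A c z <= mf_objective mu A c u)%E.

End gibbs.

Section random_graph.
Context (R : realType).

(* Of an [n * n] array of independent coins, only the entries strictly above
   the diagonal are used: they decide the edges. *)
Definition edge n (w : n.-tuple (n.-tuple bool)) (i j : 'I_n) : bool :=
  if (i < j)%N then tnth (tnth w i) j
  else if (j < i)%N then tnth (tnth w j) i
  else false.

Definition adjacency n (w : n.-tuple (n.-tuple bool)) : 'M[R]_n :=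
  \matrix_(i, j) (edge w i j)%:R.

Definition erdos_renyi n (p : R) : probability (n.-tuple (n.-tuple bool)) R :=
  iid (iid (bernoulli_prob p) n) n.

Definition coupling (theta p : R) n (w : n.-tuple (n.-tuple bool)) : 'M[R]_n :=
  (theta / (n%:R * p)) *: adjacency w.

End random_graph.

Section convergence.
Context (R : realType).

Definition ks_distance (P Q : set R -> \bar R) : \bar R :=
  ereal_sup (range (fun t : R => `|P `]-oo, t]%classic - Q `]-oo, t]%classic|%E)).

(* The outer measure agrees with [P n] on measurable events; with it no
   measurability of [X n] has to be assumed. *)
Definition cvg0_in_probability (d : nat -> measure_display)
    (T : forall n, measurableType (d n)) (P : forall n, probability (T n) R)
    (X : forall n, T n -> \bar R) : Prop :=
  forall e : R, 0 < e ->
    mu_ext (P n) [set w | (e%:E < X n w)%E] @[n --> \oo] --> 0%E.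

(* [normal_prob] takes the standard deviation. *)
Definition gaussian (v : R) : set R -> \bar R := normal_prob 0 (Num.sqrt v).

(* The fields [c] are drawn from [iid F n], independently of the graph, and
   [gibbs] is the conditional law of the spins given the graph and [c]. *)
Definition law_given_field mu n (A : 'M[R]_n) (c : n.-tuple R)
    (X : n.-tuple R -> R) : set R -> \bar R :=
  fun B => gibbs mu A c (X @^-1` B).

Definition law_averaged mu (F : probability (measurableTypeR R) R) n
    (A : 'M[R]_n) (X : n.-tuple R -> R) : set R -> \bar R :=
  fun B => (\int[iid F n]_c gibbs mu A c (X @^-1` B))%E.

Definition cvg_normal_given_field mu (F : probability (measurableTypeR R) R)
    (theta : R) (p : nat -> R)
    (X : forall n, 'M[R]_n -> n.-tuple R -> n.-tuple R -> R) (v : R) : Prop :=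
  cvg0_in_probability
    (fun n => (erdos_renyi n (p n) \x iid F n)%E)
    (fun n w => let A := coupling theta (p n) w.1 in
       ks_distance (law_given_field mu A w.2 (X n A w.2)) (gaussian v)).

Definition cvg_normal_averaged mu (F : probability (measurableTypeR R) R)
    (theta : R) (p : nat -> R) (X : forall n, n.-tuple R -> R) (v : R) : Prop :=
  cvg0_in_probability
    (fun n => erdos_renyi n (p n))
    (fun n w => ks_distance
       (law_averaged mu F (coupling theta (p n) w) (X n)) (gaussian v)).

End convergence.

(* Main.v *)
(* Write [m = A sigma] and [xi_i = sigma_i - psi' (c_i + m_i)]. Given the other
   spins, [sigma_i] has the law [mu] tilted by [c_i + m_i], so [xi_i] is orthogonal
   to every function of the other spins. Together with the contraction given by
   [sum_j |A_ij| <= rho < 1], this bounds the second moments of [m] by the entries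
   of [A], and a Taylor expansion of [psi'] gives
     sum_i q_i sigma_i = Y(c) + lam sum_i q_i xi_i + small,
     Y(c) = lam sum_i q_i psi' (c_i),
   where [lam q] solves [v = q + kappa A v] up to a small error, and
   [kappa = E psi'' (c_1)]: [lam = 1 / (1 - theta kappa)] for the sample mean and
   [lam = 1] for contrasts. The same expansion with the Mean-Field optimizer,
   which solves [u_i = psi' (c_i + (A u)_i)], shows that [sum_i q_i u_i] is close
   to [Y(c)]. By Stein's method, the orthogonality of [xi_i] turns the linear
   expansion into [f' = - V t f + small] for the conditional characteristic
   function [f], with [V = lam kappa]; the errors are small in [L^1] over the
   field. Averaging over the field adds the independent fluctuation of [Y(c)], of
   variance [lam^2 E psi'(c_1)^2].
     The graph only enters through its degrees, bounded by a Chernoff estimate,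
   and through [A q], bounded in second moment; this is where [n p^2 -> oo] is
   used. Characteristic functions control the Kolmogorov-Smirnov distance through
   trigonometric polynomials close to a step function. *)
Require Import Defs.
From HB Require Import structures.
From mathcomp Require Import all_boot all_order all_algebra.
From mathcomp Require Import all_classical all_reals all_analysis.
From mathcomp Require Import measurable_realfun.
From mathcomp Require Import ring lra.

Set Implicit Arguments.
Unset Strict Implicit.
Unset Printing Implicit Defensive.

Import Order.TTheory GRing.Theory Num.Theory.
Import numFieldNormedType.Exports.

Local Open Scope classical_set_scope.
Local Open Scope ring_scope.


(** * Bounded measurable functions and their means *)

(** The obstacle is the sum of [|residual i| * |m i|], where no cancellation is available: the
    second moments of the [n] coordinates of [m] add up to order [n * a], which is of order [1 / p]
    and may diverge. So the squared norm of the averaged residual must stay small after division by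
    [p]. Its part due to the randomness of the edges has squared norm of order [1 / (n p)], hence
    the condition [n p^2 -> oo]. Its deterministic part is cancelled, up to the missing diagonal, by
    the choice of [lam] for the sample mean, and is small for contrasts because
    [sum_i q_i = o(sqrt (n p))]. All errors are measured by one parameter [delta], and the limits
    hold uniformly over the matrices and vectors that satisfy the inequalities of
    [regular_coupling]; the graph then only has to satisfy these inequalities with high probability.
    Characteristic functions appear as cosines with an arbitrary phase. The phase covers the sine
    part, and it also lets the conditional estimate absorb the random centre [t * Y(c)] before the
    field is averaged. *)

Section bounded_measurable.
Context d (T : measurableType d) (R : realType).
Implicit Types f g : T -> R.

(** Boundedness holds at every point, so that sums, products and sections need no integrability side
    condition; spins meet it once they are clamped. *)
Definition bmeas f :=
  measurable_fun [set: T] f /\ exists M, forall x, `|f x| <= M.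

Lemma bmeas_cst (a : R) : bmeas (fun=> a).
Proof. by split => //; exists `|a|. Qed.

Lemma bmeasD f g : bmeas f -> bmeas g -> bmeas (fun x => f x + g x).
Proof.
move=> [mf [M fM]] [mg [N gN]]; split; first exact: measurable_funD.
by exists (M + N) => x; rewrite (le_trans (ler_normD _ _))// lerD.
Qed.

Lemma bmeasN f : bmeas f -> bmeas (fun x => - f x).
Proof.
move=> [mf [M fM]]; split; first exact: measurableT_comp.
by exists M => x; rewrite normrN.
Qed.

Lemma bmeasB f g : bmeas f -> bmeas g -> bmeas (fun x => f x - g x).
Proof. by move=> mf mg; apply: bmeasD => //; exact: bmeasN. Qed.

Lemma bmeasM f g : bmeas f -> bmeas g -> bmeas (fun x => f x * g x).
Proof.
move=> [mf [M fM]] [mg [N gN]]; split; first exact: measurable_funM.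
by exists (M * N) => x; rewrite normrM ler_pM.
Qed.

Lemma bmeasZ (a : R) f : bmeas f -> bmeas (fun x => a * f x).
Proof. by move=> mf; apply: bmeasM => //; exact: bmeas_cst. Qed.

Lemma bmeasX n f : bmeas f -> bmeas (fun x => f x ^+ n).
Proof.
move=> mf; elim: n => [|n IHn]; first exact: bmeas_cst.
by under eq_fun do rewrite exprS; exact: bmeasM.
Qed.

Lemma bmeas_norm f : bmeas f -> bmeas (fun x => `|f x|).
Proof.
move=> [mf [M fM]]; split; first exact: measurableT_comp.
by exists M => x; rewrite normr_id.
Qed.

Lemma bmeas_sum (I : Type) (r : seq I) (F : I -> T -> R) :
  (forall i, bmeas (F i)) -> bmeas (fun x => \sum_(i <- r) F i x).
Proof.
move=> mF; elim: r => [|i r IHr].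
  by under eq_fun do rewrite big_nil; exact: bmeas_cst.
by under eq_fun do rewrite big_cons; exact: bmeasD.
Qed.

Lemma bmeas_comp (h : R -> R) f : measurable_fun [set: T] f ->
  measurable_fun [set: R] h -> (exists M, forall x, `|h x| <= M) ->
  bmeas (fun x => h (f x)).
Proof.
move=> mf mh [M hM]; split; first exact: measurableT_comp mh mf.
by exists M.
Qed.

Lemma bmeas_cos f : measurable_fun [set: T] f -> bmeas (fun x => cos (f x)).
Proof.
move=> mf; apply: (bmeas_comp (h := cos)) => //.
  by apply: continuous_measurable_fun; exact: continuous_cos.
by exists 1 => x; exact: cos_max.
Qed.

Lemma bmeas_sin f : measurable_fun [set: T] f -> bmeas (fun x => sin (f x)).
Proof.
move=> mf; apply: (bmeas_comp (h := sin)) => //.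
  by apply: continuous_measurable_fun; exact: continuous_sin.
by exists 1 => x; exact: sin_max.
Qed.

Lemma bmeas_expR f : bmeas f -> bmeas (fun x => expR (f x)).
Proof.
move=> [mf [M fM]]; split; first exact: measurableT_comp.
exists (expR M) => x; rewrite ger0_norm ?expR_ge0// ler_expR.
by rewrite (le_trans (ler_norm _)).
Qed.

Lemma bmeas_indic (A : set T) : measurable A -> bmeas (\1_A : T -> R).
Proof.
move=> mA; split; first exact: measurable_indic.
by exists 1 => x; rewrite indicE; case: (x \in A); rewrite ?normr1// normr0.
Qed.

End bounded_measurable.

Lemma indic_bounds (T : Type) (R : realType) (B : set T) x :
  0 <= (\1_B x : R) <= 1.
Proof. by rewrite indicE; case: (x \in B); rewrite ?lexx ?ler01. Qed.

Lemma bmeas_comp_measurable d1 d2 (T1 : measurableType d1)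
  (T2 : measurableType d2) (R : realType) (X : T1 -> T2) (f : T2 -> R) :
  measurable_fun [set: T1] X -> bmeas f -> bmeas (fun x => f (X x)).
Proof.
move=> mX [mf [M fM]]; split; first exact: measurableT_comp.
by exists M.
Qed.

(* A normalized positive linear functional on bounded measurable functions:
   this covers at once Gibbs expectations (ratios of integrals), their averages
   over the field, and the Gaussian law. *)
Definition is_mean d (T : measurableType d) (R : realType)
    (L : (T -> R) -> R) :=
  [/\ forall f g, bmeas f -> bmeas g -> L (fun x => f x + g x) = L f + L g,
      forall a f, bmeas f -> L (fun x => a * f x) = a * L f,
      forall f g, bmeas f -> bmeas g -> (forall x, f x <= g x) -> L f <= L g
    & L (fun=> 1) = 1].

Section mean_theory.
Context d (T : measurableType d) (R : realType) (L : (T -> R) -> R).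
Hypothesis LM : is_mean L.
Implicit Types f g : T -> R.

Lemma meanD f g : bmeas f -> bmeas g -> L (fun x => f x + g x) = L f + L g.
Proof. by case: LM => + _ _ _; exact. Qed.

Lemma meanZ a f : bmeas f -> L (fun x => a * f x) = a * L f.
Proof. by case: LM => _ + _ _; exact. Qed.

Lemma mean_le f g : bmeas f -> bmeas g -> (forall x, f x <= g x) -> L f <= L g.
Proof. by case: LM => _ _ + _; exact. Qed.

Lemma mean_cst a : L (fun=> a) = a.
Proof.
have := meanZ a (bmeas_cst T (1 : R)).
by case: LM => _ _ _ ->; rewrite mulr1.
Qed.

Lemma meanN f : bmeas f -> L (fun x => - f x) = - L f.
Proof.
by move=> mf; rewrite -mulN1r -meanZ//; congr L; apply/funext => x; rewrite mulN1r.
Qed.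

Lemma meanB f g : bmeas f -> bmeas g -> L (fun x => f x - g x) = L f - L g.
Proof. by move=> mf mg; rewrite meanD ?meanN//; exact: bmeasN. Qed.

Lemma mean_sum (I : Type) (r : seq I) (F : I -> T -> R) :
  (forall i, bmeas (F i)) ->
  L (fun x => \sum_(i <- r) F i x) = \sum_(i <- r) L (F i).
Proof.
move=> mF; elim: r => [|i r IHr].
  by rewrite big_nil -[RHS]mean_cst; congr L; apply/funext => x; rewrite big_nil.
rewrite big_cons -IHr -meanD//; last exact: bmeas_sum.
by congr L; apply/funext => x; rewrite big_cons.
Qed.

Lemma mean_ge0 f : bmeas f -> (forall x, 0 <= f x) -> 0 <= L f.
Proof. by move=> mf f0; rewrite -(mean_cst 0) mean_le//; exact: bmeas_cst. Qed.

Lemma mean_le_cst f M : bmeas f -> (forall x, f x <= M) -> L f <= M.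
Proof. by move=> mf fM; rewrite -(mean_cst M) mean_le//; exact: bmeas_cst. Qed.

Lemma mean_norm f : bmeas f -> `|L f| <= L (fun x => `|f x|).
Proof.
move=> mf; have mnf := bmeas_norm mf.
rewrite ler_norml -meanN//; apply/andP; split; apply: mean_le => //.
- exact: bmeasN.
- by move=> x; rewrite lerNl -normrN ler_norm.
- by move=> x; exact: ler_norm.
Qed.

Lemma mean_norm_le f g : bmeas f -> bmeas g -> (forall x, `|f x| <= g x) ->
  `|L f| <= L g.
Proof.
move=> mf mg fg; rewrite (le_trans (mean_norm mf))// mean_le//.
exact: bmeas_norm.
Qed.

Lemma mean_norm_le_cst f M : bmeas f -> (forall x, `|f x| <= M) -> `|L f| <= M.
Proof.
by move=> mf fM; rewrite -(mean_cst M) mean_norm_le//; exact: bmeas_cst.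
Qed.

(** The variance of [|f|] is non-negative. *)
Lemma mean_abs_sqr f : bmeas f -> L (fun x => `|f x|) ^+ 2 <= L (fun x => f x ^+ 2).
Proof.
move=> mf; have mnf := bmeas_norm mf; set a := L (fun x => `|f x|).
have : 0 <= L (fun x => (`|f x| - a) ^+ 2).
  apply: mean_ge0 => [|x]; last exact: sqr_ge0.
  by apply: bmeasX; apply: bmeasB => //; exact: bmeas_cst.
rewrite (_ : (fun x => _) = (fun x => f x ^+ 2 + ((-2 * a) * `|f x| + a ^+ 2))).
  rewrite meanD; [|exact: bmeasX|apply: bmeasD; [exact: bmeasZ|exact: bmeas_cst]].
  rewrite meanD; [|exact: bmeasZ|exact: bmeas_cst].
  by rewrite meanZ// mean_cst -/a; nra.
apply/funext => x; rewrite -[f x ^+ 2]real_normK ?num_real//; ring.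
Qed.

Lemma mean_abs_le_sqrt f M : 0 <= M -> bmeas f -> L (fun x => f x ^+ 2) <= M ->
  L (fun x => `|f x|) <= Num.sqrt M.
Proof.
move=> M0 mf fM; rewrite -(ler_pXn2r (n := 2))//; last first.
- by rewrite nnegrE sqrtr_ge0.
- by rewrite nnegrE mean_ge0//; exact: bmeas_norm.
by rewrite sqr_sqrtr// (le_trans (mean_abs_sqr mf)).
Qed.

End mean_theory.

Section expectation.
Context d (T : measurableType d) (R : realType) (P : probability T R).

Definition expect (f : T -> R) : R := \int[P]_x f x.

Lemma bmeas_integrable f : bmeas f -> P.-integrable [set: T] (EFin \o f).
Proof.
move=> [mf [M fM]]; apply: measurable_bounded_integrable => //.
  by rewrite (le_lt_trans (probability_le1 _ _))// ltry.
by exists M; split => [|x Mx y _]; [exact: num_real|exact: le_trans (fM y) (ltW Mx)].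
Qed.

Lemma expect_mean : is_mean expect.
Proof.
split.
- by move=> f g mf mg; rewrite /expect RintegralD//; exact: bmeas_integrable.
- by move=> a f mf; rewrite /expect RintegralZl//; exact: bmeas_integrable.
- by move=> f g mf mg fg; apply: le_Rintegral => //; exact: bmeas_integrable.
- by rewrite /expect (Rintegral_cst P measurableT) mul1r [X in fine X]probability_setT.
Qed.

Lemma integral_expect f : bmeas f -> (\int[P]_x (f x)%:E = (expect f)%:E)%E.
Proof.
move=> mf; rewrite /expect /Rintegral fineK//.
by apply: integrable_fin_num => //; exact: bmeas_integrable.
Qed.

Lemma expect_indic A : measurable A -> expect \1_A = fine (P A).
Proof. by move=> mA; rewrite /expect /Rintegral integral_indic// setIT. Qed.

End expectation.

Section weighted_mean.
Context d (T : measurableType d) (R : realType) (P : probability T R).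

Definition wexpect (w f : T -> R) : R :=
  expect P (fun x => f x * w x) / expect P w.

Lemma wexpect_mean w : bmeas w -> (forall x, 0 <= w x) -> 0 < expect P w ->
  is_mean (wexpect w).
Proof.
have EM := expect_mean P.
move=> mw w0 Ew0; rewrite /wexpect; split.
- move=> f g mf mg; rewrite -mulrDl -(meanD EM); try exact: bmeasM.
  by congr (_ / _); congr expect; apply/funext => x; rewrite mulrDl.
- move=> a f mf; rewrite mulrA -(meanZ EM); try exact: bmeasM.
  by congr (_ / _); congr expect; apply/funext => x; rewrite mulrA.
- move=> f g mf mg fg; rewrite ler_pM2r ?invr_gt0// (mean_le EM)//; try exact: bmeasM.
  by move=> x; rewrite ler_wpM2r.
- rewrite (_ : (fun x => 1 * w x) = w) ?divff ?gt_eqF//.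
  by apply/funext => x; rewrite mul1r.
Qed.

End weighted_mean.

Lemma mean_pushforward d1 d2 (T1 : measurableType d1) (T2 : measurableType d2)
  (R : realType) (L : (T1 -> R) -> R) (X : T1 -> T2) :
  is_mean L -> measurable_fun [set: T1] X -> is_mean (fun f => L (fun x => f (X x))).
Proof.
move=> LM mX; have mc := bmeas_comp_measurable mX; split.
- by move=> f g /mc mf /mc mg; rewrite (meanD LM).
- by move=> a f /mc mf; rewrite (meanZ LM).
- by move=> f g /mc mf /mc mg fg; rewrite (mean_le LM).
- by rewrite (mean_cst LM).
Qed.

Section product_expectation.
Context d1 d2 (T1 : measurableType d1) (T2 : measurableType d2) (R : realType).
Variables (P1 : probability T1 R) (P2 : probability T2 R).

Lemma bmeas_section (f : T1 * T2 -> R) x : bmeas f -> bmeas (fun y => f (x, y)).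
Proof.
move=> [mf [M fM]]; split; last by exists M.
by apply: measurableT_comp mf _; exact: measurable_pair1.
Qed.

Lemma bmeas_sectionr (f : T1 * T2 -> R) y : bmeas f -> bmeas (fun x => f (x, y)).
Proof.
move=> [mf [M fM]]; split; last by exists M.
by apply: measurableT_comp mf _; exact: measurable_pair2.
Qed.

Lemma bmeas_expect (f : T1 * T2 -> R) :
  bmeas f -> bmeas (fun x => expect P2 (fun y => f (x, y))).
Proof.
move=> mf; have [_ [M fM]] := mf; split.
  have := measurable_fubini_F (bmeas_integrable (P1 \x P2)%E mf).
  rewrite /fubini_F => mF.
  apply/measurable_EFinP; apply: eq_measurable_fun mF => x _ /=.
  by rewrite integral_expect//; exact: bmeas_section.
exists M => x; apply: (mean_norm_le_cst (expect_mean P2)) => [|y]; last exact: fM.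
exact: bmeas_section.
Qed.

Lemma expect_fubini (f : T1 * T2 -> R) : bmeas f ->
  expect (P1 \x P2)%E f = expect P1 (fun x => expect P2 (fun y => f (x, y))).
Proof.
move=> mf; apply: EFin_inj; rewrite -!integral_expect//; last exact: bmeas_expect.
rewrite -(integral12_prod_meas1 (bmeas_integrable (P1 \x P2)%E mf)).
by apply: eq_integral => x _; rewrite /fubini_F -integral_expect//; exact: bmeas_section.
Qed.

End product_expectation.

(** * Resampling a coordinate of an i.i.d. tuple *)

Definition upd (T : Type) n (s : n.-tuple T) (i : 'I_n) (z : T) : n.-tuple T :=
  [tuple if j == i then z else tnth s j | j < n].

Lemma tnth_upd (T : Type) n (s : n.-tuple T) i z j :
  tnth (upd s i z) j = if j == i then z else tnth s j.
Proof. by rewrite tnth_mktuple. Qed.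

Section iid_expectation.
Context d (T : measurableType d) (R : realType) (P : probability T R).

Lemma expect_swap d2 (T2 : measurableType d2) (P2 : probability T2 R)
  (f : T * T2 -> R) : bmeas f ->
  expect P (fun x => expect P2 (fun y => f (x, y))) =
  expect P2 (fun y => expect P (fun x => f (x, y))).
Proof.
move=> mf; rewrite -expect_fubini//; apply: EFin_inj.
have mG : bmeas (fun z : T2 * T => f (z.2, z.1)).
  apply: (bmeas_comp_measurable (X := fun z : T2 * T => (z.2, z.1))) mf.
  exact: measurable_fun_pair.
rewrite -!integral_expect//; last exact: (bmeas_expect P2 P mG).
rewrite -(integral21_prod_meas1 (bmeas_integrable (P \x P2)%E mf)).
by apply: eq_integral => x _; rewrite /fubini_G -integral_expect//; exact: bmeas_sectionr.
Qed.

Lemma expect_iidS n (f : n.+1.-tuple T -> R) : bmeas f ->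
  expect (iid P n.+1) f =
  expect P (fun z => expect (iid P n) (fun s => f (tcons (z, s)))).
Proof.
move=> mf; have mt := @measurable_tcons _ T n.
rewrite -(expect_fubini P (iid P n) (bmeas_comp_measurable mt mf)).
apply: EFin_inj; rewrite -!integral_expect//; last exact: bmeas_comp_measurable.
rewrite [iid P n.+1]/= /distribution integral_pushforward//=.
have [mf' _] := mf; exact/measurable_EFinP.
apply: bmeas_integrable; exact: bmeas_comp_measurable.
Qed.

Lemma measurable_upd n (i : 'I_n) :
  measurable_fun [set: n.-tuple T * T] (fun x => upd x.1 i x.2).
Proof.
apply/measurable_fun_tnthP => j /=.
rewrite (_ : _ \o _ = fun x : n.-tuple T * T => if j == i then x.2 else tnth x.1 j).
  case: (j == i); first exact: measurable_snd.
  exact: (measurableT_comp (measurable_tnth (T := T) j) (measurable_fst (T1 := n.-tuple T) (T2 := T))).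
by apply/funext => x /=; rewrite tnth_upd.
Qed.

Lemma bmeas_upd n (i : 'I_n) (f : n.-tuple T -> R) s :
  bmeas f -> bmeas (fun z => f (upd s i z)).
Proof.
move=> mf; apply: bmeas_comp_measurable mf.
exact: (measurableT_comp (measurable_upd i) (measurable_pair1 s)).
Qed.

(** The form in which independence enters: orthogonality in i.i.d. sums, the conditional law of one
    spin and the resampling of one edge are all read off from it. *)
Lemma expect_resample n (i : 'I_n) (f : n.-tuple T -> R) : bmeas f ->
  expect (iid P n) f =
  expect (iid P n) (fun s => expect P (fun z => f (upd s i z))).
Proof.
elim: n i f => [[]//|n IHn] i f mf.
have mfu : bmeas (fun x : n.+1.-tuple T * T => f (upd x.1 i x.2)).
  by apply: bmeas_comp_measurable mf; exact: measurable_upd.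
have mFu : bmeas (fun s : n.+1.-tuple T => expect P (fun z : T => f (upd s i z))).
  exact: (bmeas_expect (iid P n.+1) P mfu).
rewrite (expect_iidS mFu) (expect_iidS mf).
have EM := expect_mean P.
have [j ->|->] := unliftP ord0 i.
  congr expect; apply/funext => x.
  rewrite (IHn j); last first.
    apply: bmeas_comp_measurable mf.
    exact: (measurableT_comp (@measurable_tcons _ T n) (measurable_pair1 x)).
  congr expect; apply/funext => s; congr expect; apply/funext => z; congr f.
  apply: eq_from_tnth => k; rewrite tnth_upd.
  have [l ->|->] := unliftP ord0 k.
    by rewrite (inj_eq lift_inj) !tnthS tnth_upd.
  by rewrite !tnth0 eq_liftF.
(* Here the head is resampled: the head drawn first is overwritten, so its integral is that of a
   constant, and Fubini exchanges the two integrals that remain. *)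
transitivity (expect P (fun=> expect (iid P n) (fun s => expect P (fun z => f (tcons (z, s)))))).
  rewrite (mean_cst EM); apply: (expect_swap (iid P n) (f := fun x => f (tcons x))).
  by apply: bmeas_comp_measurable mf; exact: measurable_tcons.
congr expect; apply/funext => x; congr expect; apply/funext => s.
congr expect; apply/funext => z; congr f.
apply: eq_from_tnth => k; rewrite tnth_upd.
have [l ->|->] := unliftP ord0 k; last by rewrite eqxx tnth0.
by rewrite lift_eqF/= !tnthS.
Qed.

Definition indep_of n (i : 'I_n) (V : Type) (h : n.-tuple T -> V) :=
  forall s z, h (upd s i z) = h s.

Lemma expect_iid_indep n (i : 'I_n) (f : T -> R) (h : n.-tuple T -> R) :
  bmeas f -> bmeas h -> indep_of i h ->
  expect (iid P n) (fun s => f (tnth s i) * h s) =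
  expect P f * expect (iid P n) h.
Proof.
move=> mf mh hi; have mfi : bmeas (fun s : n.-tuple T => f (tnth s i)).
  by apply: bmeas_comp_measurable mf; exact: measurable_tnth.
rewrite (expect_resample i); last exact: bmeasM.
rewrite -(meanZ (expect_mean (iid P n)))//.
congr expect; apply/funext => s.
rewrite mulrC -(meanZ (expect_mean P))//.
by congr expect; apply/funext => z; rewrite hi tnth_upd eqxx mulrC.
Qed.

Lemma expect_iid_centered n (i : 'I_n) (f : T -> R) (h : n.-tuple T -> R) :
  bmeas f -> expect P f = 0 -> bmeas h -> indep_of i h ->
  expect (iid P n) (fun s => f (tnth s i) * h s) = 0.
Proof. by move=> mf f0 mh hi; rewrite expect_iid_indep// f0 mul0r. Qed.

Lemma expect_iid_tnth n (i : 'I_n) (f : T -> R) : bmeas f ->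
  expect (iid P n) (fun s => f (tnth s i)) = expect P f.
Proof.
move=> mf; have := expect_iid_indep mf (bmeas_cst _ 1) (i := i) (fun _ _ => erefl).
rewrite (mean_cst (expect_mean _)) mulr1 => <-.
by congr expect; apply/funext => s; rewrite mulr1.
Qed.

Lemma indep_of_tnth n (i j : 'I_n) : j != i -> indep_of i (fun s => tnth s j).
Proof. by move=> ji s z; rewrite tnth_upd (negbTE ji). Qed.

(* Orthogonality of the summands. *)
Lemma expect_iid_sum_sqr n (f : T -> R) (a : 'I_n -> R) :
  bmeas f -> (forall x, `|f x| <= 1) -> expect P f = 0 ->
  expect (iid P n) (fun s => (\sum_i a i * f (tnth s i)) ^+ 2) <= \sum_i a i ^+ 2.
Proof.
move=> mf f1 f0; have EM := expect_mean (iid P n).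
have mfi i : bmeas (fun s : n.-tuple T => f (tnth s i)).
  by apply: bmeas_comp_measurable mf; exact: measurable_tnth.
rewrite (_ : (fun s => _) =
  (fun s => \sum_i \sum_j (a i * a j) * (f (tnth s i) * f (tnth s j)))); last first.
  apply/funext => s; rewrite expr2 mulr_suml; apply: eq_bigr => i _.
  by rewrite mulr_sumr; apply: eq_bigr => j _; rewrite mulrACA.
have mij i j : bmeas (fun s : n.-tuple T => (a i * a j) * (f (tnth s i) * f (tnth s j))).
  by apply: bmeasZ; exact: bmeasM.
rewrite (mean_sum EM); last by move=> i; exact: bmeas_sum.
apply: ler_sum => i _; rewrite (mean_sum EM)// (bigD1 i)//= big1 ?addr0.
  rewrite (mean_le_cst EM)// => s; rewrite -!expr2 -exprMn -real_normK ?num_real//.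
  rewrite -[leRHS]real_normK ?num_real// ler_pXn2r ?nnegrE//.
  by rewrite normrM ler_piMr.
move=> j ji; rewrite (meanZ EM); last exact: bmeasM.
rewrite expect_iid_centered ?mulr0//.
by move=> s z; rewrite indep_of_tnth.
Qed.
End iid_expectation.

(** * Stein's method for characteristic functions *)

Section mean_value.
Context (R : realType).
Implicit Types (f df : R -> R) (a b x s t h K V delta : R).

(** A quadratic remainder bound survives any positive linear functional, so means can be
    differentiated in a parameter from a pointwise Taylor bound, without dominated convergence. *)
Lemma is_derive_quadratic f x l (K : R) :
  (forall h, `|h| <= 1 -> `|f (x + h) - f x - h * l| <= K * h ^+ 2) ->
  is_derive x 1 f l.
Proof.
move=> fK; have K0 : 0 <= K.
  have := fK 1; rewrite normr1 lexx expr1n mulr1 => /(_ isT).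
  exact: le_trans.
suff fxl : h^-1 *: (f (h *: 1 + x) - f x) @[h --> 0^'] --> l.
  apply: DeriveDef; first by apply/cvg_ex; exists l.
  exact/cvg_lim.
apply/cvgrPdist_le => e e0; near=> h.
have h0 : h != 0 by near: h; exact: nbhs_dnbhs_neq.
have hn0 : 0 < `|h| by rewrite normr_gt0.
rewrite scaler1 -[_ *: _]/(h^-1 * _).
rewrite -(@ler_pM2l _ `|h|)// -normrM mulrBr mulVKf// [h + x]addrC distrC.
have h1 : `|h| <= 1 by near: h; exact: dnbhs0_le.
rewrite (le_trans (fK h h1))// -real_normK ?num_real// expr2 mulrA mulrC ler_wpM2l//.
have : `|h| <= e / (K + 1).
  near: h; apply: dnbhs0_le; rewrite divr_gt0// ltr_wpDl//.
rewrite ler_pdivlMr ?ltr_wpDl// => /(le_trans _); apply.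
by rewrite mulrC ler_wpM2l// lerDl.
Unshelve. all: by end_near. Qed.

Lemma MVT_between f df a b : (forall x, is_derive x 1 f (df x)) ->
  exists2 c, (a <= c <= b) || (b <= c <= a) & f b - f a = df c * (b - a).
Proof.
move=> fd.
have cf x y : {within `[x, y], continuous f}.
  by apply: derivable_within_continuous => z _; exact: ex_derive.
have [ab|/ltW ba] := leP a b.
  have [c + ->] := MVT_segment ab (fun x _ => fd x) (cf _ _).
  by rewrite in_itv/= => cab; exists c => //; rewrite cab.
have [c + fE] := MVT_segment ba (fun x _ => fd x) (cf _ _).
rewrite in_itv/= => cab; exists c; first by rewrite cab orbT.
by rewrite -opprB fE -mulrN opprB.
Qed.

Lemma measurable_is_derive f df : (forall x, is_derive x 1 f (df x)) ->
  measurable_fun [set: R] f.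
Proof.
move=> fd; apply: continuous_measurable_fun => x.
apply/differentiable_continuous/derivable1_diffP.
exact: (@ex_derive _ _ _ _ _ _ _ (fd x)).
Qed.

Lemma lipschitz_derive f df K : (forall x, is_derive x 1 f (df x)) ->
  (forall x, `|df x| <= K) -> forall a b, `|f b - f a| <= K * `|b - a|.
Proof.
move=> fd fK a b; have [c _ ->] := MVT_between a b fd.
by rewrite normrM ler_wpM2r.
Qed.

Lemma taylor1 f df K : (forall x, is_derive x 1 f (df x)) ->
  (forall a b, `|df b - df a| <= K * `|b - a|) ->
  forall a h, `|f (a + h) - f a - h * df a| <= K * h ^+ 2.
Proof.
move=> fd dfK a h; have [c ca] := MVT_between a (a + h) fd.
have K0 : 0 <= K.
  by have := dfK 0 1; rewrite subr0 normr1 mulr1; apply: le_trans.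
rewrite addrAC subrr add0r => ->.
rewrite [_ * h]mulrC -mulrBr normrM -real_normK ?num_real// expr2 mulrCA.
rewrite ler_wpM2l// (le_trans (dfK _ _))// ler_wpM2l//.
case/orP: ca => /andP[ac cb].
  by rewrite !ger0_norm; lra.
by rewrite !ler0_norm; lra.
Qed.

Lemma is_derive_mul f g x a b : is_derive x 1 f a -> is_derive x 1 g b ->
  is_derive x 1 (fun y => f y * g y) (f x * b + g x * a).
Proof. by move=> fa gb; exact: (@is_deriveM _ _ f g x 1 a b). Qed.

Lemma is_derive_sub f g x a b : is_derive x 1 f a -> is_derive x 1 g b ->
  is_derive x 1 (fun y => f y - g y) (a - b).
Proof. by move=> fa gb; exact: (@is_deriveB _ _ _ f g x 1 a b). Qed.

Lemma cos_taylor (a h : R) : `|cos (a + h) - cos a - h * - sin a| <= h ^+ 2.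
Proof.
rewrite -[leRHS]mul1r; apply: (@taylor1 cos (fun x => - sin x)) => x y.
rewrite opprK addrC -normrN opprB; apply: (@lipschitz_derive sin cos) => z.
by rewrite cos_max.
Qed.

Lemma sin_taylor (a h : R) : `|sin (a + h) - sin a - h * cos a| <= h ^+ 2.
Proof.
rewrite -[leRHS]mul1r; apply: (@taylor1 sin cos) => x y.
apply: (@lipschitz_derive cos (fun x => - sin x)) => z.
by rewrite normrN sin_max.
Qed.

(* The hypothesis says that [f] nearly solves the differential equation
   [f' = - V t f] of the Gaussian characteristic function. *)
Lemma gaussian_ode f df V delta t : 0 <= V ->
  (forall s, is_derive s 1 f (df s)) ->
  (forall s, `|s| <= `|t| -> `|df s + V * s * f s| <= delta) ->
  `|f t - f 0 * expR (- (V * t ^+ 2 / 2))| <= `|t| * delta.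
Proof.
move=> V0 fd fV; pose E s : R := expR (V * s ^+ 2 / 2).
have Ed s : is_derive s 1 E (V * s * E s).
  have qd : is_derive s 1 (fun u => V * u ^+ 2 / 2) (V * s).
    apply: (is_derive_quadratic (K := V / 2)) => h _.
    rewrite (_ : _ - _ - _ = V / 2 * h ^+ 2); last by field.
    by rewrite ger0_norm// mulr_ge0 ?divr_ge0 ?sqr_ge0.
  by rewrite mulrC; exact: (is_derive1_comp (f := expR) (is_derive_expR _) qd).
(* [E] is an integrating factor: the derivative of [f * E] is [E] times the defect. Dividing by
   [E t] at the end costs nothing, since [E c <= E t] for [c] between 0 and [t]. *)
have gd s : is_derive s 1 (fun u => f u * E u) (E s * (df s + V * s * f s)).
  by apply: is_derive_eq (is_derive_mul (fd s) (Ed s)) _; ring.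
have [c ct] := MVT_between 0 t gd.
rewrite subr0 {2}/E expr0n/= mulr0 mul0r expR0 mulr1 => fE.
have ct' : `|c| <= `|t|.
  case/orP: ct => /andP[? ?]; first by rewrite !ger0_norm; lra.
  by rewrite !ler0_norm; lra.
have -> : f t - f 0 * expR (- (V * t ^+ 2 / 2)) = (f t * E t - f 0) / E t.
  by rewrite mulrBl mulfK ?gt_eqF ?expR_gt0// -expRN.
rewrite fE normrM [`|(E t)^-1|]ger0_norm ?invr_ge0 ?expR_ge0//.
rewrite ler_pdivrMr ?expR_gt0// !normrM [`|E c|]ger0_norm ?expR_ge0//.
rewrite mulrC -!mulrA ler_wpM2l// mulrC ler_pM// ?expR_ge0//.
  by rewrite mulrA; exact: fV.
rewrite ler_expR ler_pM2r// ler_wpM2l//.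
by rewrite -real_normK ?num_real// -[leRHS]real_normK ?num_real// ler_pXn2r ?nnegrE.
Qed.

End mean_value.

Section stein.
Context d (T : measurableType d) (R : realType) (L : (T -> R) -> R).
Hypothesis LM : is_mean L.
Variable X : T -> R.
Hypothesis mX : bmeas X.

Lemma bmeas_phase t phi : bmeas (fun w => t * X w + phi).
Proof. by apply: bmeasD; [exact: bmeasZ|exact: bmeas_cst]. Qed.

Lemma bmeas_cos_phase t phi : bmeas (fun w => cos (t * X w + phi)).
Proof. by apply: bmeas_cos; have [] := bmeas_phase t phi. Qed.

Lemma bmeas_sin_phase t phi : bmeas (fun w => sin (t * X w + phi)).
Proof. by apply: bmeas_sin; have [] := bmeas_phase t phi. Qed.

Lemma is_derive_mean_cos phi (t : R) :
  is_derive t 1 (fun t => L (fun w => cos (t * X w + phi)))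
    (- L (fun w => X w * sin (t * X w + phi))).
Proof.
apply: (is_derive_quadratic (K := L (fun w => X w ^+ 2))) => h _.
have mc t' := bmeas_cos_phase t' phi; have ms := bmeas_sin_phase t phi.
have mXs := bmeasM mX ms.
rewrite mulrN opprK -(meanB LM)// -(meanZ LM)// -(meanD LM); first last.
- exact: bmeasZ.
- exact: bmeasB.
rewrite mulrC -(meanZ LM); last exact: bmeasX.
apply: (mean_norm_le LM) => [| |w].
- by apply: bmeasD; [exact: bmeasB|exact: bmeasZ].
- by apply: bmeasZ; exact: bmeasX.
- have := cos_taylor (t * X w + phi) (h * X w).
  rewrite exprMn; congr (`|_| <= _); rewrite mulrN opprK mulrA.
  by congr (cos _ - _ + _); ring.
Qed.

Variables (n : nat) (q : 'I_n -> R) (x xi : 'I_n -> T -> R).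
Variables (lam V e1 e2 e3 : R).
Hypothesis mx : forall i, bmeas (x i).
Hypothesis mxi : forall i, bmeas (xi i).
Hypothesis x1 : forall i w, `|x i w| <= 1.
Hypothesis xi2 : forall i w, `|xi i w| <= 2.
Hypothesis xi_centered : forall i t phi,
  L (fun w => xi i w * sin (t * (X w - q i * x i w) + phi)) = 0.
Hypothesis X_approx : L (fun w => `|X w - lam * \sum_i q i * xi i w|) <= e1.
Hypothesis V_approx :
  L (fun w => `|lam * \sum_i q i ^+ 2 * (xi i w * x i w) - V|) <= e2.
Hypothesis q3 : \sum_i `|q i| ^+ 3 <= e3.

(** Leave-one-out: the sine at [X] is compared with the sine at [X - q i * x i], to which [xi i] is
    orthogonal. The first-order term of the difference produces the variance; the second-order term
    is paid by the cubes of [q]. *)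
Lemma stein_identity t phi :
  `|L (fun w => X w * sin (t * X w + phi)) -
    V * t * L (fun w => cos (t * X w + phi))| <=
  e1 + `|t| * e2 + 2 * `|lam| * t ^+ 2 * e3.
Proof.
pose S w := sin (t * X w + phi); pose C w := cos (t * X w + phi).
pose Si i w := sin (t * (X w - q i * x i w) + phi).
pose A w := X w - lam * \sum_i q i * xi i w.
pose B w := lam * \sum_i q i ^+ 2 * (xi i w * x i w) - V.
pose D w := lam * \sum_i q i * (xi i w * (S w - Si i w - t * (q i * x i w) * C w)).
have mS : bmeas S := bmeas_sin_phase t phi.
have mC : bmeas C := bmeas_cos_phase t phi.
have mqx i : bmeas (fun w => q i * x i w) by exact: bmeasZ.
have mSi i : bmeas (Si i).
  apply: bmeas_sin; have [] // : bmeas (fun w => t * (X w - q i * x i w) + phi).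
  by apply: bmeasD; [apply: bmeasZ; exact: bmeasB|exact: bmeas_cst].
have mA : bmeas A.
  by apply: bmeasB => //; apply: bmeasZ; apply: bmeas_sum => i; exact: bmeasZ.
have mB : bmeas B.
  apply: bmeasB; last exact: bmeas_cst.
  by apply: bmeasZ; apply: bmeas_sum => i; apply: bmeasZ; exact: bmeasM.
have mD : bmeas D.
  apply: bmeasZ; apply: bmeas_sum => i; apply: bmeasZ; apply: bmeasM => //.
  apply: bmeasB; first exact: bmeasB.
  by apply: bmeasM => //; exact: bmeasZ.
have mtCB : bmeas (fun w => t * (C w * B w)) by apply: bmeasZ; exact: bmeasM.
have mAS : bmeas (fun w => A w * S w) by exact: bmeasM.
have mrest : bmeas (fun w => lam * \sum_i q i * (xi i w * Si i w)).
  by apply: bmeasZ; apply: bmeas_sum => i; apply: bmeasZ; exact: bmeasM.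
have mabc : bmeas (fun w => A w * S w + D w + t * (C w * B w)).
  by apply: bmeasD => //; exact: bmeasD.
rewrite -(meanZ LM)// -(meanB LM); [|exact: bmeasM|exact: bmeasZ].
(* [A] is the linearization error of [X], [D] the second-order Taylor error, [B] the deviation of
   the empirical variance from [V]; the last sum has mean zero by [xi_centered]. *)
rewrite (_ : (fun w => _) = (fun w => (A w * S w + D w + t * (C w * B w)) +
   lam * \sum_i q i * (xi i w * Si i w))); last first.
  apply/funext => w; rewrite /A /B /D -/(S w) -/(C w).
  rewrite (_ : \sum_i q i * (xi i w * (S w - Si i w - t * (q i * x i w) * C w)) =
    (\sum_i q i * xi i w) * S w - \sum_i q i * (xi i w * Si i w)
      - t * C w * \sum_i q i ^+ 2 * (xi i w * x i w)); first by ring.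
  rewrite mulr_suml mulr_sumr -!sumrB; apply: eq_bigr => i _; ring.
rewrite (meanD LM)// (meanZ LM); last first.
  by apply: bmeas_sum => i; apply: bmeasZ; exact: bmeasM.
rewrite (mean_sum LM); last by move=> i; apply: bmeasZ; exact: bmeasM.
rewrite big1 ?mulr0 ?addr0; last first.
  by move=> i _; rewrite (meanZ LM) ?xi_centered ?mulr0//; exact: bmeasM.
have mnA := bmeas_norm mA; have mnB := bmeas_norm mB.
have mtnB : bmeas (fun w => `|t| * `|B w|) by exact: bmeasZ.
have mcst : bmeas (fun=> 2 * `|lam| * t ^+ 2 * e3 : R) := bmeas_cst T _.
have mAB : bmeas (fun w => `|A w| + `|t| * `|B w|) by exact: bmeasD.
have le_bound : L (fun w => `|A w| + `|t| * `|B w| + 2 * `|lam| * t ^+ 2 * e3) <=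
    e1 + `|t| * e2 + 2 * `|lam| * t ^+ 2 * e3.
  rewrite (meanD LM)// (meanD LM)// (meanZ LM)// (mean_cst LM) lerD2r lerD//.
  by rewrite ler_wpM2l.
apply: le_trans le_bound; apply: (mean_norm_le LM) => // [|w]; first exact: bmeasD.
have S1 : `|S w| <= 1 by exact: sin_max.
have C1 : `|C w| <= 1 by exact: cos_max.
rewrite [leRHS]addrAC (le_trans (ler_normD _ _))// lerD//; last first.
  by rewrite !normrM ler_wpM2l// ler_piMl.
rewrite (le_trans (ler_normD _ _))// lerD//; first by rewrite normrM ler_piMr.
have -> : 2 * `|lam| * t ^+ 2 * e3 = `|lam| * (2 * t ^+ 2 * e3) by ring.
rewrite /D normrM ler_wpM2l// (le_trans (ler_norm_sum _ _ _))//.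
have K0 : 0 <= 2 * t ^+ 2 by rewrite mulr_ge0 // sqr_ge0.
rewrite (le_trans _ (ler_wpM2l K0 q3))//.
rewrite mulr_sumr ler_sum// => i _; rewrite normrM.
have := sin_taylor (t * X w + phi) (- (t * (q i * x i w))).
rewrite (_ : t * X w + phi - _ = t * (X w - q i * x i w) + phi); last by ring.
rewrite -/(S w) -/(C w) -/(Si i w) mulNr opprK => Ti.
have {}Ti : `|S w - Si i w - t * (q i * x i w) * C w| <= t ^+ 2 * `|q i| ^+ 2.
  have -> : S w - Si i w - t * (q i * x i w) * C w =
    - (Si i w - S w + t * (q i * x i w) * C w) by ring.
  rewrite normrN (le_trans Ti)// sqrrN !exprMn ler_wpM2l ?sqr_ge0//.
  rewrite real_normK ?num_real// ler_piMr ?sqr_ge0//.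
  by rewrite -real_normK ?num_real// exprn_ile1.
rewrite normrM (_ : 2 * t ^+ 2 * _ = `|q i| * (2 * (t ^+ 2 * `|q i| ^+ 2))); last by ring.
by rewrite ler_wpM2l// ler_pM.
Qed.

Lemma stein_charfun t phi : 0 <= V -> 0 <= e2 -> 0 <= e3 ->
  `|L (fun w => cos (t * X w + phi)) - cos phi * expR (- (V * t ^+ 2 / 2))| <=
  `|t| * (e1 + `|t| * e2 + 2 * `|lam| * t ^+ 2 * e3).
Proof.
move=> V0 e20 e30.
have -> : cos phi = L (fun w => cos (0 * X w + phi)).
  by rewrite -[LHS](mean_cst LM); congr L; apply/funext => w; rewrite mul0r add0r.
have := gaussian_ode V0 (is_derive_mean_cos phi); apply => s st.
rewrite -normrN opprD opprK (le_trans (stein_identity s phi))//.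
rewrite -!addrA lerD2l lerD ?ler_wpM2r// -real_normK ?num_real//.
by rewrite ler_wpM2l ?mulr_ge0// -[leRHS]real_normK ?num_real// ler_pXn2r ?nnegrE.
Qed.

End stein.

(** * The log-Laplace transform of the base measure *)

Lemma ge0_integral_eq_on_full d (T : measurableType d) (R : realType)
  (P : probability T R) (B : set T) (f g : T -> \bar R) :
  measurable B -> P B = 1%E -> measurable_fun [set: T] f ->
  measurable_fun [set: T] g -> (forall x, 0 <= f x)%E -> (forall x, 0 <= g x)%E ->
  {in B, f =1 g} -> (\int[P]_x f x = \int[P]_x g x)%E.
Proof.
move=> mB PB mf mg f0 g0 fg; apply: ge0_ae_eq_integral => //.
exists (~` B); split; first exact: measurableC.
  by apply: etrans (probability_setC P mB) _; rewrite PB subee.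
move=> x /= fgx Bx; apply: fgx => _; apply: fg; exact/mem_set.
Qed.

Section clamp.
Context (R : realType).

(* A measure carried by [[-1, 1]] is not changed by clamping its points, and
   clamped spins are bounded everywhere, not just almost everywhere. *)
Definition clamp (z : R) : R := Num.max (-1) (Num.min 1 z).

Lemma clamp_bound z : -1 <= clamp z <= 1.
Proof. rewrite /clamp le_max lexx/= ge_max ge_min lexx/= andbT.
by rewrite (@le_trans _ _ 0)// lerN10. Qed.

Lemma clamp_norm z : `|clamp z| <= 1.
Proof. by rewrite ler_norml clamp_bound. Qed.

Lemma clamp_id z : -1 <= z <= 1 -> clamp z = z.
Proof. by move=> /andP[z1 z2]; rewrite /clamp (min_idPr z2) (max_idPr z1). Qed.

Lemma measurable_clamp : measurable_fun [set: R] clamp.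
Proof. by apply: measurable_maxr => //; exact: measurable_minr. Qed.

Lemma bmeas_clamp : bmeas (clamp : measurableTypeR R -> R).
Proof. by split; [exact: measurable_clamp|exists 1; exact: clamp_norm]. Qed.

End clamp.

Lemma expR_taylor (R : realType) (a b : R) : `|b| <= 1 ->
  `|expR (a + b) - expR a - b * expR a| <= expR a * expR 1 * b ^+ 2.
Proof.
move=> b1; rewrite expRD (_ : _ - _ - _ = expR a * (expR b - 1 - b)); last by ring.
rewrite normrM ger0_norm ?expR_ge0// -mulrA ler_wpM2l ?expR_ge0//.
have [c cb E1] := MVT_between 0 b (@is_derive_expR R).
have [e ec E2] := MVT_between 0 c (@is_derive_expR R).
rewrite expR0 !subr0 in E1 E2.
rewrite E1 -[X in _ - X]mul1r -mulrBl E2.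
have cb' : `|c| <= `|b|.
  case/orP: cb => /andP[? ?]; first by rewrite !ger0_norm; lra.
  by rewrite !ler0_norm; lra.
rewrite -mulrA normrM ger0_norm ?expR_ge0// ler_pM ?expR_ge0//.
  rewrite ler_expR; case/orP: ec => /andP[? ?]; last by lra.
  by rewrite (le_trans _ (le_trans (ler_norm c) (le_trans cb' b1))).
by rewrite normrM -real_normK ?num_real// expr2 ler_pM.
Qed.

Section cumulant.
Context (R : realType) (mu : probability (measurableTypeR R) R).
Hypothesis hmu : base_measure mu.

Let mu1 : mu `[-1, 1]%classic = 1%E. Proof. by have [_ ? _ _] := hmu. Qed.

(** Moments under the unnormalized tilt of [mu]. Differentiation in [t] raises [k] by one, so the
    derivatives of [psi] are polynomials in the ratios [tilted_moment]. *)
Definition moment k (t : R) : R :=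
  expect mu (fun z => clamp z ^+ k * expR (t * clamp z)).

Let EM := expect_mean mu.

Lemma bmeas_tilt k (t : R) :
  bmeas (fun z : measurableTypeR R => clamp z ^+ k * expR (t * clamp z)).
Proof.
have mc := @bmeas_clamp R.
by apply: bmeasM; [exact: bmeasX|apply: bmeas_expR; exact: bmeasZ].
Qed.

Lemma mmt_gen_moment t : ('M_mu idfun t = (moment 0 t)%:E)%E.
Proof.
rewrite /moment -integral_expect; last exact: bmeas_tilt.
rewrite /mmt_gen_fun unlock.
have [mt _] := bmeas_tilt 0 t.
apply: (@ge0_integral_eq_on_full _ (measurableTypeR R) R mu `[-1, 1]%classic) => //.
- apply/measurable_EFinP; apply: measurableT_comp => //.
  by apply: measurable_funM; [exact: measurable_id|exact: measurable_cst].
- exact/measurable_EFinP.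
- by move=> x; rewrite lee_fin expR_ge0.
- by move=> x; rewrite lee_fin expr0 mul1r expR_ge0.
- by move=> x; rewrite inE/= in_itv/= => x1; rewrite expr0 mul1r clamp_id// mulrC.
Qed.

Lemma clamp_tilt_bound t (z : R) : expR (- `|t|) <= expR (t * clamp z) <= expR `|t|.
Proof.
rewrite !ler_expR; have : `|t * clamp z| <= `|t|.
  by rewrite normrM ler_piMr// clamp_norm.
by rewrite ler_norml.
Qed.

Lemma moment0_gt0 t : 0 < moment 0 t.
Proof.
apply: (lt_le_trans (expR_gt0 (- `|t|))); rewrite -[leLHS](mean_cst EM).
apply: (mean_le EM) => [| |z]; [exact: bmeas_cst|exact: bmeas_tilt|].
by rewrite expr0 mul1r; have /andP[] := clamp_tilt_bound t z.
Qed.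

Lemma is_derive_moment k (t : R) : is_derive t 1 (moment k) (moment k.+1 t).
Proof.
apply: (is_derive_quadratic (K := expR `|t| * expR 1)) => h h1.
have mt := bmeas_tilt.
rewrite /moment -(meanB EM)// -(meanZ EM)// -(meanB EM)//; last 2 first.
- exact: bmeasB.
- exact: bmeasZ.
apply: (mean_norm_le_cst EM) => [|z].
  by apply: bmeasB; [exact: bmeasB|exact: bmeasZ].
rewrite mulrDl exprS.
rewrite (_ : _ - _ - _ = clamp z ^+ k * (expR (t * clamp z + h * clamp z) -
  expR (t * clamp z) - (h * clamp z) * expR (t * clamp z))); last by ring.
have hc : `|h * clamp z| <= `|h| by rewrite normrM ler_piMr// clamp_norm.
rewrite normrM (le_trans (ler_piMl _ _))//.
  by rewrite normrX exprn_ile1// clamp_norm.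
rewrite (le_trans (expR_taylor _ (le_trans hc h1)))//.
have /andP[_ t2] := clamp_tilt_bound t z.
apply: ler_pM; rewrite ?sqr_ge0 ?mulr_ge0 ?expR_ge0//.
  by rewrite ler_wpM2r// expR_ge0.
by rewrite -real_normK ?num_real// -[leRHS]real_normK ?num_real// ler_pXn2r ?nnegrE.
Qed.

Definition tilted_moment k t := moment k t / moment 0 t.

Lemma tilted_moment_norm k t : `|tilted_moment k t| <= 1.
Proof.
have m0 := moment0_gt0 t.
rewrite normrM normrV ?unitfE ?gt_eqF// [X in _ / X]gtr0_norm//.
rewrite ler_pdivrMr// mul1r; apply: (mean_norm_le EM) => [| |z]; try exact: bmeas_tilt.
rewrite expr0 normrM [X in _ * X]ger0_norm ?expR_ge0// ler_wpM2r ?expR_ge0//.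
by rewrite normrX exprn_ile1// clamp_norm.
Qed.

Lemma is_derive_tilted_moment k (t : R) : is_derive t 1 (tilted_moment k)
  (tilted_moment k.+1 t - tilted_moment k t * tilted_moment 1 t).
Proof.
have m0 := moment0_gt0 t; have m0' : moment 0 t != 0 by rewrite gt_eqF.
have dV : is_derive t 1 (fun s => (moment 0 s)^-1) (- moment 1 t / moment 0 t ^+ 2).
  apply: is_derive_eq (@is_deriveV _ _ t _ _ m0' (is_derive_moment 0 t)) _.
  by rewrite -[LHS]/(_ * _); field.
apply: is_derive_eq (is_derive_mul (is_derive_moment k t) dV) _.
by rewrite /tilted_moment; field.
Qed.

Lemma psiE : psi mu = fun t => ln (moment 0 t).
Proof. by apply/funext => t; rewrite /psi mmt_gen_moment. Qed.

Lemma is_derive_psi0 (t : R) : is_derive t 1 (psi mu) (tilted_moment 1 t).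
Proof.
rewrite psiE; have m0 := moment0_gt0 t.
rewrite /tilted_moment mulrC.
exact: (@is_derive1_comp R (@ln R) (moment 0) t _ _ (is_derive1_ln m0) (is_derive_moment 0 t)).
Qed.

Lemma dpsiE : dpsi mu = tilted_moment 1.
Proof.
by apply/funext => t; rewrite /dpsi derive1E; have [_ ->] := is_derive_psi0 t.
Qed.

Lemma is_derive_psi (t : R) : is_derive t 1 (psi mu) (dpsi mu t).
Proof. by rewrite dpsiE; exact: is_derive_psi0. Qed.

Lemma ddpsiE : ddpsi mu = fun t => tilted_moment 2 t - tilted_moment 1 t ^+ 2.
Proof.
apply/funext => t; rewrite /ddpsi derive1E dpsiE.
by have [_ ->] := is_derive_tilted_moment 1 t.
Qed.

Lemma is_derive_dpsi (t : R) : is_derive t 1 (dpsi mu) (ddpsi mu t).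
Proof. by rewrite ddpsiE dpsiE; exact: is_derive_tilted_moment. Qed.

Lemma dpsi_norm t : `|dpsi mu t| <= 1.
Proof. by rewrite dpsiE; exact: tilted_moment_norm. Qed.

(** The derivative is the third cumulant [m3 - 3 m1 m2 + 2 m1^3] of the tilted law; the moments are
    bounded by 1, and [1 + 3 + 2 = 6]. *)
Lemma ddpsi_lipschitz a b : `|ddpsi mu b - ddpsi mu a| <= 6 * `|b - a|.
Proof.
rewrite ddpsiE !expr2; set m := tilted_moment.
pose d3 t := (m 3 t - m 2 t * m 1 t) -
   (m 1 t * (m 2 t - m 1 t * m 1 t) + m 1 t * (m 2 t - m 1 t * m 1 t)).
apply: (@lipschitz_derive R (fun t => m 2 t - m 1 t * m 1 t) d3 6) => t.
  have d1 := is_derive_tilted_moment 1 t; have d2 := is_derive_tilted_moment 2 t.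
  exact: is_derive_sub d2 (is_derive_mul d1 d1).
rewrite /d3; have := tilted_moment_norm 1 t; have := tilted_moment_norm 2 t.
have := tilted_moment_norm 3 t; rewrite -/m.
move: (m 1%N t) (m 2 t) (m 3 t) => x y z {m d3}.
rewrite !ler_norml => /andP[? ?] /andP[? ?] /andP[? ?]; apply/andP; split; nra.
Qed.

Lemma ddpsi_moment t : ddpsi mu t =
  expect mu (fun z => (clamp z - dpsi mu t) ^+ 2 * expR (t * clamp z)) / moment 0 t.
Proof.
have m0 : moment 0 t != 0 by rewrite gt_eqF// moment0_gt0.
have mt := bmeas_tilt.
set a := dpsi mu t.
rewrite (_ : (fun z => _) = fun z : R => clamp z ^+ 2 * expR (t * clamp z) +
  ((-2 * a) * (clamp z ^+ 1 * expR (t * clamp z)) +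
   a ^+ 2 * (clamp z ^+ 0 * expR (t * clamp z)))); last first.
  by apply/funext => z; ring.
have mz k b := bmeasZ b (mt k t).
rewrite (meanD EM (mt 2 t)); last by apply: bmeasD; exact: mz.
rewrite (meanD EM (mz 1%N _) (mz 0%N _)) (meanZ EM _ (mt 1%N t)) (meanZ EM _ (mt 0%N t)).
rewrite -/(moment 2 t) -/(moment 1 t) -/(moment 0 t) ddpsiE /a dpsiE /tilted_moment.
by field.
Qed.

Lemma tilt_centered t :
  expect mu (fun z => (clamp z - dpsi mu t) * expR (t * clamp z)) = 0.
Proof.
have m0 : moment 0 t != 0 by rewrite gt_eqF// moment0_gt0.
have mt := bmeas_tilt; have mz k b := bmeasZ b (mt k t).
rewrite (_ : (fun z => _) = fun z : R => clamp z ^+ 1 * expR (t * clamp z) +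
  (- dpsi mu t) * (clamp z ^+ 0 * expR (t * clamp z))); last first.
  by apply/funext => z; ring.
rewrite (meanD EM (mt 1%N t) (mz 0%N _)) (meanZ EM _ (mt 0%N t)).
by rewrite -/(moment 1 t) -/(moment 0 t) dpsiE /tilted_moment; field.
Qed.

(** Under the tilt, [z (z - psi')] has the variance [psi''] as its mean; this makes [eta] below a
    centred noise, as [tilt_centered] does for [xi]. *)
Lemma tilt_centered2 t : expect mu (fun z =>
  (clamp z * (clamp z - dpsi mu t) - ddpsi mu t) * expR (t * clamp z)) = 0.
Proof.
have m0 : moment 0 t != 0 by rewrite gt_eqF// moment0_gt0.
have mt := bmeas_tilt; have mz k b := bmeasZ b (mt k t).
rewrite (_ : (fun z => _) = fun z : R => clamp z ^+ 2 * expR (t * clamp z) +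
  ((- dpsi mu t) * (clamp z ^+ 1 * expR (t * clamp z)) +
   (- ddpsi mu t) * (clamp z ^+ 0 * expR (t * clamp z)))); last first.
  by apply/funext => z; ring.
rewrite (meanD EM (mt 2 t)); last by apply: bmeasD; exact: mz.
rewrite (meanD EM (mz 1%N _) (mz 0%N _)) (meanZ EM _ (mt 1%N t)) (meanZ EM _ (mt 0%N t)).
rewrite -/(moment 2 t) -/(moment 1 t) -/(moment 0 t) ddpsiE dpsiE /tilted_moment.
by field.
Qed.

(** A vanishing variance would put all the mass of [mu] on the single point [dpsi mu t], against
    non-degeneracy. *)
Lemma ddpsi_gt0 t : 0 < ddpsi mu t.
Proof.
have m0 := moment0_gt0 t; rewrite ddpsi_moment; apply: divr_gt0 => //.
set a := dpsi mu t; pose f z := (clamp z - a) ^+ 2 * expR (t * clamp z).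
have mf : bmeas (f : measurableTypeR R -> R).
  apply: bmeasM; last by have := bmeas_tilt 0 t; under eq_fun do rewrite expr0 mul1r.
  by apply: bmeasX; apply: bmeasB; [exact: bmeas_clamp|exact: bmeas_cst].
have f0 z : 0 <= f z by rewrite mulr_ge0 ?sqr_ge0 ?expR_ge0.
rewrite lt_neqAle (mean_ge0 EM)// andbT eq_sym; apply/eqP => If0.
have [hna _ _ _] := hmu; have /eqP[] := hna a.
have [mf' _] := mf; have mfE : measurable_fun setT (EFin \o f) by exact/measurable_EFinP.
have : (\int[mu]_x `|(EFin \o f) x| = 0)%E.
  rewrite -[RHS]/(0%:E) -If0 -integral_expect//; apply: eq_integral => x _ /=.
  by rewrite ger0_norm.
move/(ae_eq_integral_abs mu measurableT mfE) => [N [mN N0 sN]].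
apply/eqP; rewrite eq_le probability_le1//=.
pose I1 : set R := `[-1, 1]%classic.
have : (mu (I1 `\` N) <= mu [set a])%E.
  have mI1 : measurable I1 by exact: measurable_itv.
  apply: le_measure.
  - by rewrite inE; exact: measurableD.
  - by rewrite inE; exact: measurable_set1.
  move=> z []; rewrite /I1/= in_itv/= => z1 Nz; apply: contrapT => za; apply: Nz.
  apply: sN => /= /(_ I) [] /eqP; rewrite mulf_eq0 (gt_eqF (expR_gt0 _)) orbF sqrf_eq0.
  by rewrite clamp_id// subr_eq0 => /eqP.
have mI1 : measurable I1 by exact: measurable_itv.
have NI : mu (I1 `&` N) = 0%E.
  apply: (subset_measure0 (B := N)) => //; exact: measurableI.
have : mu I1 = (mu (I1 `\` N) + mu (I1 `&` N))%E := measureDI mu mI1 mN.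
by rewrite NI adde0 [mu I1]mu1 => <-.
Qed.

Lemma ddpsi_le1 t : ddpsi mu t <= 1.
Proof.
have := tilted_moment_norm 2 t; rewrite ddpsiE ler_norml => /andP[_ m2].
by rewrite lerBlDr (le_trans m2)// lerDl sqr_ge0.
Qed.

Lemma dpsi_lt a b : a < b -> dpsi mu a < dpsi mu b.
Proof.
move=> ab; have [c _ E] := MVT_between a b is_derive_dpsi.
by rewrite -subr_gt0 E mulr_gt0 ?ddpsi_gt0// subr_gt0.
Qed.

Lemma dpsi_le a b : a <= b -> dpsi mu a <= dpsi mu b.
Proof. by rewrite le_eqVlt => /orP[/eqP->//|/dpsi_lt/ltW]. Qed.

Lemma dpsi_bound t : -1 < dpsi mu t < 1.
Proof.
have /andP[l _] : -1 <= dpsi mu (t - 1) <= 1 by rewrite -ler_norml dpsi_norm.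
have /andP[_ r] : -1 <= dpsi mu (t + 1) <= 1 by rewrite -ler_norml dpsi_norm.
apply/andP; split.
  by apply: le_lt_trans l _; rewrite dpsi_lt// gtrBl.
by apply: lt_le_trans r; rewrite dpsi_lt// ltrDl.
Qed.

Lemma dpsi_lipschitz a b : `|dpsi mu b - dpsi mu a| <= `|b - a|.
Proof.
rewrite -[leRHS]mul1r; apply: (lipschitz_derive is_derive_dpsi) => t.
by rewrite ger0_norm ?ddpsi_le1// ltW// ddpsi_gt0.
Qed.

Lemma bmeas_dpsi : bmeas (dpsi mu : measurableTypeR R -> R).
Proof.
by split; [exact: (measurable_is_derive is_derive_dpsi)|exists 1; exact: dpsi_norm].
Qed.

Lemma bmeas_ddpsi : bmeas (ddpsi mu : measurableTypeR R -> R).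
Proof.
have mm k : bmeas (tilted_moment k : measurableTypeR R -> R).
  split; last by exists 1; exact: tilted_moment_norm.
  exact: (measurable_is_derive (is_derive_tilted_moment k)).
by rewrite ddpsiE; apply: bmeasB; [exact: mm|exact: bmeasX].
Qed.

Lemma psi0 : psi mu 0 = 0.
Proof.
rewrite psiE /moment (_ : (fun z => _) = fun=> 1); last first.
  by apply/funext => z; rewrite expr0 mul0r expR0 mulr1.
by rewrite (mean_cst EM) ln1.
Qed.

(** If the slope of [psi] towards the endpoint [e] stayed below [z < 1], then [psi] would grow more
    slowly than the positive mass of [mu] near [e] forces it to. The sign [e] treats both endpoints
    at once. *)
Lemma dpsi_unbounded (e z : R) : e = 1 \/ e = -1 -> z < 1 ->
  exists t, z < e * dpsi mu (e * t).
Proof.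
move=> e1 z1; have ee : e * e = 1 by case: e1 => ->; rewrite ?mulr1// mulrNN mulr1.
have [_ _ suppN supp1] := hmu; apply: contrapT => /forallNP bounded.
have {}bounded t : e * dpsi mu (e * t) <= z by rewrite leNgt; exact/negP/bounded.
pose eps := (1 - z) / 2; have eps0 : 0 < eps by rewrite divr_gt0// subr_gt0.
have mball : measurable (ball e eps : set R) by exact: measurable_ball.
pose beta := expect mu (\1_(ball e eps) : measurableTypeR R -> R).
have beta0 : 0 < beta.
  rewrite /beta expect_indic// fine_gt0//.
  rewrite (le_lt_trans (probability_le1 _ _)) ?ltry// andbT.
  by case: e1 => ->; [exact: supp1|exact: suppN].
(* Since [1 - eps = z + eps], the two bounds on [moment 0 (e * t)] give
   [beta <= expR (- (t * eps))]; for this [t] it reads [beta <= expR (- beta^-1)], which contradicts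
   [x < expR x] at [x = beta^-1]. *)
pose t := (beta * eps)^-1; have t0 : 0 < t by rewrite invr_gt0 mulr_gt0.
have psi_le : psi mu (e * t) <= z * t.
  have [c _] := MVT_between 0 (e * t) is_derive_psi.
  rewrite psi0 !subr0 => ->; rewrite mulrA ler_wpM2r ?(ltW t0)//.
  by have := bounded (e * c); rewrite mulrA ee mul1r mulrC.
have moment_ge : beta * expR (t * (1 - eps)) <= moment 0 (e * t).
  rewrite mulrC -(meanZ EM); last exact: bmeas_indic.
  apply: (mean_le EM) => [| |x].
  - by apply: bmeasZ; exact: bmeas_indic.
  - exact: bmeas_tilt.
  rewrite indicE expr0 mul1r; case: (boolP (x \in _)) => [|_]; last first.
    by rewrite mulr0 expR_ge0.
  rewrite inE /ball/= mulr1 ler_expR => ex.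
  rewrite [e * t]mulrC -mulrA ler_wpM2l ?(ltW t0)//.
  move: ex; rewrite ltr_norml => /andP[]; rewrite /clamp.
  case: e1 => ->; rewrite ?mul1r ?mulN1r => ? ?.
    by rewrite le_max le_min; apply/orP; right; apply/andP; split; lra.
  rewrite lerNr ge_max ge_min; apply/andP; split; first lra.
  by apply/orP; right; lra.
have : beta * expR (t * (1 - eps)) <= expR (z * t).
  apply: (le_trans moment_ge); rewrite -[leLHS](@lnK R) ?ler_expR; last first.
    by rewrite posrE moment0_gt0.
  by move: psi_le; rewrite psiE.
rewrite -ler_pdivlMr ?expR_gt0// -expRN -expRD.
rewrite (_ : _ + _ = - beta^-1); last first.
  rewrite /t (_ : 1 - eps = z + eps); last by rewrite /eps; field.
  by field; rewrite !gt_eqF.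
apply/negP; rewrite -ltNge expRN -[ltRHS]invrK ltf_pV2 ?posrE ?expR_gt0 ?invr_gt0//.
by rewrite (lt_le_trans _ (expR_ge1Dx _))// ltrDr.
Qed.

Lemma dpsi_surj (z : R) : `|z| < 1 -> exists t, dpsi mu t = z.
Proof.
rewrite ltr_norml => /andP[zN z1].
have [t1] := dpsi_unbounded (or_introl erefl) z1; rewrite !mul1r => zt1.
have zN' : - z < 1 by rewrite ltrNl.
have [t2] := dpsi_unbounded (or_intror erefl) zN'; rewrite !mulN1r ltrN2 => zt2.
have tt : - t2 <= t1.
  by rewrite leNgt; apply/negP => /dpsi_lt; rewrite ltNge (ltW (lt_trans zt2 zt1)).
have cf : {within `[- t2, t1], continuous (dpsi mu)}.
  apply: derivable_within_continuous => x _.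
  exact: (@ex_derive _ _ _ _ _ _ _ (is_derive_dpsi x)).
have [|c _ <-] := IVT (v := z) tt cf; last by exists c.
apply/andP; split; rewrite ?ge_min ?le_max; apply/orP; [left|right]; exact: ltW.
Qed.

Lemma dpsi_phi (z : R) : `|z| < 1 -> dpsi mu (phi mu z) = z.
Proof. by move=> /dpsi_surj zt; exact: (xgetPex 0 zt). Qed.

Lemma psi_above_tangent a b : psi mu a + dpsi mu a * (b - a) <= psi mu b.
Proof.
have [c cb E] := MVT_between a b is_derive_psi.
rewrite -lerBrDl E.
case/orP: cb => /andP[? ?]; first by rewrite ler_wpM2r ?dpsi_le ?subr_ge0//; lra.
by rewrite ler_wnM2r ?dpsi_le ?subr_le0//; lra.
Qed.

Lemma fenchel (h z : R) : `|z| < 1 -> h * z - psi mu h <= rate_int mu z.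
Proof.
move=> z1; rewrite /rate_int; have := psi_above_tangent (phi mu z) h.
rewrite dpsi_phi//; lra.
Qed.

Lemma phi_dpsi t : phi mu (dpsi mu t) = t.
Proof.
have /dpsi_phi : `|dpsi mu t| < 1 by rewrite ltr_norml dpsi_bound.
have [/dpsi_lt /[swap] ->|/dpsi_lt /[swap] ->|//] := ltgtP (phi mu (dpsi mu t)) t.
  by rewrite ltxx.
by rewrite ltxx.
Qed.

Lemma rate_int_dpsi h : rate_int mu (dpsi mu h) = h * dpsi mu h - psi mu h.
Proof. by rewrite /rate_int phi_dpsi mulrC. Qed.

(* The dual of strict convexity of [psi]. *)
Lemma fenchel_eq (h z : R) : `|z| < 1 -> rate_int mu z <= h * z - psi mu h ->
  z = dpsi mu h.
Proof.
move=> z1; rewrite /rate_int; set t := phi mu z => le_psi.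
suff <- : t = h by rewrite dpsi_phi.
pose m := (h + t) / 2.
have P1 := psi_above_tangent m h; have P2 := psi_above_tangent t m.
rewrite dpsi_phi// in P2.
have [th|ht|//] := ltgtP t h.
  have : dpsi mu t < dpsi mu m by apply: dpsi_lt; rewrite /m; lra.
  rewrite dpsi_phi// => zm; move: P1 P2; rewrite /m in zm *; nra.
have : dpsi mu m < dpsi mu t by apply: dpsi_lt; rewrite /m; lra.
rewrite dpsi_phi// => zm; move: P1 P2; rewrite /m in zm *; nra.
Qed.

End cumulant.

(** * The Mean-Field equation *)

Lemma sum_kronecker (R : realType) n (i : 'I_n) (F : 'I_n -> R) :
  \sum_a (a == i)%:R * F a = F i.
Proof.
rewrite (bigD1 i)//= eqxx mul1r big1 ?addr0// => a ai.
by rewrite (negbTE ai) mul0r.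
Qed.

Section mean_field.
Context (R : realType).

Definition mfield n (A : 'M[R]_n) (s : n.-tuple R) (i : 'I_n) : R :=
  \sum_j A i j * tnth s j.

Definition coupling_matrix n (A : 'M[R]_n) :=
  (forall i j, A i j = A j i) /\ (forall i, A i i = 0).

(** The square of the increment comes with [A i i = 0]. Because the energy is affine in each
    coordinate, the conditional law of a spin is a tilt of [mu], and the Mean-Field problem in one
    coordinate is a Legendre transform. *)
Lemma hamiltonian_upd n (A : 'M[R]_n) (c s : n.-tuple R) i z : coupling_matrix A ->
  hamiltonian A c (upd s i z) =
  hamiltonian A c s + (z - tnth s i) * (tnth c i + mfield A s i).
Proof.
move=> [symA diagA]; set d := z - tnth s i.
have updE a : tnth (upd s i z) a = tnth s a + (a == i)%:R * d.
  rewrite tnth_upd; case: eqP => [->|_]; last by rewrite mul0r addr0.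
  by rewrite mul1r /d addrC subrK.
have quadE : quad_form A (upd s i z) = quad_form A s + 2 * d * mfield A s i.
  have -> : quad_form A (upd s i z) = quad_form A s +
      (d * \sum_a (a == i)%:R * (\sum_b A a b * tnth s b) +
       d * \sum_b (b == i)%:R * (\sum_a A a b * tnth s a) +
       d ^+ 2 * \sum_a (a == i)%:R * \sum_b (b == i)%:R * A a b).
    rewrite [X in _ + (_ + d * X + _)](_ : _ =
      \sum_a \sum_b (b == i)%:R * (A a b * tnth s a)); last first.
      by rewrite exchange_big/=; apply: eq_bigr => a _; rewrite mulr_sumr.
    rewrite !mulr_sumr -!big_split; apply: eq_bigr => a _ /=.
    rewrite !mulr_sumr -!big_split; apply: eq_bigr => b _ /=.
    rewrite !updE; ring.
  rewrite !sum_kronecker diagA mulr0 addr0.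
  have -> : \sum_a A a i * tnth s a = mfield A s i.
    by apply: eq_bigr => a _; rewrite symA.
  by rewrite -/(mfield A s i); ring.
have linE : \sum_a tnth c a * tnth (upd s i z) a =
    \sum_a tnth c a * tnth s a + d * tnth c i.
  rewrite -(sum_kronecker i (fun a => tnth c a)) mulr_sumr -big_split.
  by apply: eq_bigr => a _ /=; rewrite updE; ring.
by rewrite /hamiltonian quadE linE; field.
Qed.

Variable mu : probability (measurableTypeR R) R.
Hypothesis hmu : base_measure mu.

Lemma rate_dpsi h : rate mu (dpsi mu h) = (h * dpsi mu h - psi mu h)%:E.
Proof.
have /andP[h1 h2] := dpsi_bound hmu h.
by rewrite /rate ltr_norml h1 h2 rate_int_dpsi.
Qed.

Lemma rate_int_monotone (x y : R) : `|x| < 1 -> `|y| < 1 ->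
  0 <= phi mu x * (y - x) -> rate_int mu x <= rate_int mu y.
Proof.
move=> x1 y1 xy; apply: le_trans (fenchel hmu (phi mu x) y1).
by move: xy; rewrite /rate_int; lra.
Qed.

Lemma phi_ge0 (x : R) : dpsi mu 0 <= x < 1 -> 0 <= phi mu x.
Proof.
move=> /andP[x0 x1]; have /andP[h1 _] := dpsi_bound hmu 0.
rewrite leNgt; apply/negP => /(dpsi_lt hmu); rewrite (dpsi_phi hmu); first by rewrite ltNge x0.
by rewrite ltr_norml x1 andbT (lt_le_trans h1).
Qed.

Lemma phi_le0 (x : R) : -1 < x <= dpsi mu 0 -> phi mu x <= 0.
Proof.
move=> /andP[x1 x0]; have /andP[_ h1] := dpsi_bound hmu 0.
rewrite leNgt; apply/negP => /(dpsi_lt hmu); rewrite (dpsi_phi hmu); first by rewrite ltNge x0.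
by rewrite ltr_norml x1 (le_lt_trans x0).
Qed.

(** The endpoint values of [rate] are written with [lim], which is informative only if the limit
    exists. It does, in the extended reals: [rate_int] is monotone on either side of [dpsi mu 0],
    where [phi] keeps its sign. *)
Lemma cvg_rate_int_N1 : cvg ((rate_int mu x)%:E @[x --> (-1 : R)^'+]).
Proof.
apply: nonincreasing_at_right_is_cvge; near=> e => x y.
have e0 : e <= dpsi mu 0.
  near: e; apply: nbhs_right_le; by have /andP[] := dpsi_bound hmu 0.
have /andP[_ h1] := dpsi_bound hmu 0.
rewrite !in_itv/= => /andP[x1 xe] /andP[y1 ye] xy; rewrite lee_fin.
have /ltW xd := lt_le_trans xe e0; have /ltW yd := lt_le_trans ye e0.
apply: rate_int_monotone; rewrite ?ltr_norml ?x1 ?y1 ?(le_lt_trans _ h1)//.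
by rewrite mulr_le0 ?subr_le0 ?phi_le0// y1.
Unshelve. all: by end_near. Qed.

Lemma cvg_rate_int_1 : cvg ((rate_int mu x)%:E @[x --> (1 : R)^'-]).
Proof.
suff : cvg ((rate_int mu (- x))%:E @[x --> (-1 : R)^'+]).
  move=> /cvg_ex[l fl]; apply/cvg_ex; exists l.
  exact: (cvg_at_leftNP (fun x => (rate_int mu x)%:E) 1 l).2 fl.
apply: nonincreasing_at_right_is_cvge; near=> e => x y.
have e0 : e <= - dpsi mu 0.
  near: e; apply: nbhs_right_le; rewrite ltrN2; by have /andP[] := dpsi_bound hmu 0.
have /andP[h1 _] := dpsi_bound hmu 0.
rewrite !in_itv/= => /andP[x1 xe] /andP[y1 ye] xy; rewrite lee_fin.
have /ltW xd := lt_le_trans xe e0; have /ltW yd := lt_le_trans ye e0.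
rewrite lerNr in xd; rewrite lerNr in yd.
apply: rate_int_monotone; rewrite ?ltr_norml ?(lt_le_trans h1)//= 1?ltrNl//.
by rewrite mulr_ge0 ?phi_ge0 ?yd 1?ltrNl// opprK addrC subr_ge0.
Unshelve. all: by end_near. Qed.

Lemma rate_ge (h z : R) : -1 <= z <= 1 -> ((h * z - psi mu h)%:E <= rate mu z)%E.
Proof.
have lim_ge (x : R) (F : set_system R) : ProperFilter F ->
    cvg ((rate_int mu x)%:E @[x --> F]) -> x @[x --> F] --> x ->
    (\forall y \near F, `|y| < 1) ->
    ((h * x - psi mu h)%:E <= lim ((rate_int mu x)%:E @[x --> F]))%E.
  move=> PF cF Fx F1; apply/lee_addgt0Pr => e e0; rewrite -leeBlDr// -EFinB.
  apply: lime_ge => //; near=> y; rewrite lee_fin.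
  apply: le_trans (fenchel hmu h _); last by near: y.
  rewrite lerBlDr addrAC lerB// -lerBlDl -mulrBr (le_trans (ler_norm _))// normrM.
  have : `|x - y| <= e / (`|h| + 1).
    near: y; move/cvgrPdist_le : Fx; apply; by rewrite divr_gt0// ltr_wpDl.
  rewrite ler_pdivlMr ?ltr_wpDl// => /(le_trans _); apply.
  by rewrite mulrC ler_wpM2l// lerDl.
move=> /andP[z1 z2]; rewrite /rate.
case: ifPn => [?|]; first by rewrite lee_fin fenchel.
move=> zN; case: eqP => [->|z3].
  apply: lim_ge; first exact: cvg_rate_int_1.
    exact: cvg_at_left_filter cvg_id.
  near=> y; rewrite ltr_norml; apply/andP; split; near: y.
    by apply: nbhs_left_gt; lra.
  exact: nbhs_left_lt.
case: eqP => [->|z4]; last by rewrite leey.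
apply: lim_ge; first exact: cvg_rate_int_N1.
  exact: cvg_at_right_filter cvg_id.
near=> y; rewrite ltr_norml; apply/andP; split; near: y.
  exact: nbhs_right_gt.
by apply: nbhs_right_lt; lra.
Unshelve. all: by end_near. Qed.

Lemma rate_ge0 (z : R) : -1 <= z <= 1 -> (0 <= rate mu z)%E.
Proof. by move=> /(rate_ge 0); rewrite mul0r psi0// subr0. Qed.

(** Replacing coordinate [i] by [dpsi mu h], with [h] the local field at [i], cannot increase the
    objective; this forces equality in Fenchel's inequality at [u_i]. *)
Lemma mf_optimizer_fixpoint n (A : 'M[R]_n) (c u : n.-tuple R) :
  coupling_matrix A -> mf_optimizer mu A c u ->
  forall i, tnth u i = dpsi mu (tnth c i + mfield A u i).
Proof.
move=> cA [ucube umax] i.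
have r0 j : (0 <= rate mu (tnth u j))%E by exact: rate_ge0.
(* An infinite rate would make the objective [-oo] at [u], whereas it is finite at the constant
   vector [dpsi mu 0]. *)
have rfin j : rate mu (tnth u j) \is a fin_num.
  pose z0 : n.-tuple R := [tuple dpsi mu 0 | _ < n].
  have z0cube : in_cube z0.
    by move=> k; rewrite tnth_mktuple -ler_norml dpsi_norm.
  have := umax _ z0cube; rewrite /mf_objective.
  under eq_bigr do rewrite tnth_mktuple rate_dpsi.
  rewrite sumEFin -EFinB => le_obj.
  have : (\sum_(j < n) rate mu (tnth u j) < +oo)%E.
    rewrite ltey; apply/eqP => Sy; move: le_obj.
    by rewrite Sy.
  move=> Sy; rewrite ge0_fin_numE//; apply: le_lt_trans Sy.
  by rewrite (bigD1 j)//= leeDl// sume_ge0.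
pose r j := fine (rate mu (tnth u j)).
have rE j : rate mu (tnth u j) = (r j)%:E by rewrite fineK.
set h := tnth c i + mfield A u i.
have hu : psi mu h <= h * tnth u i - r i.
  pose z := upd u i (dpsi mu h).
  have zcube : in_cube z.
    move=> k; rewrite tnth_upd; case: ifP => _; last exact: ucube.
    by rewrite -ler_norml dpsi_norm.
  have := umax _ zcube; rewrite /mf_objective /z hamiltonian_upd// -/h.
  rewrite (bigD1 i)//= [X in (_ <= _ - X)%E](bigD1 i)//= tnth_upd eqxx rate_dpsi.
  rewrite (eq_bigr (fun j => (r j)%:E)); last first.
    by move=> j ji; rewrite tnth_upd (negbTE ji) rE.
  rewrite [X in (_ <= _ - (_ + X))%E](eq_bigr (fun j => (r j)%:E)); last first.
    by move=> j _; rewrite rE.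
  rewrite sumEFin rE -!EFinD lee_fin; lra.
have re b : b * tnth u i - psi mu b <= r i by rewrite -lee_fin -rE rate_ge.
have [u1|u1] := ltP `|tnth u i| 1.
  apply: fenchel_eq => //; move: hu; rewrite /r /rate u1/= -/h; lra.
(* An endpoint is impossible: [hu] and Fenchel at [h + u_i] give
   [psi (h + u_i) - psi h >= u_i ^+ 2 = 1], but this difference is [dpsi mu k * u_i], which is less
   than 1 in absolute value. *)
have [k _ E] := MVT_between h (h + tnth u i) (is_derive_psi hmu).
have := re (h + tnth u i) => re'; have /andP[k1 k2] := dpsi_bound hmu k.
have /andP[v1 v2] := ucube i.
move: u1; rewrite ler_normr => /orP[] u1.
  have ue : tnth u i = 1 by apply/le_anti; rewrite v2.
  move: k1 k2 E hu re'; rewrite ue; move: (dpsi mu k) (psi mu _) (psi mu h) (r i).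
  by clearbody h; clear=> a b e f; lra.
have ue : tnth u i = -1 by apply/le_anti; rewrite v1 andbT lerNr.
move: k1 k2 E hu re'; rewrite ue; move: (dpsi mu k) (psi mu _) (psi mu h) (r i).
by clearbody h; clear=> a b e f; lra.
Qed.

End mean_field.

(** * Gibbs expectations *)

Section schur.
Context (R : realType) (n : nat).
Implicit Types (M : 'I_n -> 'I_n -> R) (a x : 'I_n -> R).

(** Bound [|a i| * |a j|] by half the sum of the squares; by symmetry both halves are weighted row
    sums. *)
Lemma schur_test M a rho : (forall i j, M i j = M j i) ->
  (forall i j, 0 <= M i j) -> (forall i, \sum_j M i j <= rho) ->
  \sum_i \sum_j `|a i| * `|a j| * M i j <= rho * \sum_i a i ^+ 2.
Proof.
move=> symM M0 Mr.
have row : \sum_i \sum_j a i ^+ 2 * M i j <= rho * \sum_i a i ^+ 2.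
  rewrite mulr_sumr ler_sum// => i _.
  by rewrite -mulr_sumr mulrC ler_wpM2r ?sqr_ge0.
apply: (@le_trans _ _ (\sum_i \sum_j (a i ^+ 2 * M i j / 2 + a j ^+ 2 * M j i / 2))).
  apply: ler_sum => i _; apply: ler_sum => j _.
  rewrite [M j i]symM -!mulrDl.
  rewrite -[a i ^+ 2]real_normK ?num_real// -[a j ^+ 2]real_normK ?num_real//.
  rewrite [leRHS](_ : _ = (`|a i| ^+ 2 + `|a j| ^+ 2) / 2 * M i j); last by field.
  rewrite ler_wpM2r//; have := sqr_ge0 (`|a i| - `|a j|); lra.
have split_half : \sum_i \sum_j (a i ^+ 2 * M i j / 2 + a j ^+ 2 * M j i / 2) =
    \sum_i \sum_j a i ^+ 2 * M i j.
  under eq_bigr do rewrite big_split/=.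
  rewrite big_split/= [X in _ + X]exchange_big/= -big_split/=.
  by apply: eq_bigr => i _; rewrite -big_split/=; apply: eq_bigr => j _; field.
by rewrite split_half.
Qed.

(* Cauchy-Schwarz for the sub-probability weights [M i j / rho]. *)
Lemma weighted_sum_sqr (m x : 'I_n -> R) rho : (forall j, 0 <= m j) ->
  \sum_j m j <= rho ->
  (\sum_j m j * x j) ^+ 2 <= rho * \sum_j m j * x j ^+ 2.
Proof.
move=> m0 mr; set S := \sum_j m j * x j; set Q := \sum_j m j * x j ^+ 2.
have Q0 : 0 <= Q by apply: sumr_ge0 => j _; rewrite mulr_ge0 ?sqr_ge0.
have expand t : 0 <= t ^+ 2 * rho - 2 * t * S + Q.
  apply: (@le_trans _ _ (\sum_j m j * (t - x j) ^+ 2)).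
    by apply: sumr_ge0 => j _; rewrite mulr_ge0 ?sqr_ge0.
  rewrite (_ : \sum_j _ = t ^+ 2 * (\sum_j m j) - 2 * t * S + Q).
    by rewrite !lerD2r ler_wpM2l ?sqr_ge0.
  rewrite /S /Q !mulr_sumr -sumrB -big_split; apply: eq_bigr => j _ /=; ring.
have rho0 : 0 <= rho by apply: le_trans mr; apply: sumr_ge0.
have [rho1|] := ltP 0 rho.
  have := expand (S / rho); rewrite (_ : _ + Q = Q - S ^+ 2 / rho); last first.
    by field; rewrite gt_eqF.
  by rewrite subr_ge0 ler_pdivrMr// mulrC.
move=> rho1.
have m00 j : m j = 0.
  apply/le_anti; rewrite m0 andbT; apply: le_trans (le_trans mr rho1).
  by rewrite (bigD1 j)//= lerDl sumr_ge0.
by rewrite /S big1 ?expr0n ?mulr_ge0// => j _; rewrite m00 mul0r.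
Qed.

End schur.

Lemma mnormalizeE d (T : measurableType d) (R : realType)
  (m : {measure set T -> \bar R}) (P : probability T R) (B : set T) (z : R) :
  0 < z -> m [set: T] = z%:E -> mnormalize m P B = (m B * (z^-1)%:E)%E.
Proof.
move=> z0 mz; rewrite /mnormalize mz [_ == 0%E](_ : _ = false)//.
by rewrite eqe gt_eqF.
Qed.

Section gibbs_mean.
Context (R : realType) (mu : probability (measurableTypeR R) R).
Hypothesis hmu : base_measure mu.
Variables (n : nat) (A : 'M[R]_n).
Hypothesis cA : coupling_matrix A.
Local Notation T := (n.-tuple (measurableTypeR R)).

Definition spins (s : n.-tuple R) : n.-tuple R := [tuple clamp (tnth s i) | i < n].

Lemma tnth_spins s i : tnth (spins s) i = clamp (tnth s i).
Proof. by rewrite tnth_mktuple. Qed.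

Lemma spins_norm s i : `|tnth (spins s) i| <= 1.
Proof. by rewrite tnth_spins clamp_norm. Qed.

Lemma spins_upd s i z : spins (upd s i z) = upd (spins s) i (clamp z).
Proof.
by apply: eq_from_tnth => j; rewrite tnth_spins !tnth_upd tnth_spins; case: ifP.
Qed.

Lemma bmeas_spin i : bmeas (fun s : T => tnth (spins s) i).
Proof.
have := bmeas_comp_measurable (measurable_tnth (T := measurableTypeR R) i) (@bmeas_clamp R).
by under [X in _ -> bmeas X]eq_fun do rewrite tnth_spins.
Qed.

Lemma measurable_spins : measurable_fun [set: T] (spins : T -> T).
Proof.
by apply/measurable_fun_tnthP => i; have [] := bmeas_spin i.
Qed.

Lemma bmeas_mfield i : bmeas (fun s : T => mfield A (spins s) i).
Proof. by apply: bmeas_sum => j; apply: bmeasZ; exact: bmeas_spin. Qed.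

Definition local_field (c s : n.-tuple R) i := tnth c i + mfield A (spins s) i.

Lemma bmeas_local_field c i : bmeas (fun s : T => local_field c s i).
Proof. by apply: bmeasD; [exact: bmeas_cst|exact: bmeas_mfield]. Qed.

Lemma local_field_upd c s i j z : local_field c (upd s i z) j =
  local_field c s j + A j i * (clamp z - tnth (spins s) i).
Proof.
rewrite /local_field -addrA; congr (_ + _); rewrite spins_upd /mfield.
rewrite (bigD1 i)//= [in RHS](bigD1 i)//= tnth_upd eqxx.
rewrite (eq_bigr (fun k => A j k * tnth (spins s) k)); last first.
  by move=> k ki; rewrite tnth_upd (negbTE ki).
by ring.
Qed.

Lemma local_field_indep c i : indep_of (T := measurableTypeR R) i
  (fun s => local_field c s i).
Proof. by move=> s z; rewrite local_field_upd cA.2 mul0r addr0. Qed.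

Definition boltzmann (c s : n.-tuple R) : R := expR (hamiltonian A c (spins s)).

Lemma bmeas_boltzmann c : bmeas (boltzmann c : T -> R).
Proof.
apply: bmeas_expR; apply: bmeasD.
  apply: bmeasZ; apply: bmeas_sum => i; apply: bmeas_sum => j.
  apply: bmeasM; last exact: bmeas_spin.
  by apply: bmeasM; [exact: bmeas_spin|exact: bmeas_cst].
by apply: bmeas_sum => i; apply: bmeasZ; exact: bmeas_spin.
Qed.

Lemma boltzmann_upd c s i z : boltzmann c (upd s i z) =
  boltzmann c s * expR (- tnth (spins s) i * local_field c s i) *
  expR (local_field c s i * clamp z).
Proof.
rewrite /boltzmann spins_upd hamiltonian_upd// -!expRD; congr expR.
by rewrite /local_field; ring.
Qed.

Lemma partition_gt0 c : 0 < expect (iid mu n) (boltzmann c).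
Proof.
have [mw [M wM]] := bmeas_boltzmann c.
have EM := expect_mean (iid mu n).
pose K := \sum_i \sum_j `|A i j| + \sum_i `|tnth c i|.
apply: (lt_le_trans (expR_gt0 (- K))); rewrite -[leLHS](mean_cst EM).
apply: (mean_le EM) => [| |s]; [exact: bmeas_cst|exact: bmeas_boltzmann|].
rewrite ler_expR lerNl; apply: le_trans (ler_norm _) _; rewrite normrN.
rewrite (le_trans (ler_normD _ _))// lerD//.
  rewrite normrM (le_trans (ler_piMl _ _))//.
    by rewrite ger0_norm//; lra.
  rewrite (le_trans (ler_norm_sum _ _ _))// ler_sum// => i _.
  rewrite (le_trans (ler_norm_sum _ _ _))// ler_sum// => j _.
  rewrite !normrM mulrAC ler_piMl// -[leRHS]mulr1 ler_pM// spins_norm//.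
rewrite (le_trans (ler_norm_sum _ _ _))// ler_sum// => i _.
by rewrite normrM ler_piMr// spins_norm.
Qed.

Definition gibbs_mean (c : n.-tuple R) (f : T -> R) : R :=
  wexpect (iid mu n) (boltzmann c) f.

Lemma gibbs_meanP c : is_mean (gibbs_mean c).
Proof.
apply: wexpect_mean; [exact: bmeas_boltzmann| |exact: partition_gt0].
by move=> s; exact: expR_ge0.
Qed.

(* Given the other spins, the law of [sigma_i] is the tilt of [mu] by
   the local field. *)
Lemma gibbs_mean_centered c i (k : R -> R -> R) (h : T -> R) :
  (forall t, bmeas (fun z : measurableTypeR R => k (clamp z) t)) ->
  (forall t, expect mu (fun z => k (clamp z) t * expR (t * clamp z)) = 0) ->
  bmeas (fun s : T => k (tnth (spins s) i) (local_field c s i)) ->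
  bmeas h -> indep_of (T := measurableTypeR R) i h ->
  gibbs_mean c (fun s => k (tnth (spins s) i) (local_field c s i) * h s) = 0.
Proof.
move=> mk k0 mki mh hi; rewrite /gibbs_mean /wexpect.
rewrite (expect_resample mu i); last first.
  by apply: bmeasM; [exact: bmeasM|exact: bmeas_boltzmann].
rewrite (_ : (fun s => _) = fun=> 0) ?(mean_cst (expect_mean _)) ?mul0r//.
apply/funext => s; have EM := expect_mean mu.
set t := local_field c s i.
pose C := h s * (boltzmann c s * expR (- tnth (spins s) i * t)).
rewrite (_ : (fun z => _) = fun z : R => C * (k (clamp z) t * expR (t * clamp z))).
  rewrite (meanZ EM) ?k0 ?mulr0//; apply: bmeasM => //.
  by apply: bmeas_expR; apply: bmeasZ; exact: bmeas_clamp.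
apply/funext => z; rewrite hi local_field_indep -/t spins_upd tnth_upd eqxx.
by rewrite boltzmann_upd -/t /C; ring.
Qed.

Lemma measurable_in_cube : measurable ([set s | in_cube s] : set T).
Proof.
rewrite (_ : [set s | _] = \bigcap_(i in [set: 'I_n])
  ((fun s : T => tnth s i) @^-1` `[-1, 1]%classic)); last first.
  apply/seteqP; split => s /= sc i; first by move=> _ /=; rewrite in_itv/=.
  by have := sc i I; rewrite /= in_itv.
apply: fin_bigcap_measurable => // i _.
by rewrite -[X in measurable X]setTI; exact: measurable_tnth.
Qed.

Lemma iid_in_cube : iid mu n [set s | in_cube s] = 1%E.
Proof.
have EM := expect_mean (iid mu n).
pose I1 : set (measurableTypeR R) := `[-1, 1]%classic.
have mI1 : measurable I1 by exact: measurable_itv.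
have mI i : bmeas (fun s : T => \1_I1 (tnth s i) : R).
  by apply: (bmeas_comp_measurable (measurable_tnth i)); exact: bmeas_indic.
have EI i : expect (iid mu n) (fun s : T => \1_I1 (tnth s i) : R) = 1.
  rewrite (expect_iid_tnth mu i (bmeas_indic R mI1)) expect_indic//.
  have [_ mu1 _ _] := hmu; by rewrite [mu I1]mu1.
have mC := measurable_in_cube.
suff E1 : 1 <= expect (iid mu n) (\1_[set s | in_cube s] : T -> R).
  apply/eqP; rewrite eq_le probability_le1//=.
  by move: E1; rewrite expect_indic// -lee_fin fineK// fin_num_measure.
(* Union bound: one minus the number of coordinates outside [[-1, 1]] is at most the indicator of
   the cube. *)
have <- : 1 - \sum_(i < n) expect (iid mu n) (fun s : T => 1 - \1_I1 (tnth s i)) = 1.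
  rewrite big1 ?subr0// => i _; rewrite (meanB EM) ?EI ?(mean_cst EM) ?subrr//.
  exact: bmeas_cst.
have m1I i : bmeas (fun s : T => 1 - \1_I1 (tnth s i) : R).
  by apply: bmeasB => //; exact: bmeas_cst.
rewrite -(mean_sum EM)// -[X in X - _](mean_cst EM) -(meanB EM); last first.
- exact: bmeas_sum.
- exact: bmeas_cst.
apply: (mean_le EM) => [| |s].
- by apply: bmeasB; [exact: bmeas_cst|exact: bmeas_sum].
- exact: bmeas_indic.
rewrite indicE; case: (boolP (s \in _)) => [_|].
  by rewrite gerBl sumr_ge0.
rewrite notin_setE/= => /existsNP[i si].
rewrite subr_le0 (bigD1 i)//= indicE memNset; last by rewrite /I1/= in_itv.
by rewrite subr0 lerDl sumr_ge0.
Qed.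

Lemma gibbs_weightE c (B : set T) : measurable B ->
  gibbs_weight mu A c B =
  (expect (iid mu n) (fun s => \1_B (spins s) * boltzmann c s))%:E.
Proof.
move=> mB; have mw := bmeas_boltzmann c.
have mBs : bmeas (fun s : T => \1_B (spins s) : R).
  by apply: (bmeas_comp_measurable measurable_spins); exact: bmeas_indic.
rewrite -integral_expect; last exact: bmeasM.
rewrite /gibbs_weight integral_mkcond.
have mH : measurable_fun [set: T] (fun s : T => (expR (hamiltonian A c s))%:E).
  apply/measurable_EFinP; apply: measurableT_comp => //.
  exact: measurable_hamiltonian.
apply: (ge0_integral_eq_on_full measurable_in_cube iid_in_cube).
- apply/(measurable_restrictT _ mB); exact: measurable_funTS.
- by apply/measurable_EFinP; have [] := bmeasM mBs mw.
- by move=> s; rewrite patchE; case: ifP => // _; rewrite lee_fin expR_ge0.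
- by move=> s; rewrite lee_fin mulr_ge0 ?expR_ge0.
- move=> s; rewrite inE/= => sc.
  have sE : spins s = s.
    by apply: eq_from_tnth => i; rewrite tnth_spins clamp_id.
  rewrite patchE /boltzmann sE indicE.
  by case: (s \in B); rewrite ?mul1r ?mul0r.
Qed.

Lemma gibbsE c (B : set T) : measurable B ->
  gibbs mu A c B = (gibbs_mean c (fun s => \1_B (spins s)))%:E.
Proof.
move=> mB; have w0 := partition_gt0 c.
have ZE : gibbs_weight mu A c [set: T] = (expect (iid mu n) (boltzmann c))%:E.
  rewrite gibbs_weightE//; congr (expect _ _)%:E.
  by apply/funext => s; rewrite indicT mul1r.
apply: etrans (mnormalizeE (iid mu n) B w0 ZE) _.
exact: (congr1 (mule^~ (EFin _)) (gibbs_weightE c mB)).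
Qed.

End gibbs_mean.

(** * Second moments of the noise *)

(** A linearized Cauchy-Schwarz: a second moment of order [delta ^+ 2] gives a first moment of order
    [delta]. Being linear in the second moment, the bound can be averaged again over the field. *)
Lemma normr_le_sqr (R : realType) (x delta : R) : 0 < delta ->
  `|x| <= delta + x ^+ 2 / delta.
Proof.
move=> d0; rewrite -[x ^+ 2]real_normK ?num_real//; set y := `|x|.
have [yd|/ltW dy] := leP y delta.
  by rewrite (le_trans yd)// lerDl divr_ge0 ?sqr_ge0// ltW.
apply: (@le_trans _ _ (y ^+ 2 / delta)); last by rewrite lerDr ltW.
by rewrite ler_pdivlMr// expr2 ler_wpM2l// /y.
Qed.

(** At an index where [M] is maximal the hypothesis reads [M k <= K + rho * M k]. *)
Lemma bounded_fixpoint (R : realType) n (m : 'I_n -> 'I_n -> R) (M : 'I_n -> R) K rho :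
  rho < 1 -> (forall i j, 0 <= m i j) -> (forall i, \sum_j m i j <= rho) ->
  (forall i, 0 <= M i) -> (forall i, M i <= K + \sum_j m i j * M j) ->
  forall i, M i <= K / (1 - rho).
Proof.
move=> rho1 m0 mr M0 MK i.
have [k _ kmax] := @arg_maxP _ _ _ i xpredT M isT.
apply: (le_trans (kmax i isT)); rewrite ler_pdivlMr ?subr_gt0//.
have := MK k; rewrite mulrBr mulr1 lerBlDr => /le_trans; apply; rewrite lerD2l.
apply: (@le_trans _ _ ((\sum_j m k j) * M k)).
  by rewrite mulr_suml ler_sum// => j _; rewrite ler_wpM2l//; exact: kmax.
by rewrite mulrC ler_wpM2l.
Qed.

Section mean_contraction.
Context d (T : measurableType d) (R : realType) (L : (T -> R) -> R).
Hypothesis LM : is_mean L.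
Variables (n : nat) (A : 'M[R]_n) (rho : R).
Hypotheses (rho0 : 0 < rho) (rho1 : rho < 1).
Hypothesis Arow : forall i, \sum_j `|A i j| <= rho.

(** Convexity with weights [1 - rho] and [rho]: [(p + r)^2 <= p^2 / (1 - rho) + r^2 / rho]. The
    factor [rho] from Cauchy-Schwarz cancels the division, so the squares are again coupled by
    [|A i j|], whose rows sum to at most [rho < 1]. *)
Lemma contraction_sqr (p y : R) (delta : 'I_n -> R) (v : 'I_n -> R) i :
  y = p + \sum_j A i j * delta j -> (forall j, `|delta j| <= `|v j|) ->
  y ^+ 2 <= p ^+ 2 / (1 - rho) + \sum_j `|A i j| * v j ^+ 2.
Proof.
move=> -> dv; set r := \sum_j A i j * delta j.
have r2 : r ^+ 2 <= rho * \sum_j `|A i j| * v j ^+ 2.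
  apply: (@le_trans _ _ ((\sum_j `|A i j| * `|v j|) ^+ 2)).
    rewrite -real_normK ?num_real// ler_pXn2r ?nnegrE ?sumr_ge0//.
      by rewrite (le_trans (ler_norm_sum _ _ _))// ler_sum// => j _; rewrite normrM ler_wpM2l.
  apply: le_trans (weighted_sum_sqr (fun j => `|v j|) _ (Arow i)) _ => //.
  by rewrite ler_wpM2l ?(ltW rho0)// ler_sum// => j _; rewrite real_normK ?num_real.
apply: (@le_trans _ _ (p ^+ 2 / (1 - rho) + r ^+ 2 / rho)); last first.
  by rewrite lerD2l ler_pdivrMr// mulrC.
have k0 : 0 < 1 - rho by rewrite subr_gt0.
rewrite -subr_ge0.
rewrite (_ : _ - _ = (rho * p - (1 - rho) * r) ^+ 2 / (rho * (1 - rho))).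
  by rewrite divr_ge0 ?sqr_ge0// mulr_ge0// ltW.
by field; rewrite !gt_eqF.
Qed.

Lemma mean_contraction (p v : 'I_n -> T -> R) (delta : 'I_n -> T -> R) :
  (forall i, bmeas (p i)) -> (forall i, bmeas (v i)) ->
  (forall i w, v i w = p i w + \sum_j A i j * delta j w) ->
  (forall j w, `|delta j w| <= `|v j w|) ->
  forall i, L (fun w => v i w ^+ 2) <=
    L (fun w => p i w ^+ 2) / (1 - rho) + \sum_j `|A i j| * L (fun w => v j w ^+ 2).
Proof.
move=> mp mv vE dv i.
have mv2 j : bmeas (fun w => v j w ^+ 2) by exact: bmeasX.
have mp2 : bmeas (fun w => (1 - rho)^-1 * p i w ^+ 2) by apply: bmeasZ; exact: bmeasX.
have ms j : bmeas (fun w => `|A i j| * v j w ^+ 2) by exact: bmeasZ.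
rewrite mulrC -(meanZ LM); last exact: bmeasX.
under [X in _ + X]eq_bigr do rewrite -(meanZ LM) //.
rewrite -(mean_sum LM)// -(meanD LM)//; last exact: bmeas_sum.
apply: (mean_le LM) => // [|w]; first by apply: bmeasD => //; exact: bmeas_sum.
by rewrite mulrC; apply: (contraction_sqr (vE i w)) => j; exact: dv.
Qed.

End mean_contraction.

Section conditional_noise.
Context (R : realType) (mu : probability (measurableTypeR R) R).
Hypothesis hmu : base_measure mu.
Variables (n : nat) (A : 'M[R]_n).
Hypothesis cA : coupling_matrix A.
Local Notation T := (n.-tuple (measurableTypeR R)).
Local Notation G := (gibbs_mean mu A).
Hypothesis Arow : forall i, \sum_j `|A i j| <= 1.

Let GM := gibbs_meanP mu A.

Variables (k : R -> R -> R) (B K : R).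
Hypotheses (B0 : 0 <= B) (K0 : 0 <= K).
Hypothesis mk : forall t, bmeas (fun z : measurableTypeR R => k (clamp z) t).
Hypothesis k0 : forall t, expect mu (fun z => k (clamp z) t * expR (t * clamp z)) = 0.
Hypothesis mki : forall c i, bmeas (fun s : T => k (tnth (spins s) i) (local_field A c s i)).
Hypothesis kB : forall z t, `|z| <= 1 -> `|k z t| <= B.
Hypothesis kK : forall z t t', `|z| <= 1 -> `|k z t - k z t'| <= K * `|t - t'|.

Definition noise c i (s : T) := k (tnth (spins s) i) (local_field A c s i).

(** Freezing spin [i] at 0 inside the noise [j] makes that noise orthogonal to the noise [i].
    Freezing moves the local field at [j] by at most [|A i j|], hence the noise [j] by at most
    [K * |A i j|]. *)
Lemma noise_pair c i j : i != j ->
  `|G c (fun s => noise c i s * noise c j s)| <= B * K * `|A i j|.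
Proof.
move=> ij.
pose nj0 s := noise c j (upd s i 0).
have mn l : bmeas (noise c l) by exact: mki.
have mnj0 : bmeas nj0.
  apply: (bmeas_comp_measurable (X := fun s : T => upd s i 0)) (mn j).
  exact: (measurableT_comp (@measurable_upd _ (measurableTypeR R) n i) (measurable_pair2 (0 : measurableTypeR R))).
have nj0_indep : indep_of (T := measurableTypeR R) i nj0.
  move=> s z; rewrite /nj0; congr noise; apply: eq_from_tnth => l.
  by rewrite !tnth_upd; case: (l == i).
have -> : G c (fun s => noise c i s * noise c j s) =
    G c (fun s => noise c i s * (noise c j s - nj0 s)).
  rewrite (_ : (fun s => noise c i s * (_ - _)) =
    fun s => noise c i s * noise c j s - noise c i s * nj0 s); last first.
    by apply/funext => s; rewrite mulrBr.
  rewrite (meanB (GM c)); [|exact: bmeasM|exact: bmeasM].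
  have -> : G c (fun s => noise c i s * nj0 s) = 0.
    exact: (gibbs_mean_centered cA mk k0 (mki c i) mnj0 nj0_indep).
  by rewrite subr0.
apply: (mean_norm_le_cst (GM c)) => [|s]; first by apply: bmeasM => //; exact: bmeasB.
rewrite normrM -mulrA ler_pM//; first by apply: kB; exact: spins_norm.
rewrite /nj0 /noise spins_upd tnth_upd eq_sym (negbTE ij).
rewrite (le_trans (kK _ _ (spins_norm _ _)))// ler_wpM2l//.
rewrite local_field_upd opprD addNKr normrN normrM cA.1 ler_piMr//.
by rewrite /clamp min_r// max_r ?lerN10// sub0r normrN spins_norm.
Qed.

(** The diagonal contributes [B ^+ 2]; the correlations of [noise_pair] are summed by the Schur test
    with row sums at most 1. *)
Lemma noise_sum_sqr c (x : 'I_n -> R) :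
  G c (fun s => (\sum_i x i * noise c i s) ^+ 2) <= (B ^+ 2 + B * K) * \sum_i x i ^+ 2.
Proof.
have mn l : bmeas (noise c l) by exact: mki.
rewrite (_ : (fun s => _) = (fun s => \sum_i \sum_j
  (x i * x j) * (noise c i s * noise c j s))); last first.
  apply/funext => s; rewrite expr2 mulr_suml; apply: eq_bigr => i _.
  by rewrite mulr_sumr; apply: eq_bigr => j _; rewrite mulrACA.
have mij i j : bmeas (fun s => (x i * x j) * (noise c i s * noise c j s)).
  by apply: bmeasZ; exact: bmeasM.
rewrite (mean_sum (GM c)); last by move=> i; exact: bmeas_sum.
apply: (@le_trans _ _ (\sum_i (x i ^+ 2 * B ^+ 2 +
   \sum_j `|x i| * `|x j| * `|A i j| * (B * K)))); last first.
  rewrite big_split/= -mulr_suml mulrDl lerD//; first by rewrite mulrC.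
  under eq_bigr do rewrite -mulr_suml.
  rewrite -mulr_suml mulrC ler_wpM2l ?mulr_ge0//.
  by rewrite -[leRHS]mul1r; apply: schur_test => // i j; rewrite cA.1.
apply: ler_sum => i _; rewrite (mean_sum (GM c))// (bigD1 i)//= lerD//.
  apply: (mean_le_cst (GM c)) => // s; rewrite -!expr2 ler_wpM2l ?sqr_ge0//.
  rewrite -[leLHS]real_normK ?num_real// ler_pXn2r ?nnegrE//.
  by apply: kB; exact: spins_norm.
rewrite [leRHS](bigD1 i)//= cA.2 normr0 mulr0 mul0r add0r ler_sum// => j ji.
rewrite (meanZ (GM c)); last exact: bmeasM.
rewrite (le_trans (ler_norm _))// normrM [X in X * _]normrM -[leRHS]mulrA.
rewrite ler_wpM2l ?mulr_ge0//.
by rewrite mulrC noise_pair// eq_sym.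
Qed.

End conditional_noise.

Section gibbs_moments.
Context (R : realType) (mu : probability (measurableTypeR R) R).
Hypothesis hmu : base_measure mu.
Variables (n : nat) (A : 'M[R]_n).
Hypothesis cA : coupling_matrix A.
Local Notation T := (n.-tuple (measurableTypeR R)).
Local Notation G := (gibbs_mean mu A).
Variables (rho a : R).
Hypotheses (rho0 : 0 < rho) (rho1 : rho < 1).
Hypothesis Arow : forall i, \sum_j `|A i j| <= rho.
Hypothesis Asqr : forall i, \sum_j A i j ^+ 2 <= a.

Let GM := gibbs_meanP mu A.
Let Arow1 i : \sum_j `|A i j| <= 1. Proof. exact: le_trans (Arow i) (ltW rho1). Qed.

Definition xi c i (s : T) :=
  tnth (spins s) i - dpsi mu (local_field A c s i).

(** The fluctuation of [sigma_i * xi_i] around its conditional mean [psi''] of the local field: the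
    second noise, which drives the variance term of Stein's identity. *)
Definition eta c i (s : T) :=
  tnth (spins s) i * xi c i s - ddpsi mu (local_field A c s i).

Lemma bmeas_dpsi_local c i : bmeas (fun s : T => dpsi mu (local_field A c s i)).
Proof.
have [mh _] := bmeas_local_field A c i.
exact: (bmeas_comp_measurable (T2 := measurableTypeR R) mh (bmeas_dpsi hmu)).
Qed.

Lemma bmeas_ddpsi_local c i : bmeas (fun s : T => ddpsi mu (local_field A c s i)).
Proof.
have [mh _] := bmeas_local_field A c i.
exact: (bmeas_comp_measurable (T2 := measurableTypeR R) mh (bmeas_ddpsi hmu)).
Qed.

Lemma bmeas_xi c i : bmeas (xi c i).
Proof. by apply: bmeasB; [exact: bmeas_spin|exact: bmeas_dpsi_local]. Qed.

Lemma bmeas_eta c i : bmeas (eta c i).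
Proof.
apply: bmeasB; last exact: bmeas_ddpsi_local.
by apply: bmeasM; [exact: bmeas_spin|exact: bmeas_xi].
Qed.

Lemma xi_norm c i s : `|xi c i s| <= 2.
Proof.
rewrite (le_trans (ler_normB _ _))// -[leRHS]/(1 + 1 : R).
by rewrite lerD ?spins_norm// dpsi_norm.
Qed.

Lemma xi_centered c i h : bmeas h -> indep_of (T := measurableTypeR R) i h ->
  G c (fun s => xi c i s * h s) = 0.
Proof.
apply: (gibbs_mean_centered cA (k := fun z t => z - dpsi mu t)) => [t|t|].
- by apply: bmeasB; [exact: bmeas_clamp|exact: bmeas_cst].
- exact: tilt_centered.
- exact: bmeas_xi.
Qed.

Lemma xi_sum_sqr c (x : 'I_n -> R) :
  G c (fun s => (\sum_i x i * xi c i s) ^+ 2) <= 6 * \sum_i x i ^+ 2.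
Proof.
rewrite (_ : 6 = 2 ^+ 2 + 2 * 1 :> R); last by ring.
apply: (noise_sum_sqr cA Arow1 (k := fun z t => z - dpsi mu t)) => //.
- by move=> t; apply: bmeasB; [exact: bmeas_clamp|exact: bmeas_cst].
- exact: tilt_centered.
- exact: bmeas_xi.
- move=> z t z1; rewrite (le_trans (ler_normB _ _))// -[leRHS]/(1 + 1 : R).
  by rewrite lerD// dpsi_norm.
- move=> z t t' _; rewrite opprD addrACA subrr add0r opprK addrC mul1r.
  by rewrite [leRHS]distrC dpsi_lipschitz.
Qed.

Lemma eta_sum_sqr c (x : 'I_n -> R) :
  G c (fun s => (\sum_i x i * eta c i s) ^+ 2) <= 30 * \sum_i x i ^+ 2.
Proof.
(* The bound is [3 = 2 + 1], for [z (z - psi')] and [psi'']; the Lipschitz constant in the field is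
   [7 = 1 + 6], for [psi'] and [psi'']. *)
rewrite (_ : 30 = 3 ^+ 2 + 3 * 7 :> R); last by ring.
apply: (noise_sum_sqr cA Arow1
  (k := fun z t => z * (z - dpsi mu t) - ddpsi mu t)) => //.
- move=> t; have mc := @bmeas_clamp R; apply: bmeasB; last exact: bmeas_cst.
  by apply: bmeasM => //; apply: bmeasB => //; exact: bmeas_cst.
- exact: tilt_centered2.
- exact: bmeas_eta.
- move=> z t z1; rewrite (le_trans (ler_normB _ _))// (_ : 3 = 2 + 1 :> R); last by ring.
  rewrite lerD//; last by rewrite ger0_norm ?ddpsi_le1// ltW// ddpsi_gt0.
  rewrite normrM -[leRHS]mul1r ler_pM// (le_trans (ler_normB _ _))//.
  by rewrite -[leRHS]/(1 + 1 : R) lerD// dpsi_norm.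
- move=> z t t' z1.
  have E (p p' d d' : R) : z * (z - p) - d - (z * (z - p') - d') =
    z * (p' - p) + (d' - d) by ring.
  rewrite E {E}.
  rewrite (le_trans (ler_normD _ _))// (_ : 7 = 1 + 6 :> R); last by ring.
  rewrite mulrDl [`|t - t'|]distrC lerD ?ddpsi_lipschitz// normrM ler_pM//.
  exact: dpsi_lipschitz.
Qed.

Lemma row_xi_sqr c i : G c (fun s => (\sum_j A i j * xi c j s) ^+ 2) <= 6 * a.
Proof. by rewrite (le_trans (xi_sum_sqr _ _))// ler_wpM2l. Qed.

Lemma bmeas_row_xi c i : bmeas (fun s => \sum_j A i j * xi c j s).
Proof. by apply: bmeas_sum => j; apply: bmeasZ; exact: bmeas_xi. Qed.

(** Subtracting the fixed-point equation leaves a row of noises plus [A] applied to terms no larger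
    than the deviation itself. One factor [1 / (1 - rho)] comes from splitting the square, the other
    from [bounded_fixpoint]. *)
Lemma mean_field_deviation c u :
  (forall i, tnth u i = dpsi mu (tnth c i + mfield A u i)) -> forall i,
  G c (fun s => (mfield A (spins s) i - mfield A u i) ^+ 2) <= 6 * a / (1 - rho) ^+ 2.
Proof.
move=> hu i; pose y i (s : T) := mfield A (spins s) i - mfield A u i.
have my j : bmeas (y j) by apply: bmeasB; [exact: bmeas_mfield|exact: bmeas_cst].
pose delta j (s : T) := dpsi mu (local_field A c s j) - tnth u j.
have k0 : 0 < 1 - rho by rewrite subr_gt0.
rewrite expr2 invfM mulrA; apply: (bounded_fixpoint rho1 (m := fun i j => `|A i j|)
  (M := fun i => G c (fun s => y i s ^+ 2))) => // j.
  by apply: (mean_ge0 (GM c)) => [|s]; [exact: bmeasX|exact: sqr_ge0].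
apply: le_trans (mean_contraction (GM c) rho0 rho1 Arow (bmeas_row_xi c) my
  (delta := delta) _ _ j) _ => [l s|l s|].
- rewrite /y /mfield -sumrB -big_split; apply: eq_bigr => m _ /=.
  by rewrite /xi /delta -mulrDr -mulrBr addrA subrK.
- by rewrite /delta hu (le_trans (dpsi_lipschitz hmu _ _))// /local_field opprD addrACA subrr add0r.
- by rewrite lerD2r ler_wpM2r ?invr_ge0 ?(ltW k0)// row_xi_sqr.
Qed.

Definition field_sqr (c : n.-tuple R) i := G c (fun s => mfield A (spins s) i ^+ 2).

(** The value of [m_i] when each spin is replaced by its mean under its own field alone; its
    randomness comes from the field, not from the spins. *)
Definition noise_field (c : n.-tuple R) i := \sum_j A i j * dpsi mu (tnth c j).

Lemma field_sqr_ge0 c i : 0 <= field_sqr c i.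
Proof.
apply: (mean_ge0 (GM c)) => [|s]; last exact: sqr_ge0.
by apply: bmeasX; exact: bmeas_mfield.
Qed.

Lemma field_sqr_le c i : field_sqr c i <=
  (12 * a + 2 * noise_field c i ^+ 2) / (1 - rho) + \sum_j `|A i j| * field_sqr c j.
Proof.
have k0 : 0 < 1 - rho by rewrite subr_gt0.
pose p i (s : T) := \sum_j A i j * xi c j s + noise_field c i.
have mp j : bmeas (p j) by apply: bmeasD; [exact: bmeas_row_xi|exact: bmeas_cst].
pose delta j (s : T) := dpsi mu (local_field A c s j) - dpsi mu (tnth c j).
apply: le_trans (mean_contraction (GM c) rho0 rho1 Arow mp
  (v := fun i s => mfield A (spins s) i) (delta := delta) _ _ _ i) _.
- by move=> j; exact: bmeas_mfield.
- move=> l s; rewrite /p /noise_field /mfield -!big_split; apply: eq_bigr => m _ /=.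
  have E (x y z w : R) : x * y = x * (y - z) + x * w + x * (z - w) by ring.
  exact: E.
- move=> l s; rewrite (le_trans (dpsi_lipschitz hmu _ _))//.
  by rewrite /local_field [tnth c l + _]addrC addrK.
rewrite lerD2r ler_wpM2r ?invr_ge0 ?(ltW k0)//.
have mx2 := bmeasX 2 (bmeas_row_xi c i).
apply: (@le_trans _ _ (G c (fun s => 2 * (\sum_j A i j * xi c j s) ^+ 2 +
   2 * noise_field c i ^+ 2))).
  apply: (mean_le (GM c)) => [| |s]; first exact: bmeasX.
    by apply: bmeasD; [exact: bmeasZ|exact: bmeas_cst].
  by rewrite /p; set x := \sum_j _; have := sqr_ge0 (x - noise_field c i); lra.
rewrite (meanD (GM c)); [|exact: bmeasZ|exact: bmeas_cst].
rewrite (mean_cst (GM c)) lerD2r (meanZ (GM c))//.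
by have := row_xi_sqr c i; lra.
Qed.

Lemma mfield_optimizer_sqr c u :
  (forall i, tnth u i = dpsi mu (tnth c i + mfield A u i)) -> forall i,
  mfield A u i ^+ 2 <= 2 * field_sqr c i + 12 * a / (1 - rho) ^+ 2.
Proof.
move=> hu i; have dev := mean_field_deviation hu i.
have m1 : bmeas (fun s : T => mfield A (spins s) i ^+ 2).
  by apply: bmeasX; exact: bmeas_mfield.
have m2 : bmeas (fun s : T => (mfield A (spins s) i - mfield A u i) ^+ 2).
  by apply: bmeasX; apply: bmeasB; [exact: bmeas_mfield|exact: bmeas_cst].
apply: (@le_trans _ _ (2 * field_sqr c i + 2 * (6 * a / (1 - rho) ^+ 2))); last first.
  by rewrite !mulrA lerD2l -natrM.
apply: (@le_trans _ _ (2 * field_sqr c i +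
  2 * G c (fun s => (mfield A (spins s) i - mfield A u i) ^+ 2))); last first.
  by rewrite lerD2l ler_wpM2l.
rewrite -(meanZ (GM c))// /field_sqr -(meanZ (GM c))// -(meanD (GM c)); try exact: bmeasZ.
rewrite -[leLHS](mean_cst (GM c)); apply: (mean_le (GM c)) => [| |s].
- exact: bmeas_cst.
- by apply: bmeasD; exact: bmeasZ.
set x := mfield A (spins s) i; set y := mfield A u i.
by have := sqr_ge0 (2 * x - y); lra.
Qed.

End gibbs_moments.

(** * Linearization and the conditional characteristic function *)

(** [K] stays free because it must balance a small residual against a large sum of squares of [m];
    it is finally set to [n * a / delta]. *)
Lemma young_le (R : realType) (K x y : R) : 0 < K -> 0 <= x -> 0 <= y ->
  x * y <= K * x ^+ 2 + y ^+ 2 / K.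
Proof.
move=> K0 x0 y0; rewrite -subr_ge0.
rewrite (_ : _ - _ = ((K * x - y) ^+ 2 + K * x * y) / K).
  by apply: divr_ge0 (ltW K0); rewrite addr_ge0 ?sqr_ge0// mulr_ge0// mulr_ge0// ltW.
by field; rewrite gt_eqF.
Qed.

Section linearization.
Context (R : realType) (mu : probability (measurableTypeR R) R).
Hypothesis hmu : base_measure mu.
Variables (n : nat) (A : 'M[R]_n) (q : 'I_n -> R) (lam : R) (c : n.-tuple R).

(* [q - lam (I - A D) q] with [D = diag (psi'' c)]: the error made when
   [lam q] replaces the solution [v] of [v = q + A D v]. *)
Definition residual j : R :=
  (1 - lam) * q j + lam * \sum_i q i * ddpsi mu (tnth c i) * A i j.

(** A deterministic identity used twice: for the spins with [zeta = xi], and for the optimizer with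
    [zeta = 0]. It comes from evaluating [sum_i residual i * x i] in two ways, by the definition of
    [residual] and by the equation for [x]. The three residual terms are kept apart since each is
    small for its own reason: orthogonality of the noise, centring of the field, and plain size. *)
Lemma linearization (x zeta : 'I_n -> R) :
  (forall i, x i = zeta i + dpsi mu (tnth c i + \sum_j A i j * x j)) ->
  `|\sum_i q i * x i - lam * \sum_i q i * dpsi mu (tnth c i)
    - lam * \sum_i q i * zeta i| <=
  6 * `|lam| * \sum_i `|q i| * (\sum_j A i j * x j) ^+ 2 +
  `|\sum_i residual i * zeta i| + `|\sum_i residual i * dpsi mu (tnth c i)| +
  \sum_i `|residual i| * `|\sum_j A i j * x j|.
Proof.
move=> xE; pose v i := \sum_j A i j * x j.
pose d0 i := dpsi mu (tnth c i + v i) - dpsi mu (tnth c i).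
pose r i := d0 i - v i * ddpsi mu (tnth c i).
have d0_le i : `|d0 i| <= `|v i|.
  by rewrite /d0 (le_trans (dpsi_lipschitz hmu _ _))// addrAC subrr add0r.
have r_le i : `|r i| <= 6 * v i ^+ 2.
  exact: (taylor1 (is_derive_dpsi hmu) (ddpsi_lipschitz hmu)).
have qvE : \sum_i residual i * x i =
    (1 - lam) * \sum_i q i * x i + lam * \sum_i q i * ddpsi mu (tnth c i) * v i.
  rewrite /residual; under eq_bigr do rewrite mulrDl.
  rewrite big_split/=; congr (_ + _).
    by rewrite mulr_sumr; apply: eq_bigr => i _; rewrite mulrA.
  under eq_bigr do rewrite -mulrA mulr_suml.
  rewrite -mulr_sumr exchange_big/=; congr (_ * _); apply: eq_bigr => i _.
  by rewrite /v mulr_sumr; apply: eq_bigr => j _; rewrite mulrA.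
have rxE : \sum_i residual i * x i = \sum_i residual i * zeta i +
    \sum_i residual i * dpsi mu (tnth c i) + \sum_i residual i * d0 i.
  rewrite -!big_split; apply: eq_bigr => i _ /=.
  have E (w z p p' : R) : w * (z + p') = w * z + w * p + w * (p' - p) by ring.
  by rewrite {1}xE; exact: E.
have qxE : \sum_i q i * x i = \sum_i q i * zeta i + \sum_i q i * dpsi mu (tnth c i) +
    \sum_i q i * ddpsi mu (tnth c i) * v i + \sum_i q i * r i.
  rewrite -!big_split; apply: eq_bigr => i _ /=.
  have E (w z p d t p' : R) : p' = p + (t + d) -> w * (z + p') = w * z + w * p + w * d + w * t.
    by move=> ->; ring.
  rewrite {1}xE mulrAC -[q i * v i * _]mulrA; apply: E.
  by rewrite /r subrK /d0 [RHS]addrC subrK.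
have -> : \sum_i q i * x i - lam * \sum_i q i * dpsi mu (tnth c i)
    - lam * \sum_i q i * zeta i = lam * \sum_i q i * r i +
    \sum_i residual i * zeta i + \sum_i residual i * dpsi mu (tnth c i) +
    \sum_i residual i * d0 i.
  move: qvE rxE qxE; move: (\sum_i residual i * x i) (\sum_i residual i * zeta i)
    (\sum_i residual i * dpsi mu (tnth c i)) (\sum_i residual i * d0 i)
    (\sum_i q i * x i) (\sum_i q i * dpsi mu (tnth c i)) (\sum_i q i * zeta i)
    (\sum_i q i * ddpsi mu (tnth c i) * v i) (\sum_i q i * r i).
  clear=> a b e f g h i j k E1 E2 E3.
  have -> : b = a - e - f by rewrite E2; ring.
  by rewrite E1 E3; ring.
rewrite (le_trans (ler_normD _ _))// lerD//; last first.
  rewrite (le_trans (ler_norm_sum _ _ _))// ler_sum// => i _.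
  by rewrite normrM ler_wpM2l// d0_le.
rewrite (le_trans (ler_normD _ _))// lerD// (le_trans (ler_normD _ _))// lerD//.
rewrite normrM mulrAC mulrC ler_wpM2r// (le_trans (ler_norm_sum _ _ _))//.
rewrite mulr_sumr ler_sum// => i _; rewrite normrM mulrCA ler_wpM2l//.
Qed.

End linearization.

Section conditional_charfun.
Context (R : realType) (mu : probability (measurableTypeR R) R).
Hypothesis hmu : base_measure mu.
Variables (n : nat) (A : 'M[R]_n).
Hypothesis cA : coupling_matrix A.
Local Notation T := (n.-tuple (measurableTypeR R)).
Local Notation G := (gibbs_mean mu A).
Variables (rho a : R).
Hypotheses (rho0 : 0 < rho) (rho1 : rho < 1) (a0 : 0 < a).
Hypothesis Arow : forall i, \sum_j `|A i j| <= rho.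
Hypothesis Asqr : forall i, \sum_j A i j ^+ 2 <= a.
Variables (q : 'I_n -> R) (lam kappa delta K : R).
Hypotheses (delta0 : 0 < delta) (K0 : 0 < K).
Hypothesis q1 : \sum_i q i ^+ 2 = 1.
Hypotheses (lamkappa0 : 0 <= lam * kappa).

Let GM := gibbs_meanP mu A.
Let res c := residual mu A q lam c.
Let msq c := field_sqr mu A c.
Let b := 12 * a / (1 - rho) ^+ 2.

Let b_ge0 : 0 <= b. Proof. by rewrite /b divr_ge0 ?sqr_ge0// mulr_ge0// ltW. Qed.

(** In [3 * msq c i + b], one [msq] comes from linearizing the spins, and [2 * msq + b] bounds the
    square of the optimizer's field. The doubled residual terms occur in both linearizations; the
    term divided by [delta] occurs once, as the optimizer carries no noise. *)
Definition err_linear c : R :=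
  6 * `|lam| * \sum_i `|q i| * (3 * msq c i + b) + (delta + 6 * (\sum_i res c i ^+ 2) / delta) +
  2 * `|\sum_i res c i * dpsi mu (tnth c i)| +
  (2 * (K * (\sum_i res c i ^+ 2)) + (\sum_i (3 * msq c i + b)) / K).

(** Three sources: the noise [eta], the replacement of the local field by [c_i] (6 is the Lipschitz
    constant of [psi'']), and the empirical mean of [psi'' (c_i)] against [kappa]. *)
Definition err_variance c : R :=
  `|lam| * ((delta + 30 * (\sum_i q i ^+ 4) / delta) +
    6 * (delta + (\sum_i q i ^+ 2 * msq c i) / delta) +
    `|\sum_i q i ^+ 2 * (ddpsi mu (tnth c i) - kappa)|).

(* The two centerings used for the statistic: around the Mean-Field optimizer,
   and around the linear statistic of the field. *)
Definition is_center c (y : R) :=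
  y = lam * \sum_i q i * dpsi mu (tnth c i) \/
  exists2 u : n.-tuple R,
    forall i, tnth u i = dpsi mu (tnth c i + mfield A u i) &
    y = \sum_i q i * tnth u i.

Let young (e m : R) : `|e| * `|m| <= K * e ^+ 2 + m ^+ 2 / K.
Proof.
rewrite -[e ^+ 2]real_normK ?num_real// -[m ^+ 2]real_normK ?num_real//.
exact: young_le.
Qed.

Let linear_stat (s : T) := \sum_i q i * tnth (spins s) i.

Let bmeas_linear : bmeas linear_stat.
Proof. by apply: bmeas_sum => i; apply: bmeasZ; exact: bmeas_spin. Qed.

Let bmeas_noise (x : 'I_n -> R) c : bmeas (fun s : T => \sum_i x i * xi mu A c i s).
Proof. by apply: bmeas_sum => i; apply: bmeasZ; exact: bmeas_xi. Qed.

Let mean_abs_sum_xi c (x : 'I_n -> R) :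
  G c (fun s => `|\sum_i x i * xi mu A c i s|) <= delta + 6 * (\sum_i x i ^+ 2) / delta.
Proof.
have mx := bmeas_noise x c; have mx2 := bmeasX 2 mx.
apply: (@le_trans _ _ (G c (fun s => delta + delta^-1 * (\sum_i x i * xi mu A c i s) ^+ 2))).
  apply: (mean_le (GM c)) => [| |s]; first exact: bmeas_norm.
    by apply: bmeasD; [exact: bmeas_cst|exact: bmeasZ].
  by rewrite [delta^-1 * _]mulrC normr_le_sqr.
rewrite (meanD (GM c)); [|exact: bmeas_cst|exact: bmeasZ].
rewrite (mean_cst (GM c)) (meanZ (GM c))// lerD2l mulrC ler_wpM2r ?invr_ge0 ?(ltW delta0)//.
exact: (xi_sum_sqr hmu cA rho1 Arow).
Qed.

Lemma linear_center_close c :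
  G c (fun s => `|linear_stat s - lam * (\sum_i q i * dpsi mu (tnth c i))
    - lam * \sum_i q i * xi mu A c i s|) <=
  6 * `|lam| * \sum_i `|q i| * msq c i + (delta + 6 * (\sum_i res c i ^+ 2) / delta) +
  `|\sum_i res c i * dpsi mu (tnth c i)| +
  (K * (\sum_i res c i ^+ 2) + (\sum_i msq c i) / K).
Proof.
have mm i : bmeas (fun s : T => mfield A (spins s) i) by exact: bmeas_mfield.
have mm2 i := bmeasX 2 (mm i).
pose f1 (s : T) := 6 * `|lam| * \sum_i `|q i| * mfield A (spins s) i ^+ 2.
pose f2 (s : T) := `|\sum_i res c i * xi mu A c i s|.
pose f3 (s : T) := `|\sum_i res c i * dpsi mu (tnth c i)|.
pose f4 (s : T) := K * (\sum_i res c i ^+ 2) + K^-1 * \sum_i mfield A (spins s) i ^+ 2.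
have mf1 : bmeas f1 by apply: bmeasZ; apply: bmeas_sum => i; exact: bmeasZ.
have mf2 : bmeas f2 by exact/bmeas_norm/bmeas_noise.
have mf3 : bmeas f3 by exact: bmeas_cst.
have mf4 : bmeas f4.
  by apply: bmeasD; [exact: bmeas_cst|apply: bmeasZ; exact: bmeas_sum].
apply: (@le_trans _ _ (G c (fun s => f1 s + f2 s + f3 s + f4 s))).
  apply: (mean_le (GM c)) => [| |s].
  - apply/bmeas_norm/bmeasB; last exact/bmeasZ/bmeas_noise.
    by apply: bmeasB => //; exact: bmeas_cst.
  - by do 3 (apply: bmeasD => //).
  have xE i : tnth (spins s) i = xi mu A c i s +
      dpsi mu (tnth c i + \sum_j A i j * tnth (spins s) j) by rewrite /xi subrK.
  apply: (le_trans (linearization hmu q lam xE)).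
  rewrite lerD2l /f4 mulr_sumr mulr_sumr -big_split ler_sum// => i _ /=.
  by rewrite [_^-1 * _]mulrC young.
have mf12 := bmeasD mf1 mf2.
rewrite (meanD (GM c) (bmeasD mf12 mf3) mf4) (meanD (GM c) mf12 mf3).
rewrite (meanD (GM c) mf1 mf2) [G c f3](mean_cst (GM c)); apply: lerD; last first.
  rewrite /f4 (meanD (GM c)); [|exact: bmeas_cst|by apply: bmeasZ; exact: bmeas_sum].
  rewrite (mean_cst (GM c)) lerD2l (meanZ (GM c)); last exact: bmeas_sum.
  by rewrite (mean_sum (GM c))// mulrC.
rewrite lerD2r; apply: lerD; last exact: mean_abs_sum_xi.
rewrite /f1 (meanZ (GM c)); last by apply: bmeas_sum => i; exact: bmeasZ.
rewrite (mean_sum (GM c)); last by move=> i; exact: bmeasZ.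
by under eq_bigr do rewrite (meanZ (GM c))//.
Qed.

Lemma center_close c y : is_center c y ->
  G c (fun s => `|linear_stat s - y - lam * \sum_i q i * xi mu A c i s|) <= err_linear c.
Proof.
have close := linear_center_close c.
have msq0 i : 0 <= msq c i by exact: field_sqr_ge0.
set P := `|\sum_i res c i * dpsi mu (tnth c i)| in close.
set Nc := \sum_i res c i ^+ 2 in close.
have P0 : 0 <= P by exact: normr_ge0.
have N0 : 0 <= Nc by apply: sumr_ge0 => i _; exact: sqr_ge0.
have slack : 6 * `|lam| * \sum_i `|q i| * msq c i + (delta + 6 * Nc / delta) + P +
    (K * Nc + (\sum_i msq c i) / K) <=
    6 * `|lam| * \sum_i `|q i| * (3 * msq c i + b) + (delta + 6 * Nc / delta) + 2 * P +
    (2 * (K * Nc) + (\sum_i (3 * msq c i + b)) / K).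
  have le3 i : msq c i <= 3 * msq c i + b by move: (msq0 i) b_ge0; lra.
  rewrite lerD//; last first.
    rewrite lerD//; first by rewrite ler_peMl ?ler1n// mulr_ge0// ltW.
    by rewrite ler_wpM2r ?invr_ge0 ?(ltW K0)// ler_sum.
  rewrite lerD//; last by lra.
  by rewrite lerD2r ler_wpM2l ?mulr_ge0// ler_sum// => i _; rewrite ler_wpM2l.
case=> [->|[u hu ->]]; first exact: le_trans slack.
pose y0 := lam * \sum_i q i * dpsi mu (tnth c i).
have uy : `|\sum_i q i * tnth u i - y0| <=
    6 * `|lam| * \sum_i `|q i| * (2 * msq c i + b) + P +
    (K * Nc + (\sum_i (2 * msq c i + b)) / K).
  have uE i : tnth u i = 0 + dpsi mu (tnth c i + \sum_j A i j * tnth u j).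
    by rewrite add0r hu.
  have u2 i : (\sum_j A i j * tnth u j) ^+ 2 <= 2 * msq c i + b.
    exact: (mfield_optimizer_sqr hmu cA rho0 rho1 Arow Asqr hu).
  have := linearization hmu q lam uE.
  rewrite [X in _ - lam * X]big1; last by move=> i _; rewrite mulr0.
  rewrite [X in _ + `|X| + _ + _]big1; last by move=> i _; rewrite mulr0.
  rewrite mulr0 subr0 normr0 addr0 => /le_trans; apply.
  rewrite lerD//.
    by rewrite lerD2r ler_wpM2l ?mulr_ge0// ler_sum// => i _; rewrite ler_wpM2l.
  rewrite mulr_sumr mulr_suml -big_split ler_sum// => i _ /=.
  by rewrite (le_trans (young _ _))// lerD2l ler_wpM2r ?invr_ge0 ?(ltW K0).
set yu := \sum_i q i * tnth u i in uy *.
pose Z (s : T) := linear_stat s - y0 - lam * \sum_i q i * xi mu A c i s.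
have mlx : bmeas (fun s : T => lam * \sum_i q i * xi mu A c i s).
  by apply: bmeasZ; exact: bmeas_noise.
have mZ : bmeas Z by apply: bmeasB => //; apply: bmeasB => //; exact: bmeas_cst.
apply: (@le_trans _ _ (G c (fun s => `|Z s| + `|yu - y0|))).
  apply: (mean_le (GM c)) => [| |s].
  - by apply/bmeas_norm/bmeasB => //; apply: bmeasB => //; exact: bmeas_cst.
  - by apply: bmeasD; [exact: bmeas_norm|exact: bmeas_cst].
  rewrite (_ : _ - _ - _ = Z s - (yu - y0)) ?ler_normB//.
  by rewrite /Z opprB addrACA addrA subrK addrAC.
rewrite (meanD (GM c)); [|exact: bmeas_norm|exact: bmeas_cst].
rewrite (mean_cst (GM c)); apply: (le_trans (lerD close uy)).
have split3 (w : 'I_n -> R) : \sum_i w i * (3 * msq c i + b) =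
    \sum_i w i * msq c i + \sum_i w i * (2 * msq c i + b).
  by rewrite -big_split; apply: eq_bigr => i _ /=; ring.
have := split3 (fun=> 1); under eq_bigr do rewrite mul1r.
under [X in _ = X + _ -> _]eq_bigr do rewrite mul1r.
under [X in _ = _ + X -> _]eq_bigr do rewrite mul1r.
move=> split1; rewrite /err_linear -/Nc -/P split3 split1.
move: (\sum_i `|q i| * msq c i) (\sum_i `|q i| * (2 * msq c i + b))
  (\sum_i msq c i) (\sum_i (2 * msq c i + b)) (6 * `|lam|) => w1 w2 w3 w4 w5.
rewrite le_eqVlt; apply/orP; left; apply/eqP; clearbody P Nc b.
by clear; ring.
Qed.

Lemma variance_close c :
  G c (fun s => `|lam * (\sum_i q i ^+ 2 * (xi mu A c i s * tnth (spins s) i))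
    - lam * kappa|) <= err_variance c.
Proof.
have mm i : bmeas (fun s : T => mfield A (spins s) i) by exact: bmeas_mfield.
have mm2 i := bmeasX 2 (mm i).
pose f1 (s : T) := \sum_i q i ^+ 2 * eta mu A c i s.
pose f2 (s : T) := \sum_i q i ^+ 2 * `|mfield A (spins s) i|.
pose W := `|\sum_i q i ^+ 2 * (ddpsi mu (tnth c i) - kappa)|.
have mf1 : bmeas f1 by apply: bmeas_sum => i; apply: bmeasZ; exact: bmeas_eta.
have mf2 : bmeas f2 by apply: bmeas_sum => i; apply: bmeasZ; exact: bmeas_norm.
have G1 : G c (fun s => `|f1 s|) <= delta + 30 * (\sum_i q i ^+ 4) / delta.
  apply: (@le_trans _ _ (G c (fun s => delta + delta^-1 * f1 s ^+ 2))).
    apply: (mean_le (GM c)) => [| |s]; first exact: bmeas_norm.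
      by apply: bmeasD; [exact: bmeas_cst|apply: bmeasZ; exact: bmeasX].
    by rewrite [delta^-1 * _]mulrC normr_le_sqr.
  rewrite (meanD (GM c)); [|exact: bmeas_cst|by apply: bmeasZ; exact: bmeasX].
  rewrite (mean_cst (GM c)) (meanZ (GM c)); last exact: bmeasX.
  rewrite lerD2l mulrC ler_wpM2r ?invr_ge0 ?(ltW delta0)//.
  apply: le_trans (eta_sum_sqr hmu cA rho1 Arow c (fun i => q i ^+ 2)) _.
  by rewrite ler_wpM2l// ler_sum// => i _; rewrite -exprM.
have G2 : G c f2 <= delta + (\sum_i q i ^+ 2 * msq c i) / delta.
  rewrite /f2 (mean_sum (GM c)); last by move=> i; apply: bmeasZ; exact: bmeas_norm.
  rewrite -[X in _ <= X + _]mul1r -q1 mulr_suml mulr_suml -big_split ler_sum// => i _ /=.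
  rewrite (meanZ (GM c)); last exact: bmeas_norm.
  rewrite -mulrA -mulrDr ler_wpM2l ?sqr_ge0//.
  apply: (@le_trans _ _ (G c (fun s => delta + delta^-1 * mfield A (spins s) i ^+ 2))).
    apply: (mean_le (GM c)) => [| |s]; first exact: bmeas_norm.
      by apply: bmeasD; [exact: bmeas_cst|exact: bmeasZ].
    by rewrite [delta^-1 * _]mulrC normr_le_sqr.
  rewrite (meanD (GM c)); [|exact: bmeas_cst|exact: bmeasZ].
  by rewrite (mean_cst (GM c)) (meanZ (GM c))// lerD2l mulrC.
apply: (@le_trans _ _ (G c (fun s => `|lam| * (`|f1 s| + 6 * f2 s + W)))); last first.
  have mn1 := bmeas_norm mf1; have m62 := bmeasZ 6 mf2.
  rewrite (meanZ (GM c)); last by apply: bmeasD; [exact: bmeasD|exact: bmeas_cst].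
  rewrite ler_wpM2l// (meanD (GM c)); [|exact: bmeasD|exact: bmeas_cst].
  rewrite (mean_cst (GM c)) lerD2r (meanD (GM c))// (meanZ (GM c))// lerD//.
  by rewrite ler_wpM2l.
apply: (mean_le (GM c)) => [| |s].
- apply/bmeas_norm/bmeasB; last exact: bmeas_cst.
  apply: bmeasZ; apply: bmeas_sum => i; apply: bmeasZ.
  by apply: bmeasM; [exact: bmeas_xi|exact: bmeas_spin].
- apply: bmeasZ; apply: bmeasD; last exact: bmeas_cst.
  by apply: bmeasD; [exact: bmeas_norm|exact: bmeasZ].
rewrite -mulrBr normrM ler_wpM2l//.
have -> : \sum_i q i ^+ 2 * (xi mu A c i s * tnth (spins s) i) - kappa =
    f1 s + \sum_i q i ^+ 2 * (ddpsi mu (local_field A c s i) - ddpsi mu (tnth c i)) +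
    \sum_i q i ^+ 2 * (ddpsi mu (tnth c i) - kappa).
  rewrite -[X in _ - X]mul1r -q1 mulr_suml -sumrB -!big_split; apply: eq_bigr => i _ /=.
  have E (w x y d d' k : R) : w * (x * y) - w * k =
    w * (y * x - d) + w * (d - d') + w * (d' - k) by ring.
  exact: E.
rewrite (le_trans (ler_normD _ _))// lerD2r (le_trans (ler_normD _ _))// lerD2l.
rewrite (le_trans (ler_norm_sum _ _ _))// mulr_sumr ler_sum// => i _.
rewrite normrM ger0_norm ?sqr_ge0// mulrCA ler_wpM2l ?sqr_ge0//.
by rewrite (le_trans (ddpsi_lipschitz hmu _ _))// /local_field [tnth c i + _]addrC addrK.
Qed.

Lemma gibbs_charfun c y t phi : is_center c y ->
  `|G c (fun s => cos (t * (linear_stat s - y) + phi)) -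
    cos phi * expR (- (lam * kappa * t ^+ 2 / 2))| <=
  `|t| * (err_linear c + `|t| * err_variance c +
    2 * `|lam| * t ^+ 2 * (\sum_i `|q i| ^+ 3)).
Proof.
move=> yc; have mX : bmeas (fun s => linear_stat s - y).
  by apply: bmeasB => //; exact: bmeas_cst.
have ev0 : 0 <= err_variance c.
  apply: le_trans (variance_close c).
  apply: (mean_ge0 (GM c)) => [|s]; last exact: normr_ge0.
  apply/bmeas_norm/bmeasB; last exact: bmeas_cst.
  apply: bmeasZ; apply: bmeas_sum => i; apply: bmeasZ.
  by apply: bmeasM; [exact: bmeas_xi|exact: bmeas_spin].
apply: (stein_charfun (GM c) mX (q := q) (x := fun i s => tnth (spins s) i)
  (xi := xi mu A c)) => //.
- by move=> i; exact: bmeas_spin.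
- by move=> i; exact: bmeas_xi.
- by move=> i s; exact: spins_norm.
- by move=> i s; exact: xi_norm.
- move=> i t' phi'; apply: xi_centered => //.
    apply: bmeas_sin; have [] // : bmeas (fun s : T =>
      t' * (linear_stat s - y - q i * tnth (spins s) i) + phi').
    apply: bmeasD; last exact: bmeas_cst.
    by apply/bmeasZ/bmeasB => //; apply: bmeasZ; exact: bmeas_spin.
  move=> s z; congr (sin (_ * _ + _)); rewrite /linear_stat.
  rewrite (bigD1 i)//= [in RHS](bigD1 i)//= spins_upd tnth_upd eqxx.
  rewrite (eq_bigr (fun j => q j * tnth (spins s) j)); last first.
    by move=> j ji; rewrite tnth_upd (negbTE ji).
  by ring.
- exact: center_close.
- exact: variance_close.
- by apply: sumr_ge0 => i _; rewrite exprn_ge0.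
Qed.

(** Provides tightness. [7 = 1 + 6], from [|x| <= 1 + x^2] and the second moment of the noise
    sum. *)
Lemma gibbs_abs_moment c y : is_center c y ->
  G c (fun s => `|linear_stat s - y|) <= err_linear c + 7 * `|lam|.
Proof.
move=> yc; have mx := bmeas_noise q c; have mlx := bmeasZ lam mx.
have mXy : bmeas (fun s => linear_stat s - y) by apply: bmeasB => //; exact: bmeas_cst.
have mX : bmeas (fun s => linear_stat s - y - lam * \sum_i q i * xi mu A c i s).
  exact: bmeasB.
apply: (@le_trans _ _ (G c (fun s =>
  `|linear_stat s - y - lam * \sum_i q i * xi mu A c i s| +
  `|lam| * (1 + (\sum_i q i * xi mu A c i s) ^+ 2)))).
  apply: (mean_le (GM c)) => [| |s]; first exact: bmeas_norm.
    apply: bmeasD; first exact: bmeas_norm.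
    by apply/bmeasZ/bmeasD; [exact: bmeas_cst|exact: bmeasX].
  rewrite -{1}[linear_stat s - y](subrK (lam * \sum_i q i * xi mu A c i s)).
  rewrite (le_trans (ler_normD _ _))// lerD2l normrM ler_wpM2l//.
  by have := normr_le_sqr (\sum_i q i * xi mu A c i s) (@ltr01 R); rewrite divr1.
have m1 : bmeas (fun s : T => 1 + (\sum_i q i * xi mu A c i s) ^+ 2).
  by apply: bmeasD; [exact: bmeas_cst|exact: bmeasX].
rewrite (meanD (GM c)); [|exact: bmeas_norm|exact: bmeasZ].
rewrite lerD ?center_close// (meanZ (GM c))// mulrC ler_wpM2r//.
rewrite (meanD (GM c)); [|exact: bmeas_cst|exact: bmeasX].
rewrite (mean_cst (GM c)) -lerBrDl (le_trans (xi_sum_sqr hmu cA rho1 Arow _ _))//.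
by rewrite q1 mulr1; lra.
Qed.

End conditional_charfun.

(** * Averaging the errors over the field *)

Section iid_bilinear.
Context d (T : measurableType d) (R : realType) (P : probability T R).
Variables (n : nat) (f g : T -> R) (x : 'I_n -> R) (B : 'I_n -> 'I_n -> R) (a : R).
Hypotheses (mf : bmeas f) (mg : bmeas g).
Hypotheses (f1 : forall z, `|f z| <= 1) (g1 : forall z, `|g z| <= 1).
Hypotheses (f0 : expect P f = 0) (g0 : expect P g = 0).
Hypotheses (symB : forall i j, B i j = B j i) (diagB : forall i, B i i = 0).
Hypothesis Bsqr : forall i, \sum_j B i j ^+ 2 <= a.

Let EM := expect_mean (iid P n).
Let H i (s : n.-tuple T) := \sum_j B i j * g (tnth s j).

Let mfi i : bmeas (fun s : n.-tuple T => f (tnth s i)).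
Proof. exact: (bmeas_comp_measurable (measurable_tnth i) mf). Qed.

Let mgi i : bmeas (fun s : n.-tuple T => g (tnth s i)).
Proof. exact: (bmeas_comp_measurable (measurable_tnth i) mg). Qed.

Let mH i : bmeas (H i).
Proof. by apply: bmeas_sum => j; exact: bmeasZ. Qed.

Let H_reduced_indep i k : indep_of k (fun s => H i s - B i k * g (tnth s k)).
Proof.
move=> s z; rewrite /H (bigD1 k)//= [in RHS](bigD1 k)//= addrAC subrr add0r.
rewrite [RHS]addrAC subrr add0r.
by apply: eq_bigr => j jk; rewrite tnth_upd (negbTE jk).
Qed.

Let H_indep i : indep_of i (H i).
Proof.
by move=> s z; have := H_reduced_indep i i s z; rewrite diagB !mul0r !subr0.
Qed.

(** Remove coordinate [i] from [H k] and coordinate [k] from [H i]. Every product but one then keeps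
    a centred factor [f] independent of the rest; what survives carries [B i k] twice. *)
Let pair i k : i != k ->
  `|expect (iid P n) (fun s => (f (tnth s i) * H i s) * (f (tnth s k) * H k s))|
  <= B i k ^+ 2.
Proof.
move=> ik; have ki : k != i by rewrite eq_sym.
pose Hk s := H k s - B k i * g (tnth s i); pose Hi s := H i s - B i k * g (tnth s k).
have mHk : bmeas Hk by apply: bmeasB => //; exact: bmeasZ.
have mHi : bmeas Hi by apply: bmeasB => //; exact: bmeasZ.
pose u1 s := f (tnth s k) * H i s * Hk s.
pose u2 s := f (tnth s i) * g (tnth s i) * Hi s.
pose u3 s := f (tnth s i) * g (tnth s i) * (f (tnth s k) * g (tnth s k)).
have mu1 : bmeas u1 by do 2 (apply: bmeasM => //).
have mu2 : bmeas u2 by do 2 (apply: bmeasM => //).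
have mu3 : bmeas u3 by apply: bmeasM; exact: bmeasM.
have E1 : expect (iid P n) (fun s => f (tnth s i) * u1 s) = 0.
  apply: expect_iid_centered => // s z.
  by rewrite /u1 /Hk H_reduced_indep H_indep tnth_upd (negbTE ki).
have E2 : expect (iid P n) (fun s => f (tnth s k) * u2 s) = 0.
  apply: expect_iid_centered => // s z.
  by rewrite /u2 /Hi H_reduced_indep tnth_upd (negbTE ik).
rewrite (_ : (fun s => _) = fun s => f (tnth s i) * u1 s +
  (B k i * (f (tnth s k) * u2 s) + B i k ^+ 2 * u3 s)); last first.
  by apply/funext => s; rewrite /u1 /u2 /u3 /Hk /Hi [B k i]symB; ring.
have mfu1 := bmeasM (mfi i) mu1; have mfu2 := bmeasM (mfi k) mu2.
rewrite (meanD EM)// ?(meanD EM) ?E1 ?(meanZ EM) ?E2 ?mulr0 ?add0r//; last 3 first.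
- exact: bmeasZ.
- exact: bmeasZ.
- by apply: bmeasD; exact: bmeasZ.
rewrite normrM ger0_norm ?sqr_ge0// ler_piMr ?sqr_ge0//.
apply: (mean_norm_le_cst EM) => // s.
by rewrite !normrM !mulr_ile1 ?mulr_ge0.
Qed.

Lemma expect_iid_bilinear_sqr : expect (iid P n)
    (fun s => (\sum_i x i * (f (tnth s i) * H i s)) ^+ 2) <= 2 * a * \sum_i x i ^+ 2.
Proof.
have mfH i : bmeas (fun s => f (tnth s i) * H i s) by exact: bmeasM.
rewrite (_ : (fun s => _) = (fun s => \sum_i \sum_j
  (x i * x j) * ((f (tnth s i) * H i s) * (f (tnth s j) * H j s)))); last first.
  apply/funext => s; rewrite expr2 mulr_suml; apply: eq_bigr => i _.
  by rewrite mulr_sumr; apply: eq_bigr => j _; rewrite mulrACA.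
have mij i j : bmeas (fun s => (x i * x j) *
    ((f (tnth s i) * H i s) * (f (tnth s j) * H j s))).
  by apply: bmeasZ; exact: bmeasM.
rewrite (mean_sum EM); last by move=> i; exact: bmeas_sum.
apply: (@le_trans _ _ (\sum_i (x i ^+ 2 * a + \sum_j `|x i| * `|x j| * B i j ^+ 2))).
  apply: ler_sum => i _; rewrite (mean_sum EM)// (bigD1 i)//=.
  rewrite [X in _ <= _ + X](bigD1 i)//= diagB expr0n mulr0 add0r; apply: lerD.
    rewrite (meanZ EM); last exact: bmeasM.
    rewrite -expr2 ler_wpM2l ?sqr_ge0//.
    apply: (@le_trans _ _ (expect (iid P n) (fun s => H i s ^+ 2))).
      apply: (mean_le EM) => [| |s]; [exact: bmeasM|exact: bmeasX|].
      rewrite -expr2 exprMn ler_piMl ?sqr_ge0// -real_normK ?num_real//.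
      by rewrite exprn_ile1.
    apply: le_trans (Bsqr i); exact: expect_iid_sum_sqr.
  apply: ler_sum => j ji; rewrite (meanZ EM); last exact: bmeasM.
  rewrite (le_trans (ler_norm _))// normrM [X in X * _]normrM.
  by rewrite ler_wpM2l ?mulr_ge0// pair// eq_sym.
rewrite big_split/= -mulr_suml [2 * a]mulrDl mul1r mulrDl mulrC lerD2l.
by apply: schur_test => // [i j|i j]; rewrite ?sqr_ge0// symB.
Qed.

End iid_bilinear.

(** * Measurability of Gibbs expectations in the field *)

Section gibbs_kernel.
Context (R : realType) (mu : probability (measurableTypeR R) R).
Variables (n : nat) (A : 'M[R]_n).
Local Notation T := (n.-tuple (measurableTypeR R)).

Lemma measurable_fun_invr d (S : measurableType d) (f : S -> R) :
  measurable_fun [set: S] f -> (forall x, 0 < f x) ->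
  measurable_fun [set: S] (fun x => (f x)^-1).
Proof.
move=> mf f0; rewrite (_ : (fun x => _) = fun x => expR (- ln (f x))).
  apply: measurableT_comp => //; apply: measurableT_comp => //.
  exact: measurableT_comp.
by apply/funext => x; rewrite expRN lnK// posrE.
Qed.

(** The field is unbounded, so the Boltzmann weight is not bounded jointly in field and spins.
    Multiplying numerator and denominator by [expR (- sum_i |c_i|)] bounds the weight and leaves the
    ratio unchanged. *)
Lemma bmeas_gibbs_mean (P : probability T R) (f : T * T -> R) : bmeas f ->
  bmeas (fun c : T => gibbs_mean mu A c (fun s => f (c, s))).
Proof.
move=> mf.
pose h (x : T * T) : R := hamiltonian A x.1 (spins x.2) - \sum_i `|tnth x.1 i|.
have mspin i : bmeas (fun x : T * T => tnth (spins x.2) i).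
  exact: (bmeas_comp_measurable (X := snd : T * T -> T) measurable_snd (bmeas_spin R i)).
have mtnth i : measurable_fun [set: T * T] (fun x : T * T => tnth x.1 i : R).
  exact: (measurableT_comp (measurable_tnth (T := measurableTypeR R) i) measurable_fst).
have mh : measurable_fun [set: T * T] h.
  apply: measurable_funB; last first.
    apply: measurable_sum => i; apply: measurableT_comp => //; exact: mtnth.
  apply: measurable_funD; last first.
    by apply: measurable_sum => i; apply: measurable_funM => //; have [] := mspin i.
  have [//] : bmeas (fun x : T * T => 2^-1 * quad_form A (spins x.2)).
  apply: bmeasZ; apply: bmeas_sum => i; apply: bmeas_sum => j.
  by apply: bmeasM => //; apply: bmeasM => //; exact: bmeas_cst.
pose Q := \sum_i \sum_j `|A i j|.
have mw : bmeas (fun x => expR (h x)).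
  split; first exact: measurableT_comp.
  exists (expR Q) => x; rewrite ger0_norm ?expR_ge0// ler_expR /h.
  rewrite /hamiltonian -addrA -[leRHS]addr0 lerD//.
    rewrite (le_trans (ler_norm _))// normrM (le_trans (ler_piMl _ _))//.
      by rewrite ger0_norm//; lra.
    rewrite (le_trans (ler_norm_sum _ _ _))// ler_sum// => i _.
    rewrite (le_trans (ler_norm_sum _ _ _))// ler_sum// => j _.
    by rewrite !normrM mulrAC ler_piMl// mulr_ile1// spins_norm.
  rewrite subr_le0 ler_sum// => i _; rewrite (le_trans (ler_norm _))//.
  by rewrite normrM ler_piMr// spins_norm.
have mfw := bmeasM mf mw; have EM := expect_mean (iid mu n).
have mZ := bmeas_expect P (iid mu n) mw; have mN := bmeas_expect P (iid mu n) mfw.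
pose k (c : T) := expR (- \sum_i `|tnth c i|).
have wE c s : expR (h (c, s)) = k c * boltzmann A c s by rewrite /h expRD mulrC.
have ZE c : expect (iid mu n) (fun s => expR (h (c, s))) =
    k c * expect (iid mu n) (boltzmann A c).
  rewrite -(meanZ EM); last exact: bmeas_boltzmann.
  by congr expect; apply/funext => s; rewrite wE.
have GE c : gibbs_mean mu A c (fun s => f (c, s)) =
    expect (iid mu n) (fun s => f (c, s) * expR (h (c, s))) /
    expect (iid mu n) (fun s => expR (h (c, s))).
  rewrite ZE [X in X / _](_ : _ = k c * expect (iid mu n)
      (fun s => f (c, s) * boltzmann A c s)); last first.
    rewrite -(meanZ EM); last by apply: bmeasM; [exact: bmeas_section|exact: bmeas_boltzmann].
    by congr expect; apply/funext => s; rewrite wE mulrCA.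
  by rewrite -mulf_div divff ?mul1r// gt_eqF// expR_gt0.
split.
  under eq_fun do rewrite GE.
  apply: measurable_funM; first by have [] := mN.
  apply: measurable_fun_invr => [|c]; first by have [] := mZ.
  by rewrite ZE mulr_gt0 ?expR_gt0 ?partition_gt0.
have [_ [M fM]] := mf; exists M => c.
by apply: (mean_norm_le_cst (gibbs_meanP mu A c)) => // ; exact: bmeas_section.
Qed.

End gibbs_kernel.

(** * Field averages of the local fields and of the residual *)

Section error_expectation.
Context (R : realType) (mu F : probability (measurableTypeR R) R).
Hypothesis hmu : base_measure mu.
Variables (n : nat) (A : 'M[R]_n).
Hypothesis cA : coupling_matrix A.
Local Notation T := (n.-tuple (measurableTypeR R)).
Variables (rho a : R).
Hypotheses (rho0 : 0 < rho) (rho1 : rho < 1) (a0 : 0 < a).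
Hypothesis Arow : forall i, \sum_j `|A i j| <= rho.
Hypothesis Asqr : forall i, \sum_j A i j ^+ 2 <= a.
Variables (q : 'I_n -> R) (lam delta K : R).
Hypotheses (delta0 : 0 < delta) (K0 : 0 < K).
Hypothesis q1 : \sum_i q i ^+ 2 = 1.
Hypothesis F0 : expect F (dpsi mu) = 0.

Let EM := expect_mean (iid F n).
Let E := expect (iid F n).
Definition mean_ddpsi : R := expect F (ddpsi mu).
Local Notation kappa := mean_ddpsi.

(** [residual] with [psi'' (c_i)] replaced by its mean. For constant [q] and column sums [theta] it
    vanishes exactly when [lam = 1 / (1 - theta * kappa)]. *)
Definition mean_residual j : R := (1 - lam) * q j + lam * kappa * \sum_i q i * A i j.

Let sq := \sum_j mean_residual j ^+ 2.

Let mcoord (f : measurableTypeR R -> R) i : bmeas f -> bmeas (fun c : T => f (tnth c i)).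
Proof.
exact: (bmeas_comp_measurable (measurable_tnth (T := measurableTypeR R) i)).
Qed.

Lemma mean_ddpsi_gt0 : 0 < kappa.
Proof.
have md := bmeas_ddpsi hmu; have [md' _] := md.
have d0 x := ltW (ddpsi_gt0 hmu x).
rewrite lt_neqAle (mean_ge0 (expect_mean F))// andbT eq_sym; apply/eqP => E0.
have : (\int[F]_x `|(EFin \o ddpsi mu) x| = 0)%E.
  rewrite -[RHS]/(0%:E) -E0 -integral_expect//; apply: eq_integral => x _ /=.
  by rewrite ger0_norm.
have mfE : measurable_fun [set: measurableTypeR R] (EFin \o ddpsi mu).
  exact/measurable_EFinP.
move/(ae_eq_integral_abs F measurableT mfE) => [N [mN N0 sN]].
have : (F [set: measurableTypeR R] <= F N)%E.
  apply: le_measure; rewrite ?inE// => x _; apply: sN => /= /(_ I) [] dx.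
  by have := ddpsi_gt0 hmu x; rewrite dx ltxx.
by rewrite [F [set: _]]probability_setT N0 leNgt lte01.
Qed.

Lemma mean_ddpsi_le1 : kappa <= 1.
Proof.
apply: (mean_le_cst (expect_mean F)); first exact: bmeas_ddpsi.
exact: ddpsi_le1.
Qed.

Let Z x := ddpsi mu x - kappa.

Let mZ : bmeas (Z : measurableTypeR R -> R).
Proof. by apply: bmeasB; [exact: bmeas_ddpsi|exact: bmeas_cst]. Qed.

Let Z1 x : `|Z x| <= 1.
Proof.
have := mean_ddpsi_gt0; have := mean_ddpsi_le1; have := ddpsi_gt0 hmu x.
have := ddpsi_le1 hmu x; rewrite /Z; move: (ddpsi mu x) kappa => y k.
by move=> ? ? ? ?; rewrite ler_norml; apply/andP; split; lra.
Qed.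

Let Z0 : expect F Z = 0.
Proof.
rewrite (meanB (expect_mean F)); [|exact: bmeas_ddpsi|exact: bmeas_cst].
by rewrite (mean_cst (expect_mean F)) subrr.
Qed.

Lemma noise_field_sqr i : E (fun c => noise_field mu A c i ^+ 2) <= a.
Proof.
apply: le_trans (Asqr i); apply: expect_iid_sum_sqr => //.
- exact: bmeas_dpsi.
- exact: dpsi_norm.
Qed.

Lemma bmeas_field_sqr i : bmeas (fun c : T => field_sqr mu A c i).
Proof.
apply: (bmeas_gibbs_mean mu A (iid F n)
  (f := fun x : T * T => mfield A (spins x.2) i ^+ 2)).
apply: bmeasX; exact: (bmeas_comp_measurable (X := snd : T * T -> T)
  measurable_snd (bmeas_mfield A i)).
Qed.

(** Centring of [psi' (c_1)] gives [noise_field] a second moment at most [a], instead of the square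
    of a row sum; [14 = 12 + 2]. *)
Lemma expect_field_sqr i : E (fun c => field_sqr mu A c i) <= 14 * a / (1 - rho) ^+ 2.
Proof.
have k0 : 0 < 1 - rho by rewrite subr_gt0.
have mM := bmeas_field_sqr.
have mg j : bmeas (fun c : T => noise_field mu A c j).
  apply: bmeas_sum => l; apply: bmeasZ; apply: mcoord; exact: bmeas_dpsi.
have mg2 j := bmeasX 2 (mg j).
rewrite expr2 invfM mulrA; apply: (bounded_fixpoint rho1 (m := fun i j => `|A i j|)
  (M := fun i => E (fun c => field_sqr mu A c i))) => // j.
  by apply: (mean_ge0 EM) => // c; exact: field_sqr_ge0.
apply: (@le_trans _ _ (E (fun c => (1 - rho)^-1 * (12 * a + 2 * noise_field mu A c j ^+ 2)
   + \sum_l `|A j l| * field_sqr mu A c l))).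
  apply: (mean_le EM) => // [|c]; last first.
    by rewrite [_^-1 * _]mulrC; exact: field_sqr_le.
  apply: bmeasD; last by apply: bmeas_sum => l; exact: bmeasZ.
  by apply: bmeasZ; apply: bmeasD; [exact: bmeas_cst|exact: bmeasZ].
have m1 : bmeas (fun c : T => 12 * a + 2 * noise_field mu A c j ^+ 2).
  by apply: bmeasD; [exact: bmeas_cst|exact: bmeasZ].
have m2 l : bmeas (fun c : T => `|A j l| * field_sqr mu A c l) by exact: bmeasZ.
rewrite /E (meanD EM); [|exact: bmeasZ|exact: bmeas_sum].
rewrite (mean_sum EM)//; under eq_bigr do rewrite (meanZ EM)//.
rewrite lerD2r (meanZ EM)// mulrC ler_wpM2r ?invr_ge0 ?(ltW k0)//.
rewrite (meanD EM); [|exact: bmeas_cst|exact: bmeasZ].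
rewrite (mean_cst EM) (meanZ EM)//; have := noise_field_sqr j; rewrite /E; lra.
Qed.

Lemma residualE c j : residual mu A q lam c j =
  mean_residual j + lam * \sum_i (q i * A i j) * Z (tnth c i).
Proof.
rewrite /residual /mean_residual -addrA; congr (_ + _).
rewrite -mulrA -mulrDr; congr (_ * _); rewrite mulr_sumr -big_split.
by apply: eq_bigr => i _ /=; rewrite /Z; ring.
Qed.

Lemma bmeas_residual j : bmeas (fun c : T => residual mu A q lam c j).
Proof.
apply: bmeasD; first exact: bmeas_cst.
apply: bmeasZ; apply: bmeas_sum => i; apply: bmeasM; last exact: bmeas_cst.
by apply: bmeasZ; apply: mcoord; exact: bmeas_ddpsi.
Qed.

Lemma expect_residual_sqr :
  E (fun c => \sum_j residual mu A q lam c j ^+ 2) <= 2 * sq + 2 * lam ^+ 2 * a.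
Proof.
have mr := bmeas_residual; have mr2 j := bmeasX 2 (mr j).
pose S j (c : T) := \sum_i (q i * A i j) * Z (tnth c i).
have mS j : bmeas (S j) by apply: bmeas_sum => i; apply: bmeasZ; exact: mcoord.
have mS2 j := bmeasX 2 (mS j).
have ES j : E (fun c => S j c ^+ 2) <= \sum_i (q i * A i j) ^+ 2.
  exact: expect_iid_sum_sqr.
have lam2 : 0 <= 2 * lam ^+ 2 by apply: mulr_ge0 => //; exact: sqr_ge0.
rewrite /E (mean_sum EM)//.
apply: (@le_trans _ _ (\sum_j (2 * mean_residual j ^+ 2 +
    2 * lam ^+ 2 * \sum_i (q i * A i j) ^+ 2))).
  apply: ler_sum => j _.
  apply: (@le_trans _ _ (E (fun c => 2 * mean_residual j ^+ 2 + (2 * lam ^+ 2) * S j c ^+ 2))).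
    apply: (mean_le EM) => // [|c]; first by apply: bmeasD; [exact: bmeas_cst|exact: bmeasZ].
    rewrite residualE -/(S j c); have := sqr_ge0 (mean_residual j - lam * S j c); lra.
  rewrite /E (meanD EM); [|exact: bmeas_cst|exact: bmeasZ].
  rewrite (mean_cst EM) (meanZ EM)// lerD2l ler_wpM2l//.
rewrite big_split/= -!mulr_sumr lerD2l ler_wpM2l//.
rewrite exchange_big/= -[leRHS]mul1r -q1 mulr_suml ler_sum// => i _.
under eq_bigr do rewrite exprMn.
by rewrite -mulr_sumr ler_wpM2l ?sqr_ge0.
Qed.

(** Cauchy-Schwarz alone would lose a factor [n]. Splitting the residual around its mean gives a
    linear form and a bilinear form in centred variables, and orthogonality removes that factor. *)
Lemma expect_residual_dpsi_sqr :
  E (fun c => (\sum_j residual mu A q lam c j * dpsi mu (tnth c j)) ^+ 2) <=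
  2 * sq + 4 * lam ^+ 2 * a.
Proof.
have md := bmeas_dpsi hmu; have mr := bmeas_residual.
pose S1 (c : T) := \sum_j mean_residual j * dpsi mu (tnth c j).
pose S2 (c : T) := \sum_i q i * (Z (tnth c i) * \sum_j A i j * dpsi mu (tnth c j)).
have mS1 : bmeas S1 by apply: bmeas_sum => i; apply: bmeasZ; exact: mcoord.
have mS2 : bmeas S2.
  apply: bmeas_sum => i; apply: bmeasZ; apply: bmeasM; first exact: mcoord.
  by apply: bmeas_sum => j; apply: bmeasZ; exact: mcoord.
have E1 : E (fun c => S1 c ^+ 2) <= sq by apply: expect_iid_sum_sqr => //; exact: dpsi_norm.
have E2 : E (fun c => S2 c ^+ 2) <= 2 * a.
  apply: le_trans (expect_iid_bilinear_sqr q mZ md Z1 (dpsi_norm hmu) Z0 F0 cA.1 cA.2 Asqr) _.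
  by rewrite q1 mulr1.
have mS12 := bmeasX 2 mS1; have mS22 := bmeasX 2 mS2.
apply: (@le_trans _ _ (E (fun c => 2 * S1 c ^+ 2 + (2 * lam ^+ 2) * S2 c ^+ 2))); last first.
  rewrite /E (meanD EM) ?(meanZ EM)//; try exact: bmeasZ.
  rewrite lerD//; first by rewrite ler_wpM2l.
  rewrite [leRHS](_ : _ = 2 * lam ^+ 2 * (2 * a)); last by ring.
  by apply: ler_wpM2l E2; rewrite mulr_ge0 ?sqr_ge0.
apply: (mean_le EM) => [| |c].
- by apply: bmeasX; apply: bmeas_sum => j; apply: bmeasM; [exact: mr|exact: mcoord].
- by apply: bmeasD; exact: bmeasZ.
have -> : \sum_j residual mu A q lam c j * dpsi mu (tnth c j) = S1 c + lam * S2 c.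
  under eq_bigr do rewrite residualE mulrDl.
  rewrite big_split/=; congr (_ + _); under eq_bigr do rewrite -mulrA mulr_suml.
  rewrite -mulr_sumr exchange_big/=; congr (_ * _); apply: eq_bigr => i _.
  rewrite mulrA mulr_sumr; apply: eq_bigr => j _.
  have comm (w x y z : R) : w * x * y * z = w * y * (x * z) by ring.
  exact: comm.
have := sqr_ge0 (S1 c - lam * S2 c); lra.
Qed.

Lemma expect_weighted_ddpsi :
  E (fun c => (\sum_i q i ^+ 2 * (ddpsi mu (tnth c i) - kappa)) ^+ 2) <= \sum_i q i ^+ 4.
Proof.
have := @expect_iid_sum_sqr _ _ _ F n Z (fun i => q i ^+ 2) mZ Z1 Z0.
move=> /le_trans; apply.
by rewrite ler_sum// => i _; rewrite -exprM.
Qed.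

End error_expectation.

(** * The error budget in terms of [delta] *)

Section error_bounds.
Context (R : realType) (mu F : probability (measurableTypeR R) R).
Hypothesis hmu : base_measure mu.
Variables (n : nat) (A : 'M[R]_n).
Hypothesis cA : coupling_matrix A.
Local Notation T := (n.-tuple (measurableTypeR R)).
Variables (rho a : R).
Hypotheses (rho0 : 0 < rho) (rho1 : rho < 1) (a0 : 0 < a).
Hypothesis Arow : forall i, \sum_j `|A i j| <= rho.
Hypothesis Asqr : forall i, \sum_j A i j ^+ 2 <= a.
Variables (q : 'I_n -> R) (lam delta : R).
Hypotheses (delta0 : 0 < delta) (delta1 : delta <= 1).
Hypothesis q1 : \sum_i q i ^+ 2 = 1.
Hypothesis F0 : expect F (dpsi mu) = 0.
Hypotheses (n0 : (0 < n)%N) (qmax : forall i, `|q i| <= delta).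
Hypothesis na_small : Num.sqrt n%:R * a <= delta ^+ 2.
Hypothesis residual_small :
  (\sum_j mean_residual mu F A q lam j ^+ 2) * (1 + n%:R * a) <= delta ^+ 2.

Let EM := expect_mean (iid F n).
Let E := expect (iid F n).
Let kappa := mean_ddpsi mu F.
(** The field squares sum to order [n * a], so dividing by [K] leaves order [delta]; the residual
    part, multiplied by [K], is of order [delta] because [sq * (n * a)] and [a * (n * a)] are at
    most [delta ^+ 2]. *)
Let K := n%:R * a / delta.
Let sq := \sum_j mean_residual mu F A q lam j ^+ 2.

Let nR0 : 0 < n%:R :> R. Proof. by rewrite ltr0n. Qed.

Let K0 : 0 < K. Proof. by rewrite divr_gt0// mulr_gt0. Qed.

Let sq0 : 0 <= sq. Proof. by apply: sumr_ge0 => i _; exact: sqr_ge0. Qed.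

Let sqrt_n_ge1 : 1 <= Num.sqrt n%:R :> R.
Proof. by rewrite -[leLHS]sqrtr1 ler_wsqrtr// ler1n. Qed.

Let a_small : a <= delta ^+ 2.
Proof. by apply: le_trans na_small; rewrite ler_peMl// ltW. Qed.

Let sq_small : sq <= delta ^+ 2.
Proof.
by apply: le_trans residual_small; rewrite ler_peMr// lerDl mulr_ge0// ltW.
Qed.

Let sq_na_small : sq * (n%:R * a) <= delta ^+ 2.
Proof. by apply: le_trans residual_small; rewrite ler_wpM2l// lerDr. Qed.

Let a_na_small : a * (n%:R * a) <= delta ^+ 2.
Proof.
rewrite (_ : a * _ = (Num.sqrt n%:R * a) ^+ 2); last first.
  by rewrite exprMn sqr_sqrtr ?ler0n//; ring.
have s0 : 0 <= Num.sqrt n%:R * a by rewrite mulr_ge0 ?sqrtr_ge0// ltW.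
apply: (@le_trans _ _ ((delta ^+ 2) ^+ 2)).
  by rewrite ler_pXn2r ?nnegrE ?sqr_ge0.
by rewrite -[leRHS]mulr1 expr2 ler_wpM2l ?sqr_ge0// exprn_ile1 ?(ltW delta0).
Qed.

Let sum_abs_q : \sum_i `|q i| <= Num.sqrt n%:R.
Proof.
have s0 : 0 <= \sum_i `|q i| by apply: sumr_ge0.
rewrite -[leLHS]ger0_norm// -sqrtr_sqr ler_wsqrtr//.
have card : \sum_(j < n) (1 : R) <= n%:R by rewrite sumr_const card_ord.
have := weighted_sum_sqr (fun j => `|q j|) (fun _ => ler01) card.
under eq_bigr do rewrite mul1r.
move=> /le_trans; apply; under eq_bigr do rewrite mul1r real_normK ?num_real//.
by rewrite q1 mulr1.
Qed.

Let q4 : \sum_i q i ^+ 4 <= delta ^+ 2.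
Proof.
rewrite -[leRHS]mulr1 -q1 mulr_sumr ler_sum// => i _.
rewrite (exprD _ 2 2) ler_wpM2r ?sqr_ge0// -real_normK ?num_real//.
by rewrite ler_pXn2r ?nnegrE// ltW.
Qed.

Lemma sum_q_cube : \sum_i `|q i| ^+ 3 <= delta.
Proof.
rewrite -[leRHS]mulr1 -q1 mulr_sumr ler_sum// => i _.
by rewrite exprS real_normK ?num_real// ler_wpM2r ?sqr_ge0.
Qed.

(** [54 = 3 * 14 + 12], from [3 * msq + b]. *)
Let Crho := 54 / (1 - rho) ^+ 2.

(** The summands match the terms of [err_linear]: field squares weighted by [q], noise
    ([13 = 1 + 6 * 2]), residual against [psi'] ([6 = 2 * 3]), and the two halves of the Young
    term. *)
Definition linear_constant : R :=
  6 * `|lam| * Crho + (13 + 12 * lam ^+ 2) + (6 + 8 * lam ^+ 2) +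
  (4 + 4 * lam ^+ 2) + Crho.

(** [39 = 1 + 30 + 6 + 2] and [84 = 6 * 14]. *)
Definition variance_constant : R := `|lam| * (39 + 84 / (1 - rho) ^+ 2).

Let k0 : 0 < (1 - rho) ^+ 2. Proof. by rewrite exprn_gt0// subr_gt0. Qed.

Let Crho0 : 0 <= Crho. Proof. by rewrite divr_ge0// ltW. Qed.

Lemma constants_ge0 : 0 <= linear_constant /\ 0 <= variance_constant.
Proof.
split; last by rewrite mulr_ge0// addr_ge0// divr_ge0// ltW.
have l2 : 0 <= lam ^+ 2 := sqr_ge0 lam.
rewrite /linear_constant; do ![apply: addr_ge0 => //]; exact: mulr_ge0.
Qed.

Let err1 := err_linear mu A rho a q lam delta K.
Let err2 := err_variance mu A q lam kappa delta.

Let mM i : bmeas (fun c : T => field_sqr mu A c i).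
Proof. exact: bmeas_field_sqr. Qed.

Let mMb i : bmeas (fun c : T => 3 * field_sqr mu A c i + 12 * a / (1 - rho) ^+ 2).
Proof. by apply: bmeasD; [exact: bmeasZ|exact: bmeas_cst]. Qed.

Let mr i : bmeas (fun c : T => residual mu A q lam c i ^+ 2).
Proof. by apply: bmeasX; exact: bmeas_residual. Qed.

Let mrd : bmeas (fun c : T => \sum_i residual mu A q lam c i * dpsi mu (tnth c i)).
Proof.
apply: bmeas_sum => i; apply: bmeasM; first exact: bmeas_residual.
exact: (bmeas_comp_measurable (measurable_tnth (T := measurableTypeR R) i) (bmeas_dpsi hmu)).
Qed.

Let mqd : bmeas (fun c : T => \sum_i q i ^+ 2 * (ddpsi mu (tnth c i) - kappa)).
Proof.
apply: bmeas_sum => i; apply: bmeasZ; apply: bmeasB; last exact: bmeas_cst.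
exact: (bmeas_comp_measurable (measurable_tnth (T := measurableTypeR R) i) (bmeas_ddpsi hmu)).
Qed.

Let msqr : bmeas (fun c : T => \sum_i residual mu A q lam c i ^+ 2).
Proof. exact: bmeas_sum. Qed.

Let t1 (c : T) := \sum_i `|q i| * (3 * field_sqr mu A c i + 12 * a / (1 - rho) ^+ 2).
Let t5 (c : T) := \sum_i (3 * field_sqr mu A c i + 12 * a / (1 - rho) ^+ 2).

Let mt1 : bmeas t1. Proof. by apply: bmeas_sum => i; exact: bmeasZ. Qed.
Let mt5 : bmeas t5. Proof. exact: bmeas_sum. Qed.

Let err1E : err1 = fun c =>
  6 * `|lam| * t1 c + (delta + 6 / delta * \sum_i residual mu A q lam c i ^+ 2) +
  2 * `|\sum_i residual mu A q lam c i * dpsi mu (tnth c i)| +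
  (2 * K * (\sum_i residual mu A q lam c i ^+ 2) + K^-1 * t5 c).
Proof.
apply/funext => c; rewrite /err1 /err_linear -/(t1 c) -/(t5 c) mulrA.
by rewrite [6 * _ / _]mulrAC [t5 c / K]mulrC.
Qed.

Let m_a : bmeas (fun c => 6 * `|lam| * t1 c). Proof. exact: bmeasZ. Qed.
Let m_b : bmeas (fun c : T => delta + 6 / delta * \sum_i residual mu A q lam c i ^+ 2).
Proof. by apply: bmeasD; [exact: bmeas_cst|exact: bmeasZ]. Qed.
Let m_c : bmeas (fun c : T => 2 * `|\sum_i residual mu A q lam c i * dpsi mu (tnth c i)|).
Proof. by apply: bmeasZ; exact: bmeas_norm. Qed.
Let m_d : bmeas (fun c : T => 2 * K * (\sum_i residual mu A q lam c i ^+ 2) + K^-1 * t5 c).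
Proof. by apply: bmeasD; exact: bmeasZ. Qed.

Lemma bmeas_err_linear : bmeas (err1 : T -> R).
Proof. by rewrite err1E; do 3 (apply: bmeasD => //). Qed.

Lemma bmeas_err_variance : bmeas (err2 : T -> R).
Proof.
apply: bmeasZ; apply: bmeasD; last exact: bmeas_norm.
apply: bmeasD; first exact: bmeas_cst.
apply: bmeasZ; apply: bmeasD; first exact: bmeas_cst.
by apply: bmeasM; [apply: bmeas_sum => i; exact: bmeasZ|exact: bmeas_cst].
Qed.

Let EMb i : E (fun c => 3 * field_sqr mu A c i + 12 * a / (1 - rho) ^+ 2) <= Crho * a.
Proof.
have := expect_field_sqr hmu cA rho0 rho1 Arow Asqr F0 i.
rewrite /E (meanD EM); [|exact: bmeasZ|exact: bmeas_cst].
rewrite (mean_cst EM) (meanZ EM)// /Crho => H.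
rewrite (_ : 54 / _ * a = 3 * (14 * a / (1 - rho) ^+ 2) + 12 * a / (1 - rho) ^+ 2).
  by rewrite lerD2r ler_wpM2l.
by field; rewrite gt_eqF// subr_gt0.
Qed.

Let Er2 : E (fun c => \sum_i residual mu A q lam c i ^+ 2) <= 2 * sq + 2 * lam ^+ 2 * a.
Proof. exact: expect_residual_sqr. Qed.

Let lam2 : 0 <= lam ^+ 2. Proof. exact: sqr_ge0. Qed.

Let E_t1 : E t1 <= Crho * delta ^+ 2.
Proof.
rewrite /E (mean_sum EM) => [|i]; last exact: bmeasZ.
apply: (@le_trans _ _ (\sum_i `|q i| * (Crho * a))).
  by apply: ler_sum => i _; rewrite (meanZ EM)// ler_wpM2l.
rewrite -mulr_suml mulrCA ler_wpM2l// (le_trans _ na_small)//.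
by rewrite ler_wpM2r ?(ltW a0).
Qed.

Let E_t5 : E t5 <= n%:R * (Crho * a).
Proof.
rewrite /E (mean_sum EM)//.
apply: (@le_trans _ _ (\sum_(i < n) Crho * a)); first exact: ler_sum.
by rewrite sumr_const card_ord -[leLHS]mulr_natl.
Qed.

Let Er2_le : E (fun c => \sum_i residual mu A q lam c i ^+ 2) <= (2 + 2 * lam ^+ 2) * delta ^+ 2.
Proof.
apply: (le_trans Er2); rewrite [leRHS]mulrDl lerD//; first by rewrite ler_wpM2l.
by rewrite ler_wpM2l// mulr_ge0.
Qed.

Let E_P : E (fun c => `|\sum_i residual mu A q lam c i * dpsi mu (tnth c i)|) <=
  (3 + 4 * lam ^+ 2) * delta.
Proof.
have mrd2 := bmeasX 2 mrd.
apply: (@le_trans _ _ (E (fun c => delta + delta^-1 *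
    (\sum_i residual mu A q lam c i * dpsi mu (tnth c i)) ^+ 2))).
  apply: (mean_le EM) => [| |c]; first exact: bmeas_norm.
    by apply: bmeasD; [exact: bmeas_cst|exact: bmeasZ].
  by rewrite [_^-1 * _]mulrC normr_le_sqr.
rewrite /E (meanD EM); [|exact: bmeas_cst|exact: bmeasZ].
rewrite (mean_cst EM) (meanZ EM)//.
have H : E (fun c => (\sum_i residual mu A q lam c i * dpsi mu (tnth c i)) ^+ 2) <=
    (2 + 4 * lam ^+ 2) * delta ^+ 2.
  apply: (le_trans (expect_residual_dpsi_sqr hmu cA Asqr lam q1 F0)).
  rewrite [leRHS]mulrDl lerD//; first by rewrite ler_wpM2l.
  by rewrite ler_wpM2l// mulr_ge0.
have := ler_wpM2l (x := delta^-1) _ H; rewrite invr_ge0 (ltW delta0) => /(_ isT).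
have -> : delta^-1 * ((2 + 4 * lam ^+ 2) * delta ^+ 2) = (2 + 4 * lam ^+ 2) * delta.
  by field; rewrite gt_eqF.
rewrite /E; lra.
Qed.

Let E_d : 2 * K * E (fun c => \sum_i residual mu A q lam c i ^+ 2) + K^-1 * E t5 <=
  (4 + 4 * lam ^+ 2) * delta + Crho * delta.
Proof.
have K2 : 0 <= 2 * K by rewrite mulr_ge0// ltW.
have Ki : 0 <= K^-1 by rewrite invr_ge0 ltW.
apply: lerD.
  apply: (le_trans (ler_wpM2l K2 Er2)).
  rewrite (_ : 2 * K * _ = (4 * (sq * (n%:R * a)) + 4 * lam ^+ 2 * (a * (n%:R * a))) / delta).
    rewrite ler_pdivrMr// -[leRHS]mulrA -[delta * delta]/(delta ^+ 2) [leRHS]mulrDl; apply: lerD.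
      by rewrite ler_wpM2l.
    by rewrite ler_wpM2l// mulr_ge0.
  by rewrite /K; field; rewrite gt_eqF.
apply: (le_trans (ler_wpM2l Ki E_t5)).
rewrite (_ : K^-1 * _ = Crho * delta)// /K; field.
by rewrite !gt_eqF.
Qed.

Lemma expect_err_linear : E err1 <= linear_constant * delta.
Proof.
have mab := bmeasD m_a m_b; have mabc := bmeasD mab m_c.
rewrite err1E /E (meanD EM mabc m_d) (meanD EM mab m_c) (meanD EM m_a m_b).
rewrite (meanD EM) ?(meanZ EM) ?(meanD EM) ?(meanZ EM) ?(mean_cst EM)//;
  try exact: bmeasZ; try exact: bmeas_norm; last exact: bmeas_cst.
rewrite -/E.
have d2 : delta ^+ 2 <= delta by rewrite expr2 ler_piMr// ltW.
have H1 : 6 * `|lam| * E t1 <= 6 * `|lam| * Crho * delta.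
  rewrite -[leRHS]mulrA ler_wpM2l ?mulr_ge0// (le_trans E_t1)//.
  by rewrite ler_wpM2l.
have H2 : 6 / delta * E (fun c => \sum_i residual mu A q lam c i ^+ 2) <=
    (12 + 12 * lam ^+ 2) * delta.
  have d6 : 0 <= 6 / delta by rewrite divr_ge0// ltW.
  apply: (le_trans (ler_wpM2l d6 Er2_le)).
  by rewrite le_eqVlt; apply/orP; left; apply/eqP; field; rewrite gt_eqF.
have H3 := E_P; have H4 := E_d; rewrite /linear_constant.
move: H1 H2 H3 H4; move: (E t1) (E t5) (E _) (E _) => x1 x2 x3 x4.
lra.
Qed.

Lemma expect_err_variance : E err2 <= variance_constant * delta.
Proof.
have mW := bmeas_norm mqd.
have mqM : bmeas (fun c : T => \sum_i q i ^+ 2 * field_sqr mu A c i).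
  by apply: bmeas_sum => i; exact: bmeasZ.
have dV : 0 <= delta^-1 by rewrite invr_ge0 ltW.
have EW : E (fun c => `|\sum_i q i ^+ 2 * (ddpsi mu (tnth c i) - kappa)|) <= 2 * delta.
  have mqd2 := bmeasX 2 mqd.
  apply: (@le_trans _ _ (E (fun c => delta + delta^-1 *
      (\sum_i q i ^+ 2 * (ddpsi mu (tnth c i) - kappa)) ^+ 2))).
    apply: (mean_le EM) => [//| |c].
      by apply: bmeasD; [exact: bmeas_cst|exact: bmeasZ].
    by rewrite [_^-1 * _]mulrC normr_le_sqr.
  rewrite /E (meanD EM); [|exact: bmeas_cst|exact: bmeasZ].
  rewrite (mean_cst EM) (meanZ EM)//.
  have H : E (fun c => (\sum_i q i ^+ 2 * (ddpsi mu (tnth c i) - kappa)) ^+ 2) <= delta ^+ 2.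
    exact: le_trans (expect_weighted_ddpsi F hmu q) q4.
  have := ler_wpM2l dV H.
  have -> : delta^-1 * delta ^+ 2 = delta by field; rewrite gt_eqF.
  rewrite /E; lra.
have EqM : E (fun c => \sum_i q i ^+ 2 * field_sqr mu A c i) <=
    14 / (1 - rho) ^+ 2 * delta ^+ 2.
  rewrite /E (mean_sum EM) => [|i]; last exact: bmeasZ.
  apply: (@le_trans _ _ (\sum_i q i ^+ 2 * (14 / (1 - rho) ^+ 2 * delta ^+ 2))).
    apply: ler_sum => i _; rewrite (meanZ EM)// ler_wpM2l ?sqr_ge0//.
    apply: (le_trans (expect_field_sqr hmu cA rho0 rho1 Arow Asqr F0 i)).
    by rewrite mulrAC ler_wpM2l// divr_ge0// ltW.
  by rewrite -mulr_suml q1 mul1r.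
rewrite (_ : err2 = fun c => `|lam| * ((delta + 30 * (\sum_i q i ^+ 4) / delta) +
    6 * (delta + delta^-1 * (\sum_i q i ^+ 2 * field_sqr mu A c i)) +
    `|\sum_i q i ^+ 2 * (ddpsi mu (tnth c i) - kappa)|)); last first.
  by apply/funext => c; rewrite [_^-1 * _]mulrC.
have m2 : bmeas (fun c : T => delta + delta^-1 * (\sum_i q i ^+ 2 * field_sqr mu A c i)).
  by apply: bmeasD; [exact: bmeas_cst|exact: bmeasZ].
have m1 : bmeas (fun _ : T => delta + 30 * (\sum_i q i ^+ 4) / delta) by exact: bmeas_cst.
have m12 := bmeasD m1 (bmeasZ 6 m2).
rewrite /E (meanZ EM _ (bmeasD m12 mW)) (meanD EM m12 mW) (meanD EM m1 (bmeasZ 6 m2)).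
rewrite (meanZ EM _ m2) (meanD EM (bmeas_cst _ _) (bmeasZ _ mqM)) (meanZ EM _ mqM) !(mean_cst EM).
rewrite -[leRHS]mulrA ler_wpM2l// -/E.
have H1 : 30 * (\sum_i q i ^+ 4) / delta <= 30 * delta.
  by rewrite ler_pdivrMr// -mulrA -expr2 ler_wpM2l.
have H2 : delta^-1 * E (fun c => \sum_i q i ^+ 2 * field_sqr mu A c i) <=
    14 / (1 - rho) ^+ 2 * delta.
  apply: (le_trans (ler_wpM2l dV EqM)).
  rewrite mulrCA (_ : delta^-1 * delta ^+ 2 = delta)//.
  by field; rewrite gt_eqF.
rewrite (_ : 84 / _ = 6 * (14 / (1 - rho) ^+ 2)); last by rewrite mulrA; congr (_ / _); lra.
move: H1 H2 EW; move: (30 * _ / _) (E _) (E _) (14 / _) => x1 x2 x3 x4; lra.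
Qed.

End error_bounds.

(** * From characteristic functions to distribution functions *)

Section trigonometric_polynomials.
Context (R : realType).

(* [trig W K f]: [f] is a finite sum of waves [a cos(w x + phi)] with
   frequencies [|w| <= W] and total amplitude at most [K]. *)
Inductive trig : R -> R -> (R -> R) -> Prop :=
| trig_wave (a w phi : R) : trig `|w| `|a| (fun x => a * cos (w * x + phi))
| trig_add (W1 K1 W2 K2 : R) f g : trig W1 K1 f -> trig W2 K2 g ->
    trig (Num.max W1 W2) (K1 + K2) (fun x => f x + g x).

Definition trigonometric f := exists W K, trig W K f.

Lemma trig_ge0 W K f : trig W K f -> 0 <= W /\ 0 <= K.
Proof.
elim=> [a w phi|W1 K1 W2 K2 {}f g _ [W10 K10] _ [W20 K20]]; first by [].
by rewrite le_max W10 addr_ge0.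
Qed.

Lemma trigonometric_add f g : trigonometric f -> trigonometric g ->
  trigonometric (fun x => f x + g x).
Proof.
move=> [W1 [K1 f1]] [W2 [K2 g2]].
by exists (Num.max W1 W2), (K1 + K2); exact: trig_add.
Qed.

Lemma trigonometric_wave a w phi : trigonometric (fun x => a * cos (w * x + phi)).
Proof. by exists `|w|, `|a|; exact: trig_wave. Qed.

Lemma trigonometric_cst a : trigonometric (fun=> a).
Proof.
have := trigonometric_wave a 0 0; congr trigonometric.
by apply/funext => x; rewrite mul0r addr0 cos0 mulr1.
Qed.

Lemma trigonometric_mul f g : trigonometric f -> trigonometric g ->
  trigonometric (fun x => f x * g x).
Proof.
move=> [W1 [K1 f1]] [W2 [K2 g2]].
elim: f1 => [a w phi|{W1 K1} W1 K1 W1' K1' f1 f2 _ H1 _ H2]; last first.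
  by under eq_fun do rewrite mulrDl; exact: trigonometric_add.
elim: g2 => [b v theta|{W2 K2} W2 K2 W2' K2' g1 g2 _ H1 _ H2]; last first.
  by under eq_fun do rewrite mulrDr; exact: trigonometric_add.
rewrite (_ : (fun x => _) = fun x =>
  (a * b / 2) * cos ((w + v) * x + (phi + theta)) +
  (a * b / 2) * cos ((w - v) * x + (phi - theta))).
  by apply: trigonometric_add; exact: trigonometric_wave.
apply/funext => x.
rewrite (_ : (w + v) * x + _ = (w * x + phi) + (v * x + theta)); last by ring.
rewrite (_ : (w - v) * x + _ = (w * x + phi) - (v * x + theta)); last by ring.
by move: (w * x + phi) (v * x + theta) => x1 x2; rewrite cosD cosB; field.
Qed.

Lemma trigonometric_exp f n : trigonometric f -> trigonometric (fun x => f x ^+ n).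
Proof.
move=> tf; elim: n => [|n IH]; first exact: trigonometric_cst.
by under eq_fun do rewrite exprS; exact: trigonometric_mul.
Qed.

Lemma trig_shift W K f m : trig W K f -> trig W K (fun x => f (x - m)).
Proof.
elim=> [a w phi|W1 K1 W2 K2 {}f g _ f1 _ g1]; last exact: trig_add.
rewrite (_ : (fun x => _) = fun x => a * cos (w * x + (phi - w * m))).
  exact: trig_wave.
by apply/funext => x; congr (_ * cos _); ring.
Qed.

Lemma trig_bmeas W K f : trig W K f -> bmeas (f : measurableTypeR R -> R).
Proof.
elim=> [a w phi|W1 K1 W2 K2 {}f g _ f1 _ g1]; last exact: bmeasD.
by apply: bmeasZ; apply: bmeas_cos; apply: measurable_funD => //.
Qed.

Lemma trig_mean_close (L G : (measurableTypeR R -> R) -> R) W0 eta :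
  is_mean L -> is_mean G ->
  (forall t phi, `|t| <= W0 ->
    `|L (fun x => cos (t * x + phi)) - G (fun x => cos (t * x + phi))| <= eta) ->
  forall W K f, trig W K f -> W <= W0 -> `|L f - G f| <= K * eta.
Proof.
move=> LM GM close W K f; elim=> [a w phi wW|W1 K1 W2 K2 {}f g f1 IH1 g1 IH2].
  have mw : bmeas (fun x : measurableTypeR R => cos (w * x + phi)).
    by apply: bmeas_cos; apply: measurable_funD => //; exact: measurable_funM.
  by rewrite (meanZ LM)// (meanZ GM)// -mulrBr normrM ler_wpM2l// close.
rewrite ge_max => /andP[W1W W2W].
have mf := trig_bmeas f1; have mg := trig_bmeas g1.
rewrite (meanD LM)// (meanD GM)// opprD addrACA mulrDl.
by rewrite (le_trans (ler_normD _ _))// lerD// ?IH1 ?IH2.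
Qed.

End trigonometric_polynomials.

(** * Trigonometric approximation of a step *)

Section trigonometric_step.
Context (R : realType).

Lemma bernoulli_ge (x : R) n : 0 <= x -> 1 + n%:R * x <= (1 + x) ^+ n.
Proof.
move=> x0; elim: n => [|n IH]; first by rewrite mul0r addr0 expr0.
rewrite exprS (le_trans _ (ler_wpM2l _ IH)) ?addr_ge0// -natr1.
have nx : 0 <= n%:R * x by rewrite mulr_ge0.
have := mulr_ge0 x0 nx; lra.
Qed.

Lemma bernoulli_ge1B (u : R) n : 0 <= u <= 1 -> 1 - n%:R * u <= (1 - u) ^+ n.
Proof.
move=> /andP[u0 u1]; elim: n => [|n IH]; first by rewrite mul0r subr0 expr0.
rewrite exprS (le_trans _ (ler_wpM2l _ IH)) ?subr_ge0// -natr1.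
have nu : 0 <= n%:R * u by rewrite mulr_ge0.
have := mulr_ge0 u0 nu; lra.
Qed.

Lemma bernoulli_le (u : R) n : 0 <= u <= 1 -> (1 - u) ^+ n * (1 + n%:R * u) <= 1.
Proof.
move=> /andP[u0 u1].
have un : 0 <= (1 - u) ^+ n by rewrite exprn_ge0 ?subr_ge0.
apply: (le_trans (ler_wpM2l un (bernoulli_ge n u0))).
rewrite -exprMn exprn_ile1//.
  by rewrite mulr_ge0 ?subr_ge0 ?addr_ge0.
have := sqr_ge0 u; lra.
Qed.

(** The functions [(1 - y^n)^(2^n)] are those of the elementary proof of Stone-Weierstrass by
    Brosowski and Deutsch. Here [2^n y^n <= (1 - c)^n] is small; in [step_high],
    [2^n y^n >= (1 + c)^n] is large. Bernoulli's inequality turns both into a rate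
    [1 / (1 + n c)]. *)
Lemma step_low (c y : R) n : 0 < c <= 1 -> 0 <= y <= (1 - c) / 2 ->
  1 - (1 + n%:R * c)^-1 <= (1 - y ^+ n) ^+ (2 ^ n).
Proof.
move=> /andP[c0 c1] /andP[y0 yc].
have y1 : y <= 1 by lra.
have yn : 0 <= y ^+ n <= 1 by rewrite exprn_ge0// exprn_ile1.
apply: le_trans (bernoulli_ge1B (2 ^ n) yn).
rewrite lerD2l lerN2 natrX -exprMn.
have p0 : 0 < 1 + n%:R * c by rewrite ltr_pwDl// mulr_ge0// ltW.
rewrite -[leRHS]mul1r ler_pdivlMr//.
have cc : 0 <= c <= 1 by rewrite ltW.
apply: le_trans (bernoulli_le n cc); rewrite ler_wpM2r ?(ltW p0)//.
by rewrite lerXn2r ?nnegrE; lra.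
Qed.

Lemma step_high (c y : R) n : 0 < c <= 1 -> (1 + c) / 2 <= y <= 1 ->
  (1 - y ^+ n) ^+ (2 ^ n) <= (1 + n%:R * c)^-1.
Proof.
move=> /andP[c0 c1] /andP[yc y1].
have y0 : 0 <= y by lra.
have yn : 0 <= y ^+ n <= 1 by rewrite exprn_ge0// exprn_ile1.
have p0 : 0 < 1 + n%:R * c by rewrite ltr_pwDl// mulr_ge0// ltW.
rewrite -[leRHS]mul1r ler_pdivlMr//.
apply: le_trans (bernoulli_le (2 ^ n) yn).
have s0 : 0 <= (1 - y ^+ n) ^+ (2 ^ n).
  by rewrite exprn_ge0// subr_ge0; have /andP[] := yn.
rewrite ler_wpM2l// natrX -exprMn.
have h : (1 + c) ^+ n <= (2 * y) ^+ n by rewrite lerXn2r ?nnegrE; lra.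
by rewrite (le_trans (bernoulli_ge n (ltW c0)))// (le_trans h)// lerDr.
Qed.

Lemma sin_lower_bound (h : R) : 0 < h -> h <= pi / 2 ->
  exists2 c : R, 0 < c <= 1 & forall s, h <= s <= pi - h -> c <= sin s.
Proof.
move=> h0 hp; have [||c] := @EVT_min R sin h (pi - h).
- by lra.
- by apply: continuous_subspaceT; exact: continuous_sin.
rewrite in_itv/= => /andP[hc cp] cmin; exists (sin c).
  rewrite sin_le1 andbT; apply: sin_gt0_pi; apply/andP; split; lra.
by move=> s hs; apply: cmin; rewrite in_itv.
Qed.

(* The step is [(1 - y^n)^(2^n)] with [y = (1 + sin z) / 2]: it jumps from 1 to 0
   where [y] crosses [1/2]. *)
Lemma trig_step (M h eps : R) : 0 < h -> h <= M -> 0 < eps ->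
  exists W K (S : R -> R), [/\ trig W K S, forall x, 0 <= S x <= 1,
    forall x, h <= x <= 2 * M - h -> S x <= eps &
    forall x, h <= - x <= 2 * M - h -> 1 - eps <= S x].
Proof.
move=> h0 hM eps0; have M0 : 0 < M by exact: lt_le_trans hM.
have p0 := @pi_gt0 R.
(* The period is [4 * M]: on [|x| < 2 * M] the sine of [w * x] has the sign of [x], and it is
   bounded away from 0 at distance at least [h] from [0] and from the ends. *)
pose w := pi / (2 * M); have w0 : 0 < w by rewrite divr_gt0// mulr_gt0.
have wM : w * (2 * M) = pi by rewrite /w divfK// mulf_neq0// gt_eqF.
have [||c c01 csin] := @sin_lower_bound (w * h).
- by rewrite mulr_gt0.
- by have := ler_wpM2l (ltW w0) hM; lra.
have c0 : 0 < c by have /andP[] := c01.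
have [n n_eps] : exists n, (1 + n%:R * c)^-1 <= eps.
  exists (Num.bound (eps^-1 / c)).
  have ec : 0 <= eps^-1 / c by rewrite divr_ge0 ?invr_ge0 ?(ltW eps0) ?(ltW c0).
  have := archi_boundP ec; rewrite ltr_pdivrMr// => H.
  rewrite -[leRHS]invrK lef_pV2 ?posrE ?invr_gt0//; first by lra.
  by rewrite ltr_pwDl// mulr_ge0// ltW.
pose y x := 2^-1 + 2^-1 * cos (w * x + - (pi / 2)).
have yE x : y x = (1 + sin (w * x)) / 2 by rewrite /y cosBpihalf; lra.
have y01 x : 0 <= y x <= 1.
  rewrite yE; have := sin_le1 (w * x); have := sin_geN1 (w * x).
  by move=> ? ?; apply/andP; split; lra.
pose S x := (1 + - 1 * y x ^+ n) ^+ (2 ^ n).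
have SE x : S x = (1 - y x ^+ n) ^+ (2 ^ n) by rewrite /S mulN1r.
have [W [K tS]] : trigonometric S.
  apply: trigonometric_exp; apply: trigonometric_add; first exact: trigonometric_cst.
  apply: trigonometric_mul; first exact: trigonometric_cst.
  apply: trigonometric_exp; apply: trigonometric_add; first exact: trigonometric_cst.
  exact: trigonometric_wave.
have sin_ge x : h <= x <= 2 * M - h -> c <= sin (w * x).
  move=> /andP[hx xM]; apply: csin; rewrite ler_wpM2l ?(ltW w0)//=.
  by rewrite -wM -mulrBr ler_wpM2l// ltW.
exists W, K, S; split=> // x.
- have /andP[u0 u1] := y01 x.
  have yn : 0 <= y x ^+ n <= 1 by rewrite exprn_ge0// exprn_ile1.
  have /andP[v0 v1] := yn.
  by rewrite SE exprn_ge0 ?subr_ge0// exprn_ile1 ?subr_ge0// lerBlDr lerDl.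
- move=> hx; rewrite SE (le_trans _ n_eps)//; apply: step_high => //.
  have := sin_ge _ hx; have /andP[_ ->] := y01 x; rewrite yE andbT; lra.
- move=> hx; rewrite SE (le_trans _ (step_low n c01 _))//.
    by rewrite lerD2l lerN2.
  have := sin_ge _ hx; have /andP[-> _] := y01 x; rewrite mulrN sinN yE/=; lra.
Qed.

End trigonometric_step.

(** * A quantitative continuity theorem *)

Section levy.
Context (R : realType).
Local Notation T := (measurableTypeR R).
Implicit Types L G : (T -> R) -> R.

Definition cdf_of L (t : R) : R := L \1_(`]-oo, t]%classic).

Definition tail_of L (M : R) : R := L \1_([set x : R | M < `|x|]%classic).

Lemma measurable_tail (M : R) : measurable [set x : T | M < `|x|].
Proof.
rewrite -[X in measurable X]setTI.
have mn : measurable_fun [set: T] (fun x : T => `|x|) by exact: measurableT_comp.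
by have := mn measurableT `]M, +oo[%classic (measurable_itv _);
  congr measurable; apply/seteqP; split=> x /=; rewrite in_itv/= andbT.
Qed.

Let mcdf t : bmeas (\1_(`]-oo, t]%classic) : T -> R).
Proof. by apply: bmeas_indic; exact: measurable_itv. Qed.

Let mtail M : bmeas (\1_([set x : R | M < `|x|]%classic) : T -> R).
Proof. by apply: bmeas_indic; exact: measurable_tail. Qed.

Lemma cdf_ge0 L t : is_mean L -> 0 <= cdf_of L t.
Proof. by move=> LM; apply: (mean_ge0 LM) => // x; have /andP[] := indic_bounds R `]-oo, t]%classic x. Qed.

Lemma cdf_le1 L t : is_mean L -> cdf_of L t <= 1.
Proof. by move=> LM; apply: (mean_le_cst LM) => // x; have /andP[] := indic_bounds R `]-oo, t]%classic x. Qed.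

Let indic_le (t x : R) : \1_(`]-oo, t]%classic) x = (x <= t)%R%:R :> R.
Proof.
rewrite indicE; congr (_%:R); congr nat_of_bool.
by apply/idP/idP; rewrite inE /= in_itv.
Qed.

Let indic_gt (M x : R) : \1_([set x : R | M < `|x|]%classic) x = (M < `|x|)%R%:R :> R.
Proof. by rewrite indicE; congr (_%:R); congr nat_of_bool; apply/idP/idP; rewrite inE. Qed.

Section sandwich.
Variables (M h eps : R) (S : R -> R).
Hypotheses (h0 : 0 < h) (eps0 : 0 <= eps).
Hypothesis S01 : forall x, 0 <= S x <= 1.
Hypothesis S_right : forall x, h <= x <= 2 * M - h -> S x <= eps.
Hypothesis S_left : forall x, h <= - x <= 2 * M - h -> 1 - eps <= S x.
Hypothesis mS : forall m, bmeas (fun x : T => S (x - m)).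

(** The step is centred at [t + h], so that every [x <= t] is at distance at least [h] from the
    jump. If moreover [|x| <= M], the shifted point stays inside the period; the other points are
    charged to the tail. *)
Lemma cdf_le_step L t : is_mean L -> `|t| <= M - 2 * h ->
  cdf_of L t <= L (fun x => S (x - (t + h))) + eps + tail_of L M.
Proof.
move=> LM; rewrite ler_norml => /andP[t1 t2].
rewrite -(mean_cst LM eps) -(meanD LM (mS _) (bmeas_cst _ _)).
rewrite -(meanD LM) //; last by apply: bmeasD => //; exact: bmeas_cst.
apply: (mean_le LM) => // [|x]; first by apply: bmeasD => //; apply: bmeasD => //; exact: bmeas_cst.
rewrite indic_le indic_gt; have /andP[s0 _] := S01 (x - (t + h)).
have [xt|_] := leP x t; last by rewrite addr_ge0 ?addr_ge0.
have [xM|xM] := leP `|x| M; last by rewrite lerDr addr_ge0.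
rewrite addr0 -lerBlDr; apply: S_left.
by move: xM; rewrite ler_norml => /andP[? ?]; apply/andP; split; lra.
Qed.

Lemma step_le_cdf L t : is_mean L -> `|t| <= M - 2 * h ->
  L (fun x => S (x - (t - h))) <= cdf_of L t + eps + tail_of L M.
Proof.
move=> LM; rewrite ler_norml => /andP[t1 t2].
rewrite -(mean_cst LM eps) -(meanD LM (mcdf _) (bmeas_cst _ _)).
rewrite -(meanD LM) //; last by apply: bmeasD => //; exact: bmeas_cst.
apply: (mean_le LM) => // [|x]; first by apply: bmeasD => //; apply: bmeasD => //; exact: bmeas_cst.
rewrite indic_le indic_gt; have /andP[_ s1] := S01 (x - (t - h)).
have [xt|xt] := leP x t; first by rewrite (le_trans s1)// -addrA lerDl addr_ge0.
have [xM|xM] := leP `|x| M; last by rewrite (le_trans s1)// lerDr add0r.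
rewrite addr0 add0r; apply: S_right.
by move: xM; rewrite ler_norml => /andP[? ?]; apply/andP; split; lra.
Qed.

End sandwich.

Lemma cdf_tail L M t : is_mean L -> M < `|t| ->
  if t < 0 then cdf_of L t <= tail_of L M else 1 - tail_of L M <= cdf_of L t.
Proof.
move=> LM Mt; case: ltP => t0.
  apply: (mean_le LM) => // x; rewrite indic_le indic_gt.
  have [xt|//] := leP x t.
  rewrite (lt_le_trans Mt)// ltr0_norm// ltr0_norm ?(le_lt_trans xt)//.
  by rewrite lerN2.
rewrite -(mean_cst LM 1) -(meanB LM (bmeas_cst _ _) (mtail M)).
apply: (mean_le LM) => // [|x]; first by apply: bmeasB => //; exact: bmeas_cst.
rewrite indic_le indic_gt; have [_|xt] := leP x t.
  by rewrite lerBlDr lerDl.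
rewrite (lt_trans Mt) ?subrr// ger0_norm// ger0_norm// ltW//.
exact: le_lt_trans xt.
Qed.

Lemma tail_ge0 L M : is_mean L -> 0 <= tail_of L M.
Proof.
by move=> LM; apply: (mean_ge0 LM).
Qed.

Lemma tail_anti L M N : is_mean L -> M <= N -> tail_of L N <= tail_of L M.
Proof.
move=> LM MN; apply: (mean_le LM) => // x; rewrite !indic_gt.
by have [Nx|//] := ltP N `|x|; rewrite (le_lt_trans MN Nx).
Qed.

(* Quantitative continuity theorem: a step between [t - h] and [t + h] is
   replaced by a trigonometric polynomial, whose frequencies and amplitudes do not
   depend on [t]. *)
Lemma continuity_theorem G eps M h : is_mean G -> 0 < eps -> 0 < h -> 8 * h <= M ->
  (forall t, cdf_of G (t + 2 * h) <= cdf_of G t + eps) ->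
  tail_of G (M / 2) <= eps ->
  exists W eta : R, 0 < eta /\ forall L, is_mean L ->
    tail_of L (M / 2) <= eps ->
    (forall t phi : R, `|t| <= W ->
      `|L (fun x => cos (t * x + phi)) - G (fun x => cos (t * x + phi))| <= eta) ->
    forall t, `|cdf_of L t - cdf_of G t| <= 6 * eps.
Proof.
move=> GM eps0 h0 hM Gcont Gtail.
have [|W [K [S [tS S01 S_right S_left]]]] := @trig_step R M h eps h0 _ eps0; first by lra.
have [W0 K0] := trig_ge0 tS.
have mS m : bmeas (fun x : T => S (x - m)) by exact: trig_bmeas (trig_shift m tS).
exists W, (eps / (1 + K)); split; first by rewrite divr_gt0// ltr_pwDl.
move=> L LM Ltail close t.
have M2 : M / 2 <= M by lra.
have LtM : tail_of L M <= eps by exact: le_trans (tail_anti LM M2) Ltail.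
have GtM : tail_of G M <= eps by exact: le_trans (tail_anti GM M2) Gtail.
have Sclose m : `|L (fun x => S (x - m)) - G (fun x => S (x - m))| <= eps.
  apply: (le_trans (trig_mean_close LM GM close (trig_shift m tS) (lexx _))).
  by rewrite mulrA ler_pdivrMr ?ltr_pwDl// mulrC ler_wpM2l ?(ltW eps0)// lerDr.
have [tM|tM] := leP `|t| (M / 2); last first.
  have := cdf_tail LM tM; have := cdf_tail GM tM.
  have := cdf_ge0 t LM; have := cdf_le1 t LM.
  have := cdf_ge0 t GM; have := cdf_le1 t GM.
  by case: ifP => _ *; rewrite ler_norml; apply/andP; split; lra.
have small s : `|s| <= M / 2 + 2 * h -> `|s| <= M - 2 * h.
  by move=> /le_trans; apply; lra.
have tsmall : `|t| <= M - 2 * h by apply: small; lra.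
have t2small : `|t + 2 * h| <= M - 2 * h.
  apply: small; rewrite (le_trans (ler_normD _ _))// lerD//.
  by rewrite ger0_norm//; lra.
have t2small' : `|t - 2 * h| <= M - 2 * h.
  apply: small; rewrite (le_trans (ler_normB _ _))// lerD//.
  by rewrite ger0_norm//; lra.
have e0 := ltW eps0.
(* Six times [eps] in each direction: two for the sandwich under [L], one for the trigonometric
   comparison, two for the sandwich under [G], one for the continuity of [G] over [2 * h]. *)
have up := cdf_le_step e0 S01 S_left mS LM tsmall.
have up' := step_le_cdf e0 S01 S_right mS GM t2small.
have dn := step_le_cdf e0 S01 S_right mS LM tsmall.
have dn' := cdf_le_step e0 S01 S_left mS GM t2small'.
have c1 := Sclose (t + h); have c2 := Sclose (t - h).
rewrite (_ : t + 2 * h - h = t + h) in up'; last by lra.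
rewrite (_ : t - 2 * h + h = t - h) in dn'; last by lra.
have G1 := Gcont t; have := Gcont (t - 2 * h); rewrite subrK => G2.
move: c1 c2; rewrite !ler_norml => /andP[c1 c1'] /andP[c2 c2'].
by apply/andP; split; lra.
Qed.

End levy.

(** * The Gaussian law *)

Section gaussian_mean.
Context (R : realType) (V : R).
Hypothesis V0 : 0 < V.
Local Notation T := (measurableTypeR R).
Let s := Num.sqrt V.
Let p : R -> R := normal_pdf 0 s.

Let s0 : s != 0. Proof. by rewrite gt_eqF// sqrtr_gt0. Qed.

Let peak0 : 0 < normal_peak s. Proof. exact: normal_peak_gt0. Qed.

Let pE x : p x = normal_peak s * expR (- (2 * V)^-1 * x ^+ 2).
Proof.
rewrite /p normal_pdfE// /normal_fun subr0 -mulr_natl sqr_sqrtr ?(ltW V0)//.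
by congr (_ * expR _); rewrite mulNr mulrC mulNr.
Qed.

Let p_ge0 x : 0 <= p x. Proof. exact: normal_pdf_ge0. Qed.

Definition gaussian_mean (f : T -> R) : R :=
  \int[lebesgue_measure]_x (f x * p x).
Local Notation G := gaussian_mean.

Let ip : lebesgue_measure.-integrable [set: R] (EFin \o p).
Proof. exact: integrable_normal_pdf. Qed.

Let mp : measurable_fun [set: T] (p : T -> R).
Proof. exact: measurable_normal_pdf. Qed.

Lemma integrable_gaussian (f : T -> R) : bmeas f ->
  lebesgue_measure.-integrable [set: R] (EFin \o (fun x => f x * p x)).
Proof.
move=> [mf [M fM]]; apply: le_integrable (integrableZl measurableT M ip) => //.
- by apply/measurable_EFinP; exact: measurable_funM.
- move=> x _ /=; rewrite lee_fin !normrM ler_wpM2r//.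
  by rewrite (le_trans (fM x))// ler_norm.
Qed.

Lemma gaussian_meanP : is_mean G.
Proof.
split.
- move=> f g mf mg; rewrite /G -RintegralD//; try exact: integrable_gaussian.
  by apply: eq_Rintegral => x _; rewrite mulrDl.
- move=> a f mf; rewrite /G -RintegralZl//; last exact: integrable_gaussian.
  by apply: eq_Rintegral => x _; rewrite mulrA.
- move=> f g mf mg fg; apply: le_Rintegral => //; try exact: integrable_gaussian.
  by move=> x _ /=; rewrite ler_wpM2r.
- rewrite /G /Rintegral; under eq_integral do rewrite mul1r.
  by rewrite integral_normal_pdf.
Qed.

Let GM := gaussian_meanP.

Lemma gaussian_mean_restrict (D : set T) (f : T -> R) :
  G (fun x => \1_D x * f x) = \int[lebesgue_measure]_(x in D) (f x * p x).
Proof.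
rewrite Rintegral_mkcond; apply: eq_Rintegral => x _.
by rewrite patch_indic/= -mulrA mulrC.
Qed.

Lemma gaussian_indic (D : set T) : G \1_D = fine (gaussian V D).
Proof.
rewrite /gaussian /normal_prob -[RHS]/(\int[lebesgue_measure]_(x in D) p x).
rewrite -[LHS]/(G (fun x => \1_D x)).
rewrite (_ : (fun x => \1_D x) = fun x => \1_D x * 1); last by apply/funext => x; rewrite mulr1.
by rewrite gaussian_mean_restrict; apply: eq_Rintegral => x _; rewrite mul1r.
Qed.

Lemma gaussian_anticoncentration (eps : R) : 0 < eps ->
  exists2 h : R, 0 < h & forall t, cdf_of G (t + 2 * h) <= cdf_of G t + eps.
Proof.
move=> eps0; exists (eps / (2 * normal_peak s)).
  by rewrite divr_gt0// mulr_gt0.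
set h := eps / _ => t; have h0 : 0 < h by rewrite divr_gt0// mulr_gt0.
have mD : measurable `]t, (t + 2 * h)]%classic by exact: measurable_itv.
have mi (D : set T) : measurable D -> bmeas (\1_D : T -> R) by exact: bmeas_indic.
have m1 := mi _ (measurable_itv `]-oo, t]); have m2 := mi _ mD.
have m3 := mi _ (measurable_itv `]-oo, (t + 2 * h)]).
apply: (@le_trans _ _ (cdf_of G t + G \1_(`]t, (t + 2 * h)]%classic))).
  rewrite /cdf_of -(meanD GM)//; apply: (mean_le GM) => // [|x]; first exact: bmeasD.
  rewrite !indicE -natrD ler_nat.
  have -> : (x \in `]-oo, (t + 2 * h)]%classic) = (x <= t + 2 * h).
    by apply/idP/idP; rewrite inE/= in_itv.
  have -> : (x \in `]-oo, t]%classic) = (x <= t).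
    by apply/idP/idP; rewrite inE/= in_itv.
  have -> : (x \in `]t, (t + 2 * h)]%classic) = (t < x <= t + 2 * h).
    by apply/idP/idP; rewrite inE/= in_itv.
  by case: (x <= t + 2 * h) => //; rewrite andbT; case: ltP.
rewrite lerD2l.
have -> : (\1_(`]t, (t + 2 * h)]%classic) : T -> R) =
    fun x => \1_(`]t, (t + 2 * h)]%classic) x * 1 by apply/funext => x; rewrite mulr1.
rewrite gaussian_mean_restrict.
apply: (@le_trans _ _ (\int[lebesgue_measure]_(x in `]t, (t + 2 * h)]) normal_peak s)).
  apply: le_Rintegral => //.
  - apply: integrableS (integrable_gaussian (bmeas_cst _ 1)) => //.
  - have ic : lebesgue_measure.-integrable `[t, (t + 2 * h)]
        (EFin \o (fun=> normal_peak s)).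
      apply: continuous_compact_integrable; first exact: segment_compact.
      by apply: continuous_subspaceT => x; exact: cst_continuous.
    apply: integrableS ic; [exact: measurable_itv|exact: measurable_itv|].
    by apply: subset_itvr; rewrite bnd_simp.
  - by move=> x _; rewrite mul1r normal_pdf_ub.
rewrite Rintegral_cst; last exact: measurable_itv.
rewrite [X in fine X]lebesgue_measure_itv/= lte_fin ltrDl mulr_gt0//=.
rewrite addrAC subrr add0r le_eqVlt; apply/orP; left; apply/eqP; rewrite /h.
by field; rewrite gt_eqF.
Qed.

Lemma gaussian_tail (eps : R) : 0 < eps ->
  exists N, forall M, N <= M -> tail_of G M <= eps.
Proof.
move=> eps0.
pose A (n : nat) : set T := [set x | n%:R < `|x|].
have mA n : measurable (A n) by exact: measurable_tail.
have IA : \bigcap_n A n = set0.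
  rewrite -subset0 => x /(_ (Num.bound `|x|) I) /=.
  by apply/negP; rewrite -leNgt ltW// archi_boundP.
have : (normal_prob 0 s \o A) n @[n --> \oo] --> normal_prob 0 s (\bigcap_n A n).
  apply: nonincreasing_cvg_mu => //.
  - by rewrite (le_lt_trans (probability_le1 _ _))// ltry.
  - by rewrite IA.
  - move=> n m nm; apply/subsetPset => x /=; apply: le_lt_trans.
    by rewrite ler_nat.
rewrite IA measure0 => /fine_cvgP[_] /cvgrPdist_le /(_ _ eps0) [n _ An].
exists n%:R => M nM; apply: (le_trans (tail_anti GM nM)).
have := An n (leqnn _); rewrite /= sub0r normrN /tail_of gaussian_indic.
exact/le_trans/ler_norm.
Qed.

Let is_derive_pdf (x : R) : is_derive x 1 p (- (x / V) * p x).
Proof.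
have dq : is_derive x 1 (fun y : R => - (2 * V)^-1 * y ^+ 2) (- (x / V)).
  apply: is_derive_eq; rewrite -[RHS]/(- (x / V)) /GRing.scale/=.
  by field; rewrite gt_eqF.
have de := @is_derive1_comp R expR _ x _ _ (is_derive_expR _) dq.
have dp := is_derive_mul (@is_derive_cst R R R (normal_peak s) x 1) de.
rewrite (_ : p = fun y => normal_peak s * (expR \o (fun y => - (2 * V)^-1 * y ^+ 2)) y).
  by apply: is_derive_eq dp _; rewrite /=; ring.
by apply/funext => y; rewrite pE.
Qed.

(** From [p' = - (x / V) p], the function [V * p * sin] is a primitive of the difference of the two
    integrands. *)
Lemma gaussian_by_parts (t phi a b : R) : a < b ->
  \int[lebesgue_measure]_(x in `[a, b]) ((x * sin (t * x + phi)) * p x) =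
  V * t * \int[lebesgue_measure]_(x in `[a, b]) (cos (t * x + phi) * p x) -
  V * (p b * sin (t * b + phi) - p a * sin (t * a + phi)).
Proof.
move=> ab.
have dl (x : R) : is_derive x 1 (fun y : R => t * y + phi) t.
  by apply: is_derive_eq; rewrite /GRing.scale/=; ring.
have ds (x : R) : is_derive x 1 (fun y => sin (t * y + phi)) (cos (t * x + phi) * t).
  exact: (@is_derive1_comp R sin _ x _ _ (is_derive_sin _) (dl x)).
have dc (x : R) : is_derive x 1 (fun y => cos (t * y + phi)) (- sin (t * x + phi) * t).
  exact: (@is_derive1_comp R cos _ x _ _ (is_derive_cos _) (dl x)).
pose F x := V * (p x * sin (t * x + phi)).
pose f1 x := (x * sin (t * x + phi)) * p x.
pose f2 x := cos (t * x + phi) * p x.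
pose f x := V * t * f2 x - f1 x.
have dF (x : R) : is_derive x 1 F (f x).
  apply: is_derive_eq (is_derive_mul (@is_derive_cst R R R V x 1)
    (is_derive_mul (is_derive_pdf x) (ds x))) _.
  by rewrite /f /f1 /f2 /=; move: (p x) (sin _) (cos _) => ? ? ?; field; rewrite gt_eqF.
have cont g dg : (forall x : R, is_derive x 1 g (dg x : R)) -> continuous (g : R -> R).
  move=> gd x; apply/differentiable_continuous/derivable1_diffP.
  exact: (@ex_derive _ _ _ _ _ _ _ (gd x)).
have df1 (x : R) := is_derive_mul (is_derive_mul (is_derive_id x (1 : R)) (ds x)) (is_derive_pdf x).
have df2 (x : R) := is_derive_mul (dc x) (is_derive_pdf x).
have df2' (x : R) := is_derive_mul (@is_derive_cst R R R (V * t) x 1) (df2 x).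
have cf1 : continuous f1 := cont _ _ df1.
have cf2 : continuous f2 := cont _ _ df2.
have cf2' : continuous (fun x => V * t * f2 x) := cont _ _ df2'.
have cf : continuous f := cont _ _ (fun x => is_derive_sub (df2' x) (df1 x)).
have int g : continuous g -> lebesgue_measure.-integrable `[a, b] (EFin \o (g : R -> R)).
  move=> cg; apply: continuous_compact_integrable; first exact: segment_compact.
  exact: continuous_subspaceT.
have dab : derivable_oo_LRcontinuous F a b.
  have cF := cont _ _ dF.
  split; last 2 first.
  - exact/cvg_at_right_filter/cF.
  - exact/cvg_at_left_filter/cF.
  by move=> x _; exact: (@ex_derive _ _ _ _ _ _ _ (dF x)).
have FE : {in `]a, b[, F^`()%classic =1 f}.
  by move=> x _; rewrite derive1E; have [_ ->] := dF x.
have E := @continuous_FTC2 R f F a b ab (continuous_subspaceT cf) dab FE.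
have : \int[lebesgue_measure]_(x in `[a, b]) f x = F b - F a by rewrite /Rintegral E.
rewrite /f RintegralB//; first last.
- exact: int.
- exact: int.
rewrite RintegralZl//; last exact: int.
rewrite /F -mulrBr; move=> <-; ring.
Qed.

(** The Gaussian satisfies the differential equation of [gaussian_ode] by integration by parts.
    Since means are only available for bounded functions, [x] is truncated to [[-N, N]], with
    boundary and tail errors vanishing as [N] grows. *)
Lemma gaussian_charfun t phi :
  G (fun x => cos (t * x + phi)) = cos phi * expR (- (V * t ^+ 2 / 2)).
Proof.
apply/eqP; rewrite -subr_eq0 -normr_le0; apply/ler_addgt0Pr => eps eps0; rewrite add0r.
(* [C] is the coefficient of [eps / C] in the final bound; [N] is taken so large that both [N^-1]
   and the tail are at most [eps / C]. *)
pose C := 2 * V * normal_peak s * (2 * V) * `|t| + (V * t ^+ 2 + 2); have C0 : 0 < C.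
  have V2 : 0 <= 2 * V by rewrite mulr_ge0// ltW.
  apply: ltr_wpDl; first by rewrite !mulr_ge0// ltW.
  by apply: ltr_wpDl => //; apply: mulr_ge0; [exact: ltW|exact: sqr_ge0].
have [N0 tailN] := gaussian_tail (divr_gt0 eps0 C0).
pose N := Num.max N0 (1 + C / eps).
have N1 : 1 <= N by rewrite le_max lerDl divr_ge0 ?orbT// ltW.
have Ngt0 : 0 < N by exact: lt_le_trans N1.
have NC : C / eps <= N by rewrite le_max lerDr ler01 orbT.
have tl : tail_of G N <= eps / C by apply: tailN; rewrite le_max lexx.
pose J := `[- N, N]%classic : set T.
have mJ : measurable J by exact: measurable_itv.
have JE (x : R) : \1_J x = (`|x| <= N)%R%:R :> R.
  rewrite indicE /J; congr (_%:R); congr nat_of_bool.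
  by apply/idP/idP; rewrite inE/= in_itv/= ler_norml.
have bJ : bmeas (\1_J : T -> R) by exact: bmeas_indic.
have bT : bmeas (\1_([set x : R | N < `|x|]%classic) : T -> R).
  by apply: bmeas_indic; exact: measurable_tail.
have TE (x : R) : \1_([set x : R | N < `|x|]%classic) x = 1 - \1_J x :> R.
  rewrite JE indicE; have [xN|xN] := leP `|x| N.
    by rewrite subrr memNset//= => /lt_geF; rewrite xN.
  by rewrite subr0 mem_set.
pose X (x : T) := x * \1_J x.
have mX : bmeas X.
  split; first by apply: measurable_funM => //; have [] := bJ.
  exists N => x; rewrite /X JE; have [xN|_] := leP `|x| N; first by rewrite mulr1.
  by rewrite mulr0 normr0 ltW.
have mc u : bmeas (fun x : T => cos (u * x + phi)).
  by apply: bmeas_cos; apply: measurable_funD => //; exact: measurable_funM.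
pose fN u := G (fun x => cos (u * X x + phi)).
pose tN := tail_of G N.
have tN0 : 0 <= tN by exact: tail_ge0.
have GJ u : fN u = \int[lebesgue_measure]_(x in J) (cos (u * x + phi) * p x) + cos phi * tN.
  rewrite -gaussian_mean_restrict /tN /tail_of -(meanZ GM)// -(meanD GM); first last.
  - exact: bmeasZ.
  - exact: bmeasM.
  congr G; apply/funext => x; rewrite TE /X JE.
  by have [xN|xN] := leP `|x| N; rewrite ?mulr1 ?mulr0 ?mul1r ?mul0r ?subrr ?subr0 ?mulr0 ?mulr1 ?addr0 ?add0r.
have JN : - N < N by lra.
(* From [expR (- y) <= 1 / y] with [y = N^2 / (2 V)], and [N >= 1]. *)
have pN : `|p N| <= normal_peak s * (2 * V) / N.
  rewrite ger0_norm// pE -mulrA ler_wpM2l ?(ltW peak0)// ler_pdivlMr//.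
  rewrite mulNr expRN -ler_pdivlMl ?invr_gt0 ?expR_gt0// invrK mulrC.
  have := expR_ge1Dx ((2 * V)^-1 * N ^+ 2).
  have V2 : 0 < 2 * V by rewrite mulr_gt0.
  move/(ler_wpM2l (ltW V2)); rewrite mulrDr mulr1 mulrA mulfV ?gt_eqF// mul1r.
  apply: le_trans.
  by rewrite (@le_trans _ _ (N ^+ 2))// ?lerDr ?(ltW V2)// expr2 ler_peMr// ltW.
have pNN : p (- N) = p N by rewrite !pE sqrrN.
have ode := gaussian_ode (ltW V0) (is_derive_mean_cos GM mX phi) (t := t)
  (delta := 2 * V * (normal_peak s * (2 * V) / N) + V * `|t| * (eps / C)).
have {}ode : `|fN t - cos phi * expR (- (V * t ^+ 2 / 2))| <=
    `|t| * (2 * V * (normal_peak s * (2 * V) / N) + V * `|t| * (eps / C)).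
  have := ode; rewrite (_ : G (fun x => cos (0 * X x + phi)) = cos phi); last first.
    under eq_fun do rewrite mul0r add0r.
    exact: (mean_cst GM).
  apply=> u ut; rewrite -/(fN u).
  have -> : G (fun w => X w * sin (u * X w + phi)) =
      \int[lebesgue_measure]_(x in J) ((x * sin (u * x + phi)) * p x).
    rewrite -gaussian_mean_restrict; congr G; apply/funext => x; rewrite /X JE.
    by have [xN|xN] := leP `|x| N; rewrite ?mulr1 ?mulr0 ?mul1r ?mul0r.
  rewrite gaussian_by_parts// GJ pNN.
  rewrite [X in `|X| <= _](_ : _ = V * (p N * (sin (u * N + phi) - sin (u * - N + phi))) +
     V * u * (cos phi * tN)); last by ring.
  rewrite (le_trans (ler_normD _ _))// lerD//.
    rewrite normrM (ger0_norm (ltW V0)) normrM -[leRHS]mulrA [leRHS]mulrCA ler_wpM2l ?(ltW V0)//.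
    rewrite mulrC; apply: ler_pM => //; rewrite (le_trans (ler_normB _ _))//.
    have sin1 x : `|sin x| <= 1 :> R by rewrite ler_norml sin_geN1 sin_le1.
    by have := sin1 (u * N + phi); have := sin1 (u * - N + phi); lra.
  rewrite !normrM (ger0_norm (ltW V0)) ler_pM// ?mulr_ge0// ?(ltW V0)//.
    by rewrite ler_wpM2l// ltW.
  rewrite (ger0_norm tN0) -[leRHS]mul1r ler_pM//.
  by rewrite ler_norml cos_geN1 cos_le1.
have fNt : `|G (fun x => cos (t * x + phi)) - fN t| <= 2 * (eps / C).
  have mfN : bmeas (fun x => cos (t * X x + phi)).
    by apply: bmeas_cos; apply: measurable_funD => //; apply: measurable_funM => //; have [] := mX.
  rewrite -(meanB GM)//; apply: (@le_trans _ _ (2 * tN)); last by rewrite ler_wpM2l.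
  rewrite -(meanZ GM)//; apply: (mean_norm_le GM) => [| |x].
  - exact: bmeasB.
  - exact: bmeasZ.
  rewrite TE /X JE; have [xN|xN] := leP `|x| N.
    by rewrite mulr1 subrr normr0 subrr mulr0.
  rewrite subr0 mulr1 (le_trans (ler_normB _ _))//.
  have cos1 x' : `|cos x'| <= 1 :> R by rewrite ler_norml cos_geN1 cos_le1.
  by have := cos1 (t * x + phi); have := cos1 (t * (x * 0) + phi); lra.
rewrite -(subrKA (fN t)) (le_trans (ler_normD _ _))//.
apply: (le_trans (lerD fNt ode)).
have N_inv : N^-1 <= eps / C.
  by rewrite -[leRHS]invrK lef_pV2 ?posrE ?invr_gt0 ?divr_gt0// invf_div.
have eC : eps = C * (eps / C) by field; rewrite gt_eqF.
rewrite [leRHS]eC; set e := eps / C in N_inv *.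
have -> : C * e = 2 * e + `|t| * (2 * V * (normal_peak s * (2 * V) * e) + V * `|t| * e).
  by rewrite /C -(real_normK (num_real t)); ring.
rewrite lerD2l ler_wpM2l// lerD2r -!mulrA ler_wpM2l// ler_wpM2l ?(ltW V0)//.
by rewrite ler_wpM2l ?(ltW peak0)// ler_wpM2l// ler_wpM2l ?(ltW V0).
Qed.

End gaussian_mean.

(** * Limits for regular couplings *)

Lemma mean_markov d (T : measurableType d) (R : realType) (L : (T -> R) -> R)
  (f : T -> R) (M : R) : is_mean L -> 0 < M -> bmeas f -> (forall x, 0 <= f x) ->
  L \1_([set x | M < f x]) <= L f / M.
Proof.
move=> LM M0 mf f0; rewrite mulrC -(meanZ LM)//.
have mA : measurable [set x | M < f x].
  rewrite -[X in measurable X]setTI.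
  have := mf.1 measurableT `]M, +oo[%classic (measurable_itv _).
  by congr measurable; apply/seteqP; split=> x /=; rewrite in_itv/= andbT.
apply: (mean_le LM); [exact: bmeas_indic|exact: bmeasZ|move=> x].
rewrite indicE ler_pdivlMl//; have [h|h] := ltP M (f x).
  by rewrite mem_set// mulr1 ltW.
by rewrite memNset ?mulr0//=; apply/negP; rewrite -leNgt.
Qed.

Lemma tail_pushforward d (T : measurableType d) (R : realType) (L : (T -> R) -> R)
  (X : T -> R) (M : R) : is_mean L -> 0 < M -> bmeas X ->
  tail_of (fun f => L (fun x => f (X x))) M <= L (fun x => `|X x|) / M.
Proof.
move=> LM M0 mX; exact: mean_markov LM M0 (bmeas_norm mX) (fun x => normr_ge0 (X x)).
Qed.

Lemma indep_of_linear_rest d (T : measurableType d) (R : realType) n (i : 'I_n)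
  (w : 'I_n -> R) (f : T -> R) (a : R) : indep_of i (fun c : n.-tuple T =>
    a * (\sum_j w j * f (tnth c j)) - a * w i * f (tnth c i)).
Proof.
have sumD c : a * (\sum_j w j * f (tnth c j)) - a * w i * f (tnth c i) =
    \sum_(j | j != i) a * w j * f (tnth c j).
  rewrite mulr_sumr (bigD1 i)//= mulrA [X in X - _]addrC addrK.
  by apply: eq_bigr => j _; rewrite mulrA.
move=> c z; rewrite !sumD; apply: eq_bigr => j ji.
by rewrite tnth_upd (negbTE ji).
Qed.

Section uniform_limit.
Context (R : realType) (mu F : probability (measurableTypeR R) R).
Hypothesis hmu : base_measure mu.
Hypothesis F0 : expect F (dpsi mu) = 0.
Local Notation kappa := (mean_ddpsi mu F).

(** The deterministic interface between the graph and the limit theorems. For the graph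
    [a = 2 / (n p)], so [regular_small] asks for a small [1 / (sqrt n * p)], and the factor
    [1 + n * a] of [regular_residual] is of order [1 / p]. *)
Record regular_coupling (rho lam delta a : R) n (A : 'M[R]_n) (q : 'I_n -> R) : Prop :=
  RegularCoupling {
    regular_matrix : coupling_matrix A;
    regular_pos : (0 < n)%N;
    regular_sqr_gt0 : 0 < a;
    regular_row : forall i, \sum_j `|A i j| <= rho;
    regular_sqr : forall i, \sum_j A i j ^+ 2 <= a;
    regular_unit : \sum_i q i ^+ 2 = 1;
    regular_max : forall i, `|q i| <= delta;
    regular_small : Num.sqrt n%:R * a <= delta ^+ 2;
    regular_residual :
      (\sum_j mean_residual mu F A q lam j ^+ 2) * (1 + n%:R * a) <= delta ^+ 2 }.

Definition mean_sqr_dpsi : R := expect F (fun x => dpsi mu x ^+ 2).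
Local Notation tau := mean_sqr_dpsi.

Let mdpsi2 : bmeas (fun x : measurableTypeR R => dpsi mu x ^+ 2).
Proof. by apply: bmeasX; exact: bmeas_dpsi. Qed.

Lemma mean_sqr_dpsi_ge0 : 0 <= tau.
Proof. by apply: (mean_ge0 (expect_mean F)) => // x; exact: sqr_ge0. Qed.

Variables (rho lam : R).
Hypotheses (rho0 : 0 < rho) (rho1 : rho < 1) (lamkappa0 : 0 < lam * kappa).

Section fixed_coupling.
Variables (delta a : R) (n : nat) (A : 'M[R]_n) (q : 'I_n -> R).
Hypotheses (delta0 : 0 < delta) (delta1 : delta <= 1).
Hypothesis reg : regular_coupling rho lam delta a A q.
Local Notation T := (n.-tuple (measurableTypeR R)).
Let K := n%:R * a / delta.
Let err1 := err_linear mu A rho a q lam delta K.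
Let err2 := err_variance mu A q lam kappa delta.
Let GM := gibbs_meanP mu A.
Let EM := expect_mean (iid F n).
Let cA := regular_matrix reg.
Let a0 := regular_sqr_gt0 reg.
Let Arow := regular_row reg.
Let Asqr := regular_sqr reg.
Let q1 := regular_unit reg.
Let C1 := linear_constant rho lam.
Let C2 := variance_constant rho lam.

Let K0 : 0 < K.
Proof. by rewrite divr_gt0// mulr_gt0 ?ltr0n ?(regular_pos reg). Qed.

Let Eerr1 : expect (iid F n) err1 <= C1 * delta.
Proof.
exact: (expect_err_linear hmu cA rho0 rho1 a0 Arow Asqr delta0 delta1 q1 F0
  (regular_pos reg) (regular_small reg) (regular_residual reg)).
Qed.

Let Eerr2 : expect (iid F n) err2 <= C2 * delta.
Proof.
exact: (expect_err_variance hmu cA rho0 rho1 a0 Arow Asqr lam delta0 q1 F0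
  (regular_pos reg) (regular_max reg) (regular_small reg)).
Qed.

Let q3 : \sum_i `|q i| ^+ 3 <= delta.
Proof. by apply: sum_q_cube q1 _; exact: regular_max reg. Qed.

Let linear_stat (s : T) := \sum_i q i * tnth (spins s) i.

Let bmeas_linear : bmeas linear_stat.
Proof. by apply: bmeas_sum => i; apply: bmeasZ; exact: bmeas_spin. Qed.

Let merr1 : bmeas (err1 : T -> R). Proof. exact: bmeas_err_linear. Qed.
Let merr2 : bmeas (err2 : T -> R). Proof. exact: bmeas_err_variance. Qed.

Let err1_ge0 c : 0 <= err1 c.
Proof.
have ctr : is_center mu A q lam c (lam * \sum_i q i * dpsi mu (tnth c i)) by left.
apply: le_trans (center_close hmu cA rho0 rho1 a0 Arow Asqr delta0 K0 ctr).
apply: (mean_ge0 (GM c)) => // ; apply/bmeas_norm/bmeasB.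
  by apply: bmeasB => //; exact: bmeas_cst.
by apply: bmeasZ; apply: bmeas_sum => i; apply: bmeasZ; exact: bmeas_xi.
Qed.

Let err2_ge0 c : 0 <= err2 c.
Proof.
apply: le_trans (variance_close hmu cA rho1 Arow lam kappa delta0 q1 c).
apply: (mean_ge0 (GM c)) => //; apply/bmeas_norm/bmeasB; last exact: bmeas_cst.
apply: bmeasZ; apply: bmeas_sum => i; apply: bmeasZ; apply: bmeasM.
  exact: bmeas_xi.
exact: bmeas_spin.
Qed.

Definition charfun_error (W : R) : R := W * (1 + W + 2 * `|lam| * W ^+ 2).

Lemma conditional_charfun (eta W : R) c y t phi :
  is_center mu A q lam c y -> err1 c <= eta -> err2 c <= eta -> delta <= eta ->
  `|t| <= W ->
  `|gibbs_mean mu A c (fun s => cos (t * (linear_stat s - y) + phi)) -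
    cos phi * expR (- (lam * kappa * t ^+ 2 / 2))| <= charfun_error W * eta.
Proof.
move=> cy e1 e2 de tW.
apply: (le_trans (gibbs_charfun hmu cA rho0 rho1 a0 Arow Asqr delta0 K0 q1 (ltW lamkappa0) t phi cy)).
have W0 : 0 <= W by exact: le_trans tW.
have s0 : 0 <= \sum_i `|q i| ^+ 3 by apply: sumr_ge0 => i _; rewrite exprn_ge0.
have e0 : 0 <= eta by exact: le_trans (err1_ge0 c) e1.
have t2 : t ^+ 2 <= W ^+ 2 by rewrite -real_normK ?num_real// lerXn2r ?nnegrE.
rewrite /charfun_error -[leRHS]mulrA; apply: ler_pM => //.
  apply: addr_ge0; first by rewrite addr_ge0 ?err1_ge0// mulr_ge0// err2_ge0.
  by apply: mulr_ge0 => //; apply: mulr_ge0; [exact: mulr_ge0|exact: sqr_ge0].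
rewrite [leRHS]mulrDl [X in _ <= X + _]mulrDl mul1r; apply: lerD; first apply: lerD => //.
  by apply: ler_pM => //; exact: err2_ge0.
apply: ler_pM => //; first by apply: mulr_ge0; [exact: mulr_ge0|exact: sqr_ge0].
  by rewrite ler_wpM2l// mulr_ge0.
exact: le_trans q3 de.
Qed.

Lemma conditional_moment c y : is_center mu A q lam c y ->
  gibbs_mean mu A c (fun s => `|linear_stat s - y|) <= err1 c + 7 * `|lam|.
Proof. exact: (gibbs_abs_moment hmu cA rho0 rho1 a0 Arow Asqr delta0 K0 q1). Qed.

Lemma expect_large_error (eta : R) : 0 < eta ->
  expect (iid F n) \1_([set c | eta < err1 c + err2 c]) <= (C1 + C2) * delta / eta.
Proof.
move=> eta0.
have m12 := bmeasD merr1 merr2.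
have e0 c : 0 <= err1 c + err2 c by rewrite addr_ge0 ?err1_ge0 ?err2_ge0.
apply: (le_trans (mean_markov EM eta0 m12 e0)).
rewrite ler_wpM2r ?invr_ge0 ?(ltW eta0)// (meanD EM)// mulrDl.
exact: lerD Eerr1 Eerr2.
Qed.

Lemma small_error (eta : R) c : ~ (eta < err1 c + err2 c) -> err1 c <= eta /\ err2 c <= eta.
Proof.
move/negP; rewrite -leNgt => h; split; apply: le_trans h.
  by rewrite lerDl err2_ge0.
by rewrite lerDr err1_ge0.
Qed.

Let Y (c : T) := lam * \sum_i q i * dpsi mu (tnth c i).

Let mcoord (f : measurableTypeR R -> R) i : bmeas f -> bmeas (fun c : T => f (tnth c i)).
Proof. exact: (bmeas_comp_measurable (measurable_tnth (T := measurableTypeR R) i)). Qed.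

Let mdpsi : bmeas (dpsi mu : measurableTypeR R -> R).
Proof. exact: bmeas_dpsi. Qed.

Let mY : bmeas Y.
Proof. by apply: bmeasZ; apply: bmeas_sum => i; apply: bmeasZ; exact: mcoord. Qed.

Let Ycenter c : is_center mu A q lam c (Y c). Proof. by left. Qed.

Let tau_le1 : tau <= 1.
Proof.
apply: (mean_le_cst (expect_mean F)) => // x.
by rewrite -real_normK ?num_real// exprn_ile1// dpsi_norm.
Qed.

(** Stein's estimate for an i.i.d. sum: the weights are [lam * q i], both [x i] and [xi i] are
    [psi' (c_i)], and the linearization error is 0. *)
Lemma field_charfun t phi :
  `|expect (iid F n) (fun c => cos (t * Y c + phi)) -
    cos phi * expR (- (lam ^+ 2 * tau * t ^+ 2 / 2))| <=
  `|t| * (0 + `|t| * (2 * lam ^+ 2 * delta) + 2 * `|1| * t ^+ 2 * (`|lam| ^+ 3 * delta)).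
Proof.
pose x i (c : T) := dpsi mu (tnth c i).
have mx i : bmeas (x i) by exact: mcoord.
have x1 i c : `|x i c| <= 1 by exact: dpsi_norm.
apply: (stein_charfun EM mY (q := fun i => lam * q i) (x := x) (xi := x)) => //.
- by move=> i c; rewrite (le_trans (x1 i c))// ler1n.
- move=> i s ph; apply: (expect_iid_centered (h := fun c : T =>
    sin (s * (Y c - lam * q i * x i c) + ph)) mdpsi F0).
  + apply: bmeas_sin; apply: measurable_funD => //; apply: measurable_funM => //.
    have [] : bmeas (fun c : T => Y c - lam * q i * x i c) by exact: bmeasB mY (bmeasZ _ (mx i)).
    by [].
  + have indep := @indep_of_linear_rest _ (measurableTypeR R) R n i q (dpsi mu) lam.
    by move=> c z; exact: (congr1 (fun r => sin (s * r + ph)) (indep c z)).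
- have -> : (fun c : T => `|Y c - 1 * \sum_i lam * q i * x i c|) = fun=> 0; last first.
    by rewrite (mean_cst EM).
  apply/funext => c; rewrite mul1r /Y mulr_sumr -sumrB big1 ?normr0// => i _.
  by rewrite mulrA subrr.
- pose z v := dpsi mu v ^+ 2 - tau.
  have mz : bmeas (z : measurableTypeR R -> R) by apply: bmeasB => //; exact: bmeas_cst.
  have z1 v : `|z v| <= 1.
    have := dpsi_norm hmu v; have := mean_sqr_dpsi_ge0; have := tau_le1.
    have := sqr_ge0 (dpsi mu v); rewrite /z -(real_normK (num_real (dpsi mu v))).
    move=> d0 t1 t0 d1; have := exprn_ile1 2 (normr_ge0 (dpsi mu v)) d1.
    by move: d0; move: (_ ^+ 2) => w *; rewrite ler_norml; apply/andP; split; lra.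
  have z0 : expect F z = 0.
    rewrite (meanB (expect_mean F))//; last exact: bmeas_cst.
    by rewrite (mean_cst (expect_mean F)) subrr.
  pose S (c : T) := \sum_i q i ^+ 2 * z (tnth c i).
  have mS : bmeas S by apply: bmeas_sum => i; apply: bmeasZ; exact: mcoord.
  have ES : expect (iid F n) (fun c => S c ^+ 2) <= delta ^+ 2.
    apply: (le_trans (expect_iid_sum_sqr (fun i => q i ^+ 2) mz z1 z0)).
    rewrite -[leRHS]mulr1 -q1 mulr_sumr ler_sum// => i _.
    rewrite -exprM (exprD _ 2 2) ler_wpM2r ?sqr_ge0// -real_normK ?num_real//.
    by rewrite lerXn2r ?nnegrE ?(ltW delta0)// (regular_max reg).
  rewrite (_ : (fun c => _) = fun c => lam ^+ 2 * `|S c|).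
    have mS2 := bmeasX 2 mS.
    rewrite (meanZ EM); last exact: bmeas_norm.
    rewrite [leRHS]mulrAC [leRHS]mulrC ler_wpM2l ?sqr_ge0//.
    apply: (@le_trans _ _ (expect (iid F n) (fun c => delta + delta^-1 * S c ^+ 2))).
      apply: (mean_le EM) => [| |c]; first exact: bmeas_norm.
        by apply: bmeasD; [exact: bmeas_cst|exact: bmeasZ].
      by rewrite [_^-1 * _]mulrC normr_le_sqr.
    rewrite (meanD EM); [|exact: bmeas_cst|exact: bmeasZ].
    rewrite (mean_cst EM) (meanZ EM)// [leRHS]mulrDl mul1r lerD2l.
    rewrite mulrC ler_pdivrMr// -expr2; exact: ES.
  apply/funext => c; rewrite mul1r -[lam ^+ 2 in RHS]ger0_norm ?sqr_ge0// -normrM.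
  congr `|_|; rewrite /S /z mulr_sumr.
  rewrite -[tau in LHS]mulr1 -q1 !mulr_sumr -sumrB; apply: eq_bigr => i _.
  by rewrite /x exprMn; move: (dpsi mu _) => w; ring.
- under eq_bigr do rewrite normrM exprMn.
  by rewrite -mulr_sumr ler_wpM2l// exprn_ge0.
- by rewrite mulr_ge0 ?sqr_ge0 ?mean_sqr_dpsi_ge0.
- by rewrite mulr_ge0 ?(ltW delta0)// mulr_ge0 ?sqr_ge0.
- by rewrite mulr_ge0 ?(ltW delta0)// exprn_ge0.
Qed.

Definition averaged_mean (f : T -> R) : R :=
  expect (iid F n) (fun c => gibbs_mean mu A c f).

Lemma bmeas_averaged (f : T -> R) : bmeas f ->
  bmeas (fun c : T => gibbs_mean mu A c f).
Proof.
move=> mf; apply: (bmeas_gibbs_mean mu A (iid F n) (f := fun x : T * T => f x.2)).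
exact: (bmeas_comp_measurable (X := snd : T * T -> T) measurable_snd mf).
Qed.

Lemma averaged_meanP : is_mean averaged_mean.
Proof.
split.
- move=> f g mf mg; rewrite /averaged_mean -(meanD EM); [|exact: bmeas_averaged|exact: bmeas_averaged].
  by congr expect; apply/funext => c; rewrite (meanD (GM c)).
- move=> r f mf; rewrite /averaged_mean -(meanZ EM); last exact: bmeas_averaged.
  by congr expect; apply/funext => c; rewrite (meanZ (GM c)).
- move=> f g mf mg fg; apply: (mean_le EM); try exact: bmeas_averaged.
  by move=> c; exact: (mean_le (GM c)).
- transitivity (expect (iid F n) (fun=> 1)); last exact: mean_cst EM 1.
  by congr expect; apply/funext => c; exact: (mean_cst (GM c)).
Qed.

Let m2 (f : T -> R) : bmeas f -> bmeas (fun x : T * T => f x.2).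
Proof. exact: (bmeas_comp_measurable (X := snd : T * T -> T) measurable_snd). Qed.
Let m1 (f : T -> R) : bmeas f -> bmeas (fun x : T * T => f x.1).
Proof. exact: (bmeas_comp_measurable (X := fst : T * T -> T) measurable_fst). Qed.

(** Given the field, [t * linear_stat] is [t] times the centred statistic plus [t * Y c]. Taking
    [t * Y c + phi] as the phase in the conditional estimate factors out a Gaussian term, and the
    remaining cosine of [Y] is handled by [field_charfun]. *)
Lemma averaged_charfun (W : R) t phi : `|t| <= W ->
  `|averaged_mean (fun s => cos (t * linear_stat s + phi)) -
    cos phi * expR (- ((lam * kappa + lam ^+ 2 * tau) * t ^+ 2 / 2))| <=
  (W * (C1 + W * C2 + 2 * `|lam| * W ^+ 2) +
   W * (W * (2 * lam ^+ 2) + 2 * W ^+ 2 * `|lam| ^+ 3)) * delta.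
Proof.
move=> tW; have W0 : 0 <= W by exact: le_trans tW.
have t2 : t ^+ 2 <= W ^+ 2 by rewrite -real_normK ?num_real// lerXn2r ?nnegrE.
have d0 := ltW delta0.
pose e1 := expR (- (lam * kappa * t ^+ 2 / 2)).
pose e2 := expR (- (lam ^+ 2 * tau * t ^+ 2 / 2)).
have -> : expR (- ((lam * kappa + lam ^+ 2 * tau) * t ^+ 2 / 2)) = e1 * e2.
  by rewrite -expRD; congr expR; ring.
have e10 : 0 <= e1 by exact: expR_ge0.
have e11 : e1 <= 1.
  rewrite -[leRHS]expR0 ler_expR oppr_le0 divr_ge0//.
  by apply: mulr_ge0; [exact: ltW|exact: sqr_ge0].
pose h c := cos (t * Y c + phi).
have mh : bmeas h by apply: bmeas_cos; apply: measurable_funD => //; apply: measurable_funM => //; exact: mY.1.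
have mcos : bmeas (fun s : T => cos (t * linear_stat s + phi)).
  by apply: bmeas_cos; apply: measurable_funD => //; apply: measurable_funM => //; exact: bmeas_linear.1.
have mav := bmeas_averaged mcos.
rewrite -(subrKA (e1 * expect (iid F n) h)) (le_trans (ler_normD _ _))// mulrDl; apply: lerD.
  rewrite -(meanZ EM)// -(meanB EM)//; last exact: bmeasZ.
  pose S3 := \sum_i `|q i| ^+ 3.
  pose B (c : T) := W * (err1 c + W * err2 c + 2 * `|lam| * W ^+ 2 * S3).
  have mB12 : bmeas (fun c => err1 c + W * err2 c) by apply: bmeasD => //; exact: bmeasZ.
  have mB : bmeas B by apply: bmeasZ; apply: bmeasD => //; exact: bmeas_cst.
  apply: (@le_trans _ _ (expect (iid F n) B)).
    apply: (mean_norm_le EM) => // [|c]; first by apply: bmeasB => //; exact: bmeasZ.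
    have s0 : 0 <= S3 by apply: sumr_ge0 => i _; rewrite exprn_ge0.
    have := gibbs_charfun hmu cA rho0 rho1 a0 Arow Asqr delta0 K0 q1 (ltW lamkappa0) t (t * Y c + phi) (Ycenter c).
    rewrite -/e1 -/(h c) [h c * e1]mulrC (_ : gibbs_mean mu A c _ =
      gibbs_mean mu A c (fun s => cos (t * linear_stat s + phi))); last first.
      congr gibbs_mean; apply/funext => s; congr cos; rewrite -/(linear_stat s).
      by move: (linear_stat s) (Y c) => z y; ring.
    move/le_trans; apply; rewrite -/S3 /B; apply: ler_pM => //.
      apply: addr_ge0; first by rewrite addr_ge0 ?err1_ge0// mulr_ge0// err2_ge0.
      by apply: mulr_ge0 => //; apply: mulr_ge0; [exact: mulr_ge0|exact: sqr_ge0].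
    rewrite lerD//; first by rewrite lerD2l ler_wpM2r// err2_ge0.
    by rewrite ler_wpM2r// ler_wpM2l// mulr_ge0.
  rewrite /B (meanZ EM); last by apply: bmeasD => //; exact: bmeas_cst.
  rewrite (meanD EM mB12 (bmeas_cst _ _)) (meanD EM merr1 (bmeasZ _ merr2)) (meanZ EM _ merr2) (mean_cst EM).
  rewrite -[leRHS]mulrA ler_wpM2l// [leRHS]mulrDl [X in _ <= X + _]mulrDl; apply: lerD; first apply: lerD => //.
    by rewrite -mulrA ler_wpM2l.
  by rewrite ler_wpM2l// !mulr_ge0// sqr_ge0.
rewrite mulrCA -mulrBr normrM (ger0_norm e10) -[leRHS]mul1r; apply: ler_pM => //.
apply: (le_trans (field_charfun t phi)).
rewrite add0r normr1 mulr1 -[leRHS]mulrA; apply: ler_pM => //.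
  rewrite addr_ge0// mulr_ge0//.
  - by rewrite mulr_ge0// mulr_ge0// sqr_ge0.
  - by rewrite mulr_ge0// sqr_ge0.
  - by rewrite mulr_ge0// exprn_ge0.
rewrite [leRHS]mulrDl; apply: lerD.
  by rewrite -[leRHS]mulrA ler_wpM2r// mulr_ge0// mulr_ge0// sqr_ge0.
rewrite -[leRHS]mulrA ler_wpM2r//; first by rewrite mulr_ge0// exprn_ge0.
by rewrite ler_wpM2l.
Qed.

Lemma averaged_moment :
  averaged_mean (fun s => `|linear_stat s|) <= C1 * delta + 8 * `|lam|.
Proof.
have mA := bmeas_averaged (bmeas_norm bmeas_linear).
have mLY c : bmeas (fun s : T => linear_stat s - Y c).
  exact: bmeasB bmeas_linear (bmeas_cst _ _).
have mLYn c := bmeas_norm (mLY c).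
have mYn := bmeas_norm mY.
apply: (@le_trans _ _ (expect (iid F n) (fun c => err1 c + (7 * `|lam| + `|Y c|)))).
  apply: (mean_le EM mA) => [|c].
    exact: bmeasD merr1 (bmeasD (bmeas_cst _ _) mYn).
  rewrite addrA -lerBlDr; apply: le_trans (conditional_moment (Ycenter c)).
  rewrite lerBlDr -[X in _ + X](mean_cst (GM c)) -(meanD (GM c) (mLYn c) (bmeas_cst _ _)).
  apply: (mean_le (GM c) (bmeas_norm bmeas_linear)) => [|s].
    exact: bmeasD (mLYn c) (bmeas_cst _ _).
  by rewrite -[X in `|X| <= _](subrK (Y c)) ler_normD.
have mr : bmeas (fun c : T => 7 * `|lam| + `|Y c|) by exact: bmeasD (bmeas_cst _ _) mYn.
rewrite (meanD EM merr1 mr) (meanD EM (bmeas_cst _ _) mYn) (mean_cst EM).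
apply: lerD; first exact: Eerr1.
rewrite [8 * _](_ : _ = 7 * `|lam| + `|lam|) ?lerD2l; last by ring.
rewrite -sqrtr_sqr; apply: (mean_abs_le_sqrt EM (sqr_ge0 _) mY).
rewrite (_ : (fun c => _) = fun c : T => lam ^+ 2 * (\sum_i q i * dpsi mu (tnth c i)) ^+ 2).
  rewrite (meanZ EM); last first.
    by apply: bmeasX; apply: bmeas_sum => i; apply: bmeasZ; exact: mcoord.
  rewrite ler_piMr ?sqr_ge0// -q1; apply: expect_iid_sum_sqr => //; exact: dpsi_norm.
by apply/funext => c; rewrite exprMn.
Qed.

End fixed_coupling.

End uniform_limit.

(** The frequency range and tolerance depend only on [V], [C] and [eps], hence the uniformity below;
    the moment bound [C] controls the tails by Markov. *)
Lemma gaussian_continuity_theorem (R : realType) (V C eps : R) :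
  0 < V -> 0 <= C -> 0 < eps -> exists W eta : R, [/\ 0 <= W, 0 < eta &
  forall d (T : measurableType d) (L : (T -> R) -> R) (X : T -> R),
    is_mean L -> bmeas X -> L (fun x => `|X x|) <= C ->
    (forall t phi : R, `|t| <= W -> `|L (fun x => cos (t * X x + phi)) -
      cos phi * expR (- (V * t ^+ 2 / 2))| <= eta) ->
    forall t : R, `|L (fun x => \1_(`]-oo, t]%classic) (X x)) -
      cdf_of (gaussian_mean V) t| <= eps].
Proof.
move=> V0 C0 eps0; pose e := eps / 6; have e0 : 0 < e by rewrite divr_gt0.
have [h h0 anti] := gaussian_anticoncentration V0 e0.
have [N tailN] := gaussian_tail V e0.
pose M := Num.max (8 * h) (2 * Num.max N (1 + C / e)).
have M2 : Num.max N (1 + C / e) <= M / 2.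
  by rewrite ler_pdivlMr// mulrC le_max lexx orbT.
have NM : N <= M / 2 by apply: le_trans M2; rewrite le_max lexx.
have CM : 1 + C / e <= M / 2 by apply: le_trans M2; rewrite le_max lexx orbT.
have hM : 8 * h <= M by rewrite le_max lexx.
have [W [eta [eta0 close]]] :=
  continuity_theorem (gaussian_meanP V) e0 h0 hM anti (tailN _ NM).
exists `|W|, eta; split=> // d T L X LM mX LX char t.
have M0 : 0 < M / 2 by apply: lt_le_trans CM; rewrite ltr_pwDl// divr_ge0// ltW.
have -> : eps = 6 * e by rewrite /e; field.
apply: (close (fun f => L (fun x => f (X x)))).
- exact: (mean_pushforward LM (mX.1 : measurable_fun [set: T] (X : T -> measurableTypeR R))).
- apply: (le_trans (tail_pushforward LM M0 mX)).
  rewrite ler_pdivrMr// (le_trans LX)// -ler_pdivrMl// mulrC.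
  by apply: le_trans CM; rewrite lerDr.
- move=> s phi sW; rewrite gaussian_charfun//; apply: char.
  exact: le_trans sW (ler_norm _).
Qed.

Section uniform_limit_theorems.
Context (R : realType) (mu F : probability (measurableTypeR R) R).
Hypothesis hmu : base_measure mu.
Hypothesis F0 : expect F (dpsi mu) = 0.
Local Notation kappa := (mean_ddpsi mu F).
Local Notation tau := (mean_sqr_dpsi mu F).
Variables (rho lam : R).
Hypotheses (rho0 : 0 < rho) (rho1 : rho < 1) (lamkappa0 : 0 < lam * kappa).
Let C1 := linear_constant rho lam.
Let C2 := variance_constant rho lam.

Let C10 : 0 <= C1. Proof. by have [] := constants_ge0 rho1 lam. Qed.
Let C20 : 0 <= C2. Proof. by have [] := constants_ge0 rho1 lam. Qed.

Let linear_stat n (q : 'I_n -> R) (s : n.-tuple (measurableTypeR R)) : R :=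
  \sum_i q i * tnth (spins s) i.

Let bmeas_linear n (q : 'I_n -> R) : bmeas (linear_stat q).
Proof. by apply: bmeas_sum => i; apply: bmeasZ; exact: bmeas_spin. Qed.

(** Off the set where [err_linear + err_variance] is large, which is rare by Markov, the continuity
    theorem applies. This set depends neither on the centre nor on [t]. *)
Lemma conditional_limit (eps : R) : 0 < eps -> exists2 delta0 : R, 0 < delta0 <= 1 &
  forall (delta a : R) n (A : 'M[R]_n) (q : 'I_n -> R), 0 < delta <= delta0 ->
    regular_coupling mu F rho lam delta a A q ->
  exists B : set (n.-tuple (measurableTypeR R)),
    [/\ measurable B, (iid F n B <= eps%:E)%E & forall c, ~ B c ->
      forall y, is_center mu A q lam c y -> forall t : R,
      `|gibbs_mean mu A c (fun s => \1_(`]-oo, t]%classic)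
          (\sum_i q i * tnth (spins s) i - y)) -
        cdf_of (gaussian_mean (lam * kappa)) t| <= eps].
Proof.
move=> eps0.
have l7 : 0 <= 1 + 7 * `|lam| by rewrite addr_ge0// mulr_ge0.
have [W [eta [W0 eta0 close]]] := gaussian_continuity_theorem lamkappa0 l7 eps0.
pose CE := charfun_error lam W.
have CE0 : 0 <= CE.
  apply: mulr_ge0 => //; apply: addr_ge0; first exact: addr_ge0.
  by apply: mulr_ge0; [exact: mulr_ge0|exact: sqr_ge0].
(* The cap 1 keeps the absolute moment below [1 + 7 * |lam|], the bound fixed before [W] and [eta]
   were obtained. *)
pose eta1 := Num.min 1 (eta / (1 + CE)).
have CE1 : 0 < 1 + CE by rewrite ltr_pwDl.
have e10 : 0 < eta1 by rewrite lt_min ltr01 divr_gt0.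
have e11 : eta1 <= 1 by rewrite ge_min lexx.
have e1e : CE * eta1 <= eta.
  apply: (@le_trans _ _ ((1 + CE) * (eta / (1 + CE)))); last first.
    by rewrite mulrC divfK// gt_eqF.
  by apply: ler_pM => //; [exact: ltW|rewrite lerDr|rewrite ge_min lexx orbT].
have C12 : 0 < 1 + (C1 + C2) by rewrite ltr_pwDl// addr_ge0.
exists (Num.min eta1 (eps * eta1 / (1 + (C1 + C2)))).
  by rewrite lt_min e10 divr_gt0 ?mulr_gt0//= ge_min e11.
move=> delta a n A q /andP[d0]; rewrite le_min => /andP[de dC] reg.
have d1 : delta <= 1 by exact: le_trans de e11.
pose K := n%:R * a / delta.
pose err1 := err_linear mu A rho a q lam delta K.
pose err2 := err_variance mu A q lam kappa delta.
have m12 := bmeasD (bmeas_err_linear F hmu A rho a q lam delta)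
  (bmeas_err_variance F hmu A q lam delta).
exists [set c | eta1 < err1 c + err2 c].
have mB : measurable [set c : n.-tuple (measurableTypeR R) | eta1 < err1 c + err2 c].
  rewrite -[X in measurable X]setTI.
  have := m12.1 measurableT `]eta1, +oo[%classic (measurable_itv _).
  by congr measurable; apply/seteqP; split=> x /=; rewrite in_itv/= andbT.
split=> //.
  rewrite -[iid F n _]fineK; last first.
    by rewrite ge0_fin_numE// (le_lt_trans (probability_le1 _ mB))// ltry.
  rewrite lee_fin -expect_indic//.
  apply: (le_trans (expect_large_error hmu F0 rho0 rho1 d0 d1 reg e10)).
  rewrite ler_pdivrMr//.
  apply: (@le_trans _ _ ((1 + (C1 + C2)) * (eps * eta1 / (1 + (C1 + C2))))).
    by apply: ler_pM => //; [exact: addr_ge0|exact: ltW|rewrite lerDr].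
  by rewrite mulrC divfK// gt_eqF.
move=> c cB y cy t.
have [E1 E2] := small_error hmu rho0 rho1 d0 reg cB.
have mX : bmeas (fun s => linear_stat q s - y).
  exact: bmeasB (bmeas_linear q) (bmeas_cst _ _).
apply: (close _ _ (gibbs_mean mu A c) _ (gibbs_meanP mu A c) mX).
  apply: (le_trans (conditional_moment hmu rho0 rho1 d0 reg cy)).
  by rewrite lerD2r (le_trans E1).
move=> s phi sW; apply: le_trans e1e.
exact: (conditional_charfun hmu rho0 rho1 lamkappa0 d0 reg phi cy E1 E2 de sW).
Qed.

Lemma averaged_limit (eps : R) : 0 < eps -> exists2 delta0 : R, 0 < delta0 <= 1 &
  forall (delta a : R) n (A : 'M[R]_n) (q : 'I_n -> R), 0 < delta <= delta0 ->
    regular_coupling mu F rho lam delta a A q -> forall t : R,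
  `|averaged_mean mu F A (fun s => \1_(`]-oo, t]%classic) (\sum_i q i * tnth (spins s) i)) -
    cdf_of (gaussian_mean (lam * kappa + lam ^+ 2 * tau)) t| <= eps.
Proof.
move=> eps0.
have V0 : 0 < lam * kappa + lam ^+ 2 * tau.
  by rewrite ltr_pwDl// mulr_ge0 ?sqr_ge0 ?mean_sqr_dpsi_ge0.
have l8 : 0 <= C1 + 8 * `|lam| by rewrite addr_ge0// mulr_ge0.
have [W [eta [W0 eta0 close]]] := gaussian_continuity_theorem V0 l8 eps0.
pose CE := W * (C1 + W * C2 + 2 * `|lam| * W ^+ 2) +
   W * (W * (2 * lam ^+ 2) + 2 * W ^+ 2 * `|lam| ^+ 3).
have CE0 : 0 <= CE.
  have W2 : 0 <= W ^+ 2 := sqr_ge0 W; have l2 : 0 <= lam ^+ 2 := sqr_ge0 lam.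
  have l3 : 0 <= `|lam| ^+ 3 by rewrite exprn_ge0.
  have l1 := normr_ge0 lam; have c10 : 0 <= C1 := C10.
  have p1 := mulr_ge0 W0 C20; have p2 := mulr_ge0 l1 W2.
  have p3 := mulr_ge0 W0 l2; have p4 := mulr_ge0 W2 l3.
  by apply: addr_ge0; apply: mulr_ge0 => //; lra.
have CE1 : 0 < 1 + CE by rewrite ltr_pwDl.
exists (Num.min 1 (eta / (1 + CE))).
  by rewrite lt_min ltr01 divr_gt0//= ge_min lexx.
move=> delta a n A q /andP[d0]; rewrite le_min => /andP[d1 dC] reg t.
apply: (close _ _ (averaged_mean mu F A) _ (averaged_meanP mu F A) (bmeas_linear q)).
  apply: (le_trans (averaged_moment hmu F0 rho0 rho1 d0 d1 reg)).
  by rewrite lerD2r ler_piMr.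
move=> s phi sW.
apply: (le_trans (averaged_charfun hmu F0 rho0 rho1 lamkappa0 d0 d1 reg phi sW)).
apply: (@le_trans _ _ ((1 + CE) * (eta / (1 + CE)))); last first.
  by rewrite mulrC divfK// gt_eqF.
by apply: ler_pM => //; [exact: ltW|rewrite lerDr].
Qed.

End uniform_limit_theorems.

(** * Edges of the random graph *)

Section discrete_tuples.
Context (R : realType).

Lemma bmeas_prod d (T : measurableType d) (I : Type) (r : seq I) (f : I -> T -> R) :
  (forall i, bmeas (f i)) -> bmeas (fun x => \prod_(i <- r) f i x).
Proof.
move=> mf; elim: r => [|i r IH].
  by under eq_fun do rewrite big_nil; exact: bmeas_cst.
by under eq_fun do rewrite big_cons; exact: bmeasM.
Qed.

(** The sigma-algebra on tuples is generated by the coordinates. Once points are measurable, every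
    function on the finite set of graphs is a finite combination of point indicators. *)
Definition measurable_points d (T : measurableType d) :=
  forall s : T, bmeas (fun x : T => `[< x = s >]%:R : R).

Lemma bmeas_bool (f : bool -> R) : bmeas f.
Proof.
split; first by move=> _ B mB.
by exists (`|f true| + `|f false|) => -[]; rewrite ?lerDl ?lerDr.
Qed.

Lemma measurable_points_tuple d (T : measurableType d) n :
  measurable_points T -> measurable_points (n.-tuple T).
Proof.
move=> mT s; rewrite (_ : (fun x => _) = fun x : n.-tuple T =>
    \prod_i `[< tnth x i = tnth s i >]%:R).
  apply: bmeas_prod => i.
  exact: (bmeas_comp_measurable (measurable_tnth (T := T) i) (mT (tnth s i))).
apply/funext => x; case: asboolP => [->|xs].
  by rewrite big1// => i _; rewrite asboolT.
have [i xi] : exists i, tnth x i <> tnth s i.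
  apply: contrapT => nx; apply: xs; apply: eq_from_tnth => i.
  by apply: contrapT => xi; apply: nx; exists i.
by rewrite (bigD1 i)//= asboolF// mul0r.
Qed.

Lemma bmeas_graph n (f : n.-tuple (n.-tuple bool) -> R) : bmeas f.
Proof.
have mp : measurable_points (n.-tuple (n.-tuple bool)).
  do 2 apply: measurable_points_tuple.
  by move=> b; exact: bmeas_bool.
rewrite (_ : f = fun w => \sum_(s : n.-tuple (n.-tuple bool)) f s * `[< w = s >]%:R).
  by apply: bmeas_sum => s; apply: bmeasZ; exact: mp.
apply/funext => w; rewrite (bigD1 w)//= asboolT// mulr1 big1 ?addr0// => s sw.
by rewrite asboolF ?mulr0// => ws; rewrite ws eqxx in sw.
Qed.

End discrete_tuples.

Section erdos_renyi_edges.
Context (R : realType) (p : R).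
Hypothesis p01 : 0 <= p <= 1.
Variable n : nat.
Local Notation W := (n.-tuple (n.-tuple bool)).
Local Notation B := (bernoulli_prob p).
Local Notation E := (expect (erdos_renyi n p)).
Let EM := expect_mean (erdos_renyi n p).

Lemma expect_bernoulli (f : bool -> R) : expect B f = p * f true + (1 - p) * f false.
Proof.
have mi (A : set bool) : bmeas (\1_A : bool -> R) by exact: bmeas_bool.
have tt1 : (true \in [set true]) = true by rewrite mem_set.
have tf : (true \in [set false]) = false by rewrite memNset.
have ft : (false \in [set true]) = false by rewrite memNset.
have ff : (false \in [set false]) = true by rewrite mem_set.
rewrite (_ : f = fun b => f true * \1_[set true] b + f false * \1_[set false] b).
  have EB := expect_mean B.
  rewrite (meanD EB) ?(meanZ EB)//; try exact: bmeasZ.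
  have EE (A : set bool) : expect B \1_A = fine (bernoulli_prob p A) by exact: expect_indic.
  rewrite !EE !bernoulli_probE// !diracE.
  rewrite !indicE tt1 tf ft ff.
  by rewrite !mule0 !mule1 adde0 add0e /= /unstable.onem; ring.
by apply/funext => -[]; rewrite !indicE ?tt1 ?tf ?ft ?ff mulr1 mulr0 ?addr0 ?add0r.
Qed.

(** Overwrites the one coin that decides the edge, the entry above the diagonal, whatever the order
    of [i] and [j]. *)
Definition set_edge (w : W) (i j : 'I_n) (z : bool) : W :=
  if (i < j)%N then upd w i (upd (tnth w i) j z)
  else upd w j (upd (tnth w j) i z).

Lemma edge_set_edge w i j z k l : i != j ->
  edge (set_edge w i j z) k l =
  if (k == i) && (l == j) || (k == j) && (l == i) then z else edge w k l.
Proof.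
wlog ij : i j / (i < j)%N => [H ij|ij'].
  have := ij; rewrite -val_eqE neq_ltn => /orP[lt|lt]; first exact: H.
  rewrite (_ : set_edge w i j z = set_edge w j i z); last first.
    by rewrite /set_edge lt ltnNge ltnW.
  by rewrite H// 1?eq_sym// orbC.
have ijF : (i == j) = false by exact/negbTE.
rewrite /set_edge ij /edge !tnth_upd.
case: ltnP => kl.
  case: (eqVneq k i) => [->|ki] /=.
    rewrite tnth_upd ijF/= orbF; case: eqP => //.
  case: (eqVneq k j) => [kj|//] /=; case: eqP => [li|//].
  by move: kl; rewrite kj li ltnNge ltnW.
case: ltnP => lk.
  case: (eqVneq l i) => [->|li] /=.
    rewrite tnth_upd ijF andbF andbT/=; case: eqP => //.
  rewrite andbF orbF; case: (eqVneq k i) => [ki|//] /=; case: eqP => [lj|//].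
  by move: lk; rewrite ki lj ltnNge ltnW.
have kl' : k = l by apply/val_inj/eqP; rewrite eqn_leq kl lk.
rewrite kl'; case: (eqVneq l i) => [->|li] /=; first by rewrite ijF.
by rewrite andbF.
Qed.

Lemma set_edgeC w i j : i != j -> set_edge w i j = set_edge w j i.
Proof.
rewrite -val_eqE neq_ltn /set_edge => ij; apply/funext => z.
by case: ltngtP ij.
Qed.

Let expect_edge_resample_lt (i j : 'I_n) (f : W -> R) : (i < j)%N ->
  E f = E (fun w => expect B (fun z => f (set_edge w i j z))).
Proof.
move=> lt; rewrite (expect_resample (iid B n) i (bmeas_graph f)).
rewrite [RHS](expect_resample (iid B n) i (bmeas_graph _)).
congr expect; apply/funext => w.
have mf : bmeas (fun r : n.-tuple bool => f (upd w i r)).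
  exact: bmeas_upd (bmeas_graph f).
rewrite (expect_resample _ j mf); congr expect; apply/funext => r.
congr expect; apply/funext => z; congr f; rewrite /set_edge lt.
apply: eq_from_tnth => k; rewrite !tnth_upd; case: eqP => // _.
by rewrite eqxx.
Qed.

Lemma expect_edge_resample i j (f : W -> R) : i != j ->
  E f = E (fun w => expect B (fun z => f (set_edge w i j z))).
Proof.
move=> ij; have := ij; rewrite -val_eqE neq_ltn => /orP[lt|lt].
  exact: expect_edge_resample_lt.
have -> : (fun w => expect B (fun z => f (set_edge w i j z))) =
    fun w => expect B (fun z => f (set_edge w j i z)).
  by apply/funext => w; rewrite set_edgeC.
exact: expect_edge_resample_lt.
Qed.

Lemma expect_edge_indep i j (g : bool -> R) (h : W -> R) : i != j ->
  (forall w z, h (set_edge w i j z) = h w) ->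
  E (fun w => g (edge w i j) * h w) = expect B g * E h.
Proof.
move=> ij hh; rewrite (expect_edge_resample _ ij).
rewrite -(meanZ EM); last exact: bmeas_graph.
congr expect; apply/funext => w; rewrite mulrC -(meanZ (expect_mean B)); last exact: bmeas_bool.
congr expect; apply/funext => z.
by rewrite hh edge_set_edge// !eqxx/= mulrC.
Qed.

Lemma edge_sym (w : W) i j : edge w i j = edge w j i.
Proof.
rewrite /edge; case: ltngtP => // /val_inj ->; by rewrite ltnn.
Qed.

Lemma edge_irrefl (w : W) i : edge w i i = false.
Proof. by rewrite /edge ltnn. Qed.

Lemma edge_set_other w i j k l z : i != j ->
  ~~ ((k == i) && (l == j) || (k == j) && (l == i)) ->
  edge (set_edge w i j z) k l = edge w k l.
Proof. by move=> ij /negbTE kl; rewrite edge_set_edge// kl. Qed.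

Definition degree (w : W) (i : 'I_n) : R := \sum_j (edge w i j)%:R.

(** Edges at [i] are peeled off one by one along a list without repetition. The absent loop
    contributes 1, at most a Bernoulli factor, so the exponent may be [n]. *)
Lemma expect_degree_expR (s : R) i : 0 <= s ->
  E (fun w => expR (s * degree w i)) <= (1 + p * (expR s - 1)) ^+ n.
Proof.
move=> s0; have /andP[p0 p1] := p01.
have es : 0 <= expR s - 1 by rewrite subr_ge0 -expR0 ler_expR.
have base : 1 <= 1 + p * (expR s - 1) by rewrite lerDl mulr_ge0.
suff H (l : seq 'I_n) : uniq l ->
    E (fun w => \prod_(j <- l) expR (s * (edge w i j)%:R)) <=
    (1 + p * (expR s - 1)) ^+ size l.
  have := H (enum 'I_n) (enum_uniq _); rewrite size_enum_ord.
  under eq_fun do rewrite big_enum/= -expR_sum -mulr_sumr.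
  exact: le_trans.
elim: l => [_|j l IH /= /andP[jl ul]].
  under eq_fun do rewrite big_nil; by rewrite (mean_cst EM) expr0.
under eq_fun do rewrite big_cons.
have mono x y : 0 <= x -> 0 <= y -> x <= (1 + p * (expR s - 1)) ^+ size l ->
    y <= 1 + p * (expR s - 1) -> y * x <= (1 + p * (expR s - 1)) ^+ (size l).+1.
  by move=> x0 y0 xl yl; rewrite exprS; apply: ler_pM.
have h0 : 0 <= E (fun w => \prod_(j <- l) expR (s * (edge w i j)%:R)).
  apply: (mean_ge0 EM); first exact: bmeas_graph.
  by move=> w; apply: prodr_ge0 => k _; exact: expR_ge0.
have [ij|ij] := eqVneq i j.
  under eq_fun do rewrite -{1}ij edge_irrefl mulr0 expR0 mul1r.
  by rewrite -[X in X <= _]mul1r; apply: mono => //; exact: IH.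
rewrite (expect_edge_indep (fun z => expR (s * z%:R)) (h := fun w =>
    \prod_(j <- l) expR (s * (edge w i j)%:R)) ij); last first.
  move=> w z; rewrite !big_seq; apply: eq_bigr => k kl.
  rewrite edge_set_other// eqxx/= (negbTE ij) orbF.
  by apply: contraNneq jl => <-.
rewrite expect_bernoulli mulr1 mulr0 expR0.
have -> : p * expR s + (1 - p) * 1 = 1 + p * (expR s - 1) by ring.
by apply: mono => //; [exact: le_trans base|exact: IH].
Qed.

Definition centered_edge (w : W) i j : R := (edge w i j)%:R - p * (i != j)%:R.

Lemma expect_centered_edges_sqr (x : 'I_n -> R) j :
  E (fun w => (\sum_i x i * centered_edge w i j) ^+ 2) <= p * \sum_i x i ^+ 2.
Proof.
have /andP[p0 p1] := p01.
have cross i k : i != k -> E (fun w => centered_edge w i j * centered_edge w k j) = 0.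
  move=> ik; rewrite /centered_edge; have [->|ij] := eqVneq i j.
    under eq_fun do rewrite edge_irrefl mulr0 subr0 mul0r.
    exact: mean_cst EM _.
  rewrite (expect_edge_indep (fun z => z%:R - p * true%:R) (h := fun w => (edge w k j)%:R - p * (k != j)%:R) ij).
    by rewrite expect_bernoulli [X in X * _](_ : _ = 0) ?mul0r//=; ring.
  move=> w z; rewrite edge_set_other//.
  by rewrite [k == i]eq_sym (negbTE ik)/= [j == i]eq_sym (negbTE ij) andbF.
have diag i : E (fun w => centered_edge w i j ^+ 2) <= p.
  rewrite /centered_edge; have [->|ij] := eqVneq i j.
    under eq_fun do rewrite edge_irrefl mulr0 subr0 expr0n.
    by rewrite (mean_cst EM).
  have := expect_edge_indep (fun z => (z%:R - p * true%:R) ^+ 2) (h := fun=> 1) ij (fun _ _ => erefl).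
  rewrite (mean_cst EM) mulr1 expect_bernoulli; under eq_fun do rewrite mulr1.
  by rewrite /= => ->; have := mulr_ge0 p0 p0; lra.
rewrite (_ : (fun w => _) = fun w => \sum_i \sum_k
    (x i * x k) * (centered_edge w i j * centered_edge w k j)); last first.
  apply/funext => w; rewrite expr2 mulr_suml; apply: eq_bigr => i _.
  by rewrite mulr_sumr; apply: eq_bigr => k _; rewrite mulrACA.
rewrite (mean_sum EM); last by move=> i; exact: bmeas_graph.
rewrite mulr_sumr ler_sum// => i _.
rewrite (mean_sum EM); last by move=> k; exact: bmeas_graph.
rewrite (bigD1 i)//= big1 ?addr0 => [|k ki].
  rewrite (meanZ EM); last exact: bmeas_graph.
  by rewrite -!expr2 mulrC ler_wpM2r ?sqr_ge0//; exact: diag.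
rewrite (meanZ EM); last exact: bmeas_graph.
by rewrite cross ?mulr0// eq_sym.
Qed.

End erdos_renyi_edges.

(** * Regularity of the random coupling *)

Lemma measurable_graph (R : realType) n (A : set (n.-tuple (n.-tuple bool))) : measurable A.
Proof.
rewrite -[X in measurable X]setTI.
have [mA _] := bmeas_graph (fun w => `[< A w >]%:R : R).
have := mA measurableT `]0, +oo[%classic (measurable_itv _).
congr measurable; apply/seteqP; split=> w /=; rewrite in_itv/= andbT.
  by case: asboolP => // _; rewrite ltxx => -[].
by move=> [_ Aw]; split=> //; rewrite asboolT.
Qed.

Lemma coupling_sym_diag (R : realType) (theta p : R) n w :
  coupling_matrix (coupling theta p (n := n) w).
Proof.
by split=> i *; rewrite !mxE ?edge_irrefl ?mulr0// edge_sym.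
Qed.

Section graph_regularity.
Context (R : realType) (mu F : probability (measurableTypeR R) R).
Variables (theta : R) (n : nat) (p : R) (lam : R) (q : 'I_n -> R).
Hypotheses (theta1 : `|theta| < 1) (n0 : (0 < n)%N) (p01 : 0 < p <= 1).
Local Notation W := (n.-tuple (n.-tuple bool)).
Local Notation E := (expect (erdos_renyi n p)).
Local Notation A w := (coupling theta p (n := n) w).
Local Notation kappa := (mean_ddpsi mu F).
Let EM := expect_mean (erdos_renyi n p).

(** Midpoint of [|theta|] and 1: with [eta = (1 - |theta|) / 2], degrees up to [(1 + eta) n p] give
    row sums [|theta| (1 + eta) <= |theta| + eta]. *)
Definition row_bound : R := (1 + `|theta|) / 2.

Definition degree_constant : R := (128 / (1 - `|theta|) ^+ 2) ^+ 4.

(* The squared norm of [mean_residual] once averaged over the graph. *)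
Definition graph_bias : R :=
  \sum_j ((1 - lam) * q j + lam * kappa * theta / n%:R * (\sum_i q i - q j)) ^+ 2.

Let eta : R := (1 - `|theta|) / 2.
Let k : R := n%:R * p.
Let r : R := (Num.sqrt n%:R)^-1 / p.

Let p0 : 0 < p. Proof. by have /andP[] := p01. Qed.
Let p1 : p <= 1. Proof. by have /andP[] := p01. Qed.
Let p01' : 0 <= p <= 1. Proof. by rewrite ltW. Qed.
Let nR0 : 0 < n%:R :> R. Proof. by rewrite ltr0n. Qed.
Let k0 : 0 < k. Proof. exact: mulr_gt0. Qed.
Let eta0 : 0 < eta. Proof. by rewrite divr_gt0// subr_gt0. Qed.
Let t0 : 0 <= `|theta|. Proof. exact: normr_ge0. Qed.
Let eta1 : eta <= 1.
Proof. by rewrite ler_pdivrMr// mul1r lerBlDr (@le_trans _ _ 2) ?ler1n// lerDl. Qed.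

Let sn0 : 0 < Num.sqrt n%:R :> R. Proof. by rewrite sqrtr_gt0. Qed.
Let snE : Num.sqrt n%:R ^+ 2 = n%:R :> R. Proof. by rewrite sqr_sqrtr// ltW. Qed.

Let r2E : r ^+ 2 = (n%:R * p ^+ 2)^-1.
Proof. by rewrite /r exprMn !exprVn snE -invfM. Qed.

Lemma coupling_entry w i j : A w i j = theta / k * (edge w i j)%:R.
Proof. by rewrite !mxE. Qed.

(** Minimizes [2 s^2 - eta s], the Chernoff exponent once [expR s - 1] is bounded by [s + 2 s^2]. *)
Let s : R := eta / 4.

Let s0 : 0 < s. Proof. by rewrite divr_gt0. Qed.

Let exp_small : expR s - 1 <= s + 2 * s ^+ 2.
Proof.
have s1 : 0 < 1 - s by rewrite /s; move: eta1; lra.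
have : expR s <= (1 - s)^-1.
  by rewrite -[leLHS]invrK -expRN lef_pV2 ?posrE ?expR_gt0// expR_ge1Dx.
suff : (1 - s)^-1 <= 1 + s + 2 * s ^+ 2 by lra.
rewrite -[leLHS]mul1r ler_pdivrMr//.
have s2 := sqr_ge0 s; have half : 0 <= 1 - 2 * s by rewrite /s; move: eta1; lra.
have := mulr_ge0 s2 half; lra.
Qed.

(** Chernoff's bound, with the union over vertices inside the sum of exponentials. The exponent is
    [- x] with [x = k eta^2 / 8]; bounding [expR (- x)] by [(4 / x)^4], where [4 / x] is
    [128 / (k (1 - |theta|)^2)], absorbs the factor [n], since [n / (n p)^4 = r^4 / n]. *)
Lemma degree_tail : E \1_([set w | expR (s * ((1 + eta) * k)) <
    \sum_i expR (s * degree R w i)]) <= degree_constant * r ^+ 4.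
Proof.
have mf : bmeas (fun w : W => \sum_i expR (s * degree R w i)) by exact: bmeas_graph.
have f0 (w : W) : 0 <= \sum_i expR (s * degree R w i).
  by apply: sumr_ge0 => i _; exact: expR_ge0.
apply: (le_trans (mean_markov EM (expR_gt0 _) mf f0)).
have Ef : E (fun w => \sum_i expR (s * degree R w i)) <= n%:R * expR (k * (s + 2 * s ^+ 2)).
  rewrite (mean_sum EM); last by move=> i; exact: bmeas_graph.
  apply: (@le_trans _ _ (\sum_(i < n) expR (k * (s + 2 * s ^+ 2)))); last first.
    by rewrite sumr_const card_ord -[leLHS]mulr_natl.
  apply: ler_sum => i _; apply: (le_trans (expect_degree_expR p01' i (ltW s0))).
  have b0 : 0 <= 1 + p * (expR s - 1).
    by rewrite addr_ge0// mulr_ge0 ?(ltW p0)// subr_ge0 -expR0 ler_expR ltW.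
  apply: (@le_trans _ _ (expR (p * (s + 2 * s ^+ 2)) ^+ n)).
    rewrite lerXn2r ?nnegrE ?expR_ge0// (le_trans _ (expR_ge1Dx _))//.
    by rewrite lerD2l ler_wpM2l// ltW.
  by rewrite -expRM_natl mulrA.
rewrite -expRN; apply: (le_trans (ler_wpM2r (expR_ge0 _) Ef)).
rewrite -mulrA -expRD.
have -> : k * (s + 2 * s ^+ 2) - s * ((1 + eta) * k) = - (k * eta ^+ 2 / 8).
  by rewrite /s; field.
have exp_le (y : R) : 0 < y -> expR (- y) <= (4 / y) ^+ 4.
  move=> y0; have y4 : 0 < y / 4 by rewrite divr_gt0.
  have -> : 4 / y = (y / 4)^-1 by rewrite invf_div.
  have {1}-> : y = 4%:R * (y / 4) by field.
  rewrite expRN exprVn lef_pV2 ?posrE ?expR_gt0 ?exprn_gt0//.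
  rewrite expRM_natl lerXn2r ?nnegrE ?expR_ge0 ?(ltW y4)//.
  by rewrite (le_trans _ (expR_ge1Dx _))// lerDr.
set x := k * eta ^+ 2 / 8.
have ex : expR (- x) <= (4 / x) ^+ 4.
  by apply: exp_le; rewrite divr_gt0// mulr_gt0// exprn_gt0.
apply: (le_trans (ler_wpM2l (ltW nR0) ex)).
have -> : r ^+ 4 = (n%:R * p ^+ 2)^-1 ^+ 2 by rewrite -r2E -exprM.
pose c := 128 / (1 - `|theta|) ^+ 2.
have xE : 4 / x = c * k^-1.
  by rewrite /x /c /eta; field; rewrite !gt_eqF// subr_gt0.
have c0 : 0 <= c by apply: divr_ge0 => //; exact: sqr_ge0.
have -> : n%:R * (4 / x) ^+ 4 = degree_constant * (n%:R * p ^+ 2)^-1 ^+ 2 / n%:R.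
  rewrite xE exprMn /degree_constant -/c /k; move: (c ^+ 4) => c4; field.
  by rewrite !gt_eqF.
rewrite ler_piMr// ?invf_le1// ?ler1n//.
by apply: mulr_ge0; [exact: exprn_ge0|exact: sqr_ge0].
Qed.

(** Separates the edge fluctuation from the average over the graph; [q j] is subtracted because
    there are no loops. *)
Lemma mean_residual_graph w j : mean_residual mu F (A w) q lam j =
  lam * kappa * (theta / k) * (\sum_i q i * centered_edge p w i j) +
  ((1 - lam) * q j + lam * kappa * theta / n%:R * (\sum_i q i - q j)).
Proof.
rewrite /mean_residual addrCA; congr (_ + _).
have -> : \sum_i q i - q j = \sum_i q i * (i != j)%:R.
  rewrite (bigD1 j)//= addrAC subrr add0r [RHS](bigD1 j)//= eqxx mulr0 add0r.
  by apply: eq_bigr => i ij; rewrite ij mulr1.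
rewrite !mulr_sumr -big_split; apply: eq_bigr => i _ /=.
rewrite coupling_entry /centered_edge /k.
move: (i != j)%:R (edge w i j)%:R => e1 e2; field.
by rewrite !gt_eqF.
Qed.

Lemma expect_mean_residual_sqr : \sum_i q i ^+ 2 = 1 ->
  E (fun w => \sum_j mean_residual mu F (A w) q lam j ^+ 2) <=
  2 * (lam * kappa * theta) ^+ 2 * (p * r ^+ 2) + 2 * graph_bias.
Proof.
move=> q1; rewrite (mean_sum EM); last by move=> j; exact: bmeas_graph.
apply: (@le_trans _ _ (\sum_j (2 * (lam * kappa * (theta / k)) ^+ 2 * p +
  2 * ((1 - lam) * q j + lam * kappa * theta / n%:R * (\sum_i q i - q j)) ^+ 2))).
  apply: ler_sum => j _.
  set d := _ + _ * (_ - _); set c := lam * kappa * (theta / k).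
  pose N (w : W) := \sum_i q i * centered_edge p w i j.
  apply: (@le_trans _ _ (E (fun w => 2 * c ^+ 2 * N w ^+ 2 + 2 * d ^+ 2))).
    apply: (mean_le EM) => [| |w]; [exact: bmeas_graph|exact: bmeas_graph|].
    rewrite mean_residual_graph -/c -/d -/(N w); have := sqr_ge0 (c * N w - d); lra.
  rewrite (meanD EM); [|exact: bmeas_graph|exact: bmeas_cst].
  rewrite (mean_cst EM) lerD2r (meanZ EM); last exact: bmeas_graph.
  apply: ler_wpM2l; first by apply: mulr_ge0 => //; exact: sqr_ge0.
  by have := expect_centered_edges_sqr p01' q j; rewrite q1 mulr1.
rewrite big_split/= sumr_const card_ord -mulr_sumr -/graph_bias lerD2r -[leLHS]mulr_natl r2E /k.
rewrite le_eqVlt; apply/orP; left; apply/eqP; field.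
by rewrite !gt_eqF.
Qed.

(** Two bad events, a large degree and a large residual. The residual is multiplied by
    [1 + n a = 1 + 2 / p <= 3 / p], which turns its edge part [p r^2] into [r^2], and divides the
    bias by [p]. *)
Lemma regular_coupling_whp (delta : R) : 0 < delta -> \sum_i q i ^+ 2 = 1 ->
  (forall i, `|q i| <= delta) -> 2 * r <= delta ^+ 2 ->
  exists B : set W, (erdos_renyi n p B <= (degree_constant * r ^+ 4 +
    (6 * (lam * kappa * theta) ^+ 2 * r ^+ 2 + 6 * (graph_bias / p)) / delta ^+ 2)%:E)%E /\
  forall w, ~ B w -> regular_coupling mu F row_bound lam delta (2 / k) (A w) q.
Proof.
move=> delta0 q1 qmax rsmall.
pose f (w : W) := \sum_i expR (s * degree R w i).
pose g (w : W) := \sum_j mean_residual mu F (A w) q lam j ^+ 2.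
pose na := 1 + n%:R * (2 / k).
pose B1 := [set w : W | expR (s * ((1 + eta) * k)) < f w].
pose B2 := [set w : W | delta ^+ 2 < g w * na].
have naE : na = 1 + 2 / p by rewrite /na /k; field; rewrite !gt_eqF.
have na0 : 0 <= na by rewrite naE addr_ge0// divr_ge0// ltW.
have na3 : na <= 3 / p.
  rewrite naE (_ : 3 / p = p^-1 + 2 / p); last by field; rewrite gt_eqF.
  by rewrite lerD2r -invr1 lef_pV2 ?posrE.
have d2 : 0 < delta ^+ 2 by rewrite exprn_gt0.
have bias0 : 0 <= graph_bias by apply: sumr_ge0 => j _; exact: sqr_ge0.
exists (B1 `|` B2); split.
  have mB : measurable (B1 `|` B2) by exact: measurable_graph.
  rewrite -[X in (X <= _)%E]fineK; last first.
    by rewrite ge0_fin_numE// (le_lt_trans (probability_le1 _ mB))// ltry.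
  rewrite lee_fin -(expect_indic _ mB).
  apply: (@le_trans _ _ (E (fun w => \1_B1 w + \1_B2 w))).
    apply: (mean_le EM) => [| |w]; [exact: bmeas_graph|exact: bmeas_graph|].
    rewrite !indicE -natrD ler_nat in_setU.
    by case: (w \in B1); case: (w \in B2).
  rewrite (meanD EM); [|exact: bmeas_graph|exact: bmeas_graph].
  apply: lerD; first exact: degree_tail.
  have gn0 w : 0 <= g w * na.
    by apply: mulr_ge0 => //; apply: sumr_ge0 => j _; exact: sqr_ge0.
  apply: (le_trans (mean_markov EM d2 (bmeas_graph _) gn0)).
  rewrite ler_wpM2r ?invr_ge0 ?(ltW d2)//.
  under eq_fun do rewrite mulrC.
  rewrite (meanZ EM); last exact: bmeas_graph.
  apply: (le_trans (ler_wpM2l na0 (expect_mean_residual_sqr q1))).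
  have r20 : 0 <= p * r ^+ 2 by apply: mulr_ge0; [exact: ltW|exact: sqr_ge0].
  apply: (@le_trans _ _ (3 / p * (2 * (lam * kappa * theta) ^+ 2 * (p * r ^+ 2) + 2 * graph_bias))).
    apply: ler_wpM2r na3; apply: addr_ge0; last exact: mulr_ge0.
    by apply: mulr_ge0 => //; apply: mulr_ge0 => //; exact: sqr_ge0.
  rewrite le_eqVlt; apply/orP; left; apply/eqP; field.
  by rewrite gt_eqF.
move=> w /not_orP[/negP + /negP]; rewrite -!leNgt => w1 w2.
have deg i : degree R w i <= (1 + eta) * k.
  rewrite -(ler_pM2l s0) -ler_expR (le_trans _ w1)// /f (bigD1 i)//= lerDl.
  by apply: sumr_ge0 => j _; exact: expR_ge0.
split=> //; first exact: coupling_sym_diag.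
- by rewrite divr_gt0.
- move=> i; under eq_bigr do rewrite coupling_entry normrM (ger0_norm (ler0n _ _)).
  rewrite -mulr_sumr -/(degree R w i) normrM normfV (ger0_norm (ltW k0)).
  rewrite mulrAC ler_pdivrMr// (le_trans (ler_wpM2l t0 (deg i)))// mulrA ler_wpM2r ?(ltW k0)//.
  have : `|theta| * eta <= eta by rewrite ler_piMl// ltW.
  by rewrite /row_bound mulrDr mulr1 /eta; lra.
- move=> i; have e2 j : (edge w i j)%:R ^+ 2 = (edge w i j)%:R :> R.
    by case: (edge w i j); rewrite ?expr1n ?expr0n.
  under eq_bigr do rewrite coupling_entry exprMn e2.
  rewrite -mulr_sumr -/(degree R w i).
  apply: (@le_trans _ _ ((theta / k) ^+ 2 * ((1 + eta) * k))).
    by rewrite ler_wpM2l ?sqr_ge0// deg.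
  rewrite (_ : _ * _ = theta ^+ 2 * (1 + eta) / k); last by field; rewrite gt_eqF.
  rewrite ler_wpM2r ?invr_ge0 ?(ltW k0)//.
  have th2 : theta ^+ 2 <= 1 by rewrite -real_normK ?num_real// exprn_ile1// ltW.
  have e1 : 0 <= 1 + eta by rewrite addr_ge0// ltW.
  by have := ler_wpM2r e1 th2; move: eta1; lra.
- apply: le_trans rsmall; rewrite /r /k -[X in 2 / (X * p)]snE le_eqVlt; apply/orP; left; apply/eqP.
  by field; rewrite !gt_eqF.
Qed.

End graph_regularity.

(** * Convergence in probability *)

Lemma cvge0_near (R : realType) (x : nat -> \bar R) : (forall n, 0 <= x n)%E ->
  (forall eps : R, 0 < eps -> \forall n \near \oo, (x n <= eps%:E)%E) ->
  x n @[n --> \oo] --> 0%E.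
Proof.
move=> x0 xle; have fin : \forall n \near \oo, x n \is a fin_num.
  near=> n; rewrite ge0_fin_numE// (le_lt_trans _ (ltry 1))//.
  by near: n; exact: xle.
apply/fine_cvgP; split=> //; apply/cvgrPdist_le => eps eps0 /=.
near=> n; rewrite sub0r normrN ger0_norm ?fine_ge0// -lee_fin fineK.
  by near: n; exact: xle.
by near: n.
Unshelve. all: by end_near. Qed.

Lemma ks_distance_le (R : realType) (P Q : set R -> \bar R) (f g : R -> R) (eps : R) :
  (forall t, P `]-oo, t]%classic = (f t)%:E) ->
  (forall t, Q `]-oo, t]%classic = (g t)%:E) ->
  (forall t, `|f t - g t| <= eps) -> (ks_distance P Q <= eps%:E)%E.
Proof.
move=> Pf Qg fg; apply: ge_ereal_sup => _ [t _ <-].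
by rewrite Pf Qg lee_fin.
Qed.

Lemma gaussian_cdf (R : realType) (V t : R) :
  gaussian V `]-oo, t]%classic = (cdf_of (gaussian_mean V) t)%:E.
Proof.
rewrite /cdf_of gaussian_indic fineK//.
have mt : measurable (`]-oo, t]%classic : set (measurableTypeR R)) by exact: measurable_itv.
rewrite ge0_fin_numE; last exact: (measure_ge0 (normal_prob 0 (Num.sqrt V))).
exact: le_lt_trans (probability_le1 (normal_prob 0 (Num.sqrt V)) mt) (ltry 1).
Qed.

Section graph_product.
Context (R : realType) (n : nat) d (T : measurableType d).
Context (P : probability (n.-tuple (n.-tuple bool)) R) (Q : probability T R).

(** The sets [C w] are chosen graph by graph. As there are finitely many graphs, their union over
    [w] is a finite union of measurable rectangles; over a bad graph the whole fibre is taken. *)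
Lemma probability_graph_product (B : set (n.-tuple (n.-tuple bool)))
  (C : n.-tuple (n.-tuple bool) -> set T) (a b : R) : 0 <= b ->
  (P B <= a%:E)%E -> (forall w, ~ B w -> measurable (C w) /\ (Q (C w) <= b%:E)%E) ->
  (mu_ext (P \x Q)%E [set x | B x.1 \/ C x.1 x.2] <= (a + b)%:E)%E.
Proof.
move=> b0 Pa Qb; pose C' w := if `[< B w >] then setT else C w.
have mC' w : measurable (C' w).
  by rewrite /C'; case: asboolP => // /Qb[].
pose S := [set x : n.-tuple (n.-tuple bool) * T | C' x.1 x.2].
have S_indic : \1_S = fun x : n.-tuple (n.-tuple bool) * T =>
    \sum_w `[< x.1 = w >]%:R * \1_(C' w) x.2 :> R.
  apply/funext => x; rewrite (bigD1 x.1)//= asboolT// mul1r big1 ?addr0.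
    by rewrite !indicE; congr (_%:R).
  by move=> w /eqP wx; rewrite asboolF ?mul0r// => E; exact/wx.
have mS1 : bmeas (\1_S : _ -> R).
  rewrite S_indic; apply: bmeas_sum => w; apply: bmeasM.
    exact: (bmeas_comp_measurable (X := fst) measurable_fst (bmeas_graph (fun w' => `[< w' = w >]%:R))).
  exact: (bmeas_comp_measurable (X := snd) measurable_snd (bmeas_indic R (mC' w))).
have mS : measurable S.
  rewrite -[X in measurable X]setTI.
  have := mS1.1 measurableT `]0, +oo[%classic (measurable_itv _).
  congr measurable; apply/seteqP; split=> x /=; rewrite in_itv/= andbT indicE.
    by case: (boolP (x \in S)); rewrite ?inE// ltxx => _ [].
  by move=> [_ Sx]; split=> //; rewrite mem_set.
apply: (@le_trans _ _ ((P \x Q)%E S)).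
  rewrite -(measurable_mu_extE (P \x Q)%E mS); apply: le_mu_ext => x /=.
  by rewrite /S/= /C'; case: asboolP => // nB [].
rewrite -[X in (X <= _)%E]fineK; last first.
  by rewrite ge0_fin_numE// (le_lt_trans (probability_le1 _ mS))// ltry.
rewrite lee_fin -(expect_indic _ mS) expect_fubini//.
have EP := expect_mean P.
have mB : measurable B by exact: measurable_graph.
have PB : expect P \1_B <= a.
  rewrite expect_indic// -lee_fin fineK// ge0_fin_numE// (le_lt_trans (probability_le1 _ mB))//.
  by rewrite ltry.
apply: (@le_trans _ _ (expect P (fun w => \1_B w + b))); last first.
  by rewrite (meanD EP) ?(mean_cst EP) ?lerD2r//; [exact: bmeas_indic|exact: bmeas_cst].
apply: (mean_le EP) => [| |w]; [exact: bmeas_graph|exact: bmeas_graph|].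
have -> : (fun c => \1_S (w, c)) = \1_(C' w) :> (T -> R).
  by apply/funext => c; rewrite !indicE; congr (_%:R).
rewrite expect_indic//; have [Bw|Bw] := pselect (B w).
  rewrite [\1_B w]indicE mem_set// (@le_trans _ _ 1) ?lerDl//.
  rewrite -lee_fin fineK ?probability_le1// ge0_fin_numE//.
  by rewrite (le_lt_trans (probability_le1 _ _))// ltry.
have [mC QC] := Qb w Bw.
have -> : C' w = C w by rewrite /C' asboolF.
rewrite [\1_B w]indicE memNset// add0r -lee_fin fineK//.
by rewrite ge0_fin_numE// (le_lt_trans (probability_le1 _ _))// ltry.
Qed.

End graph_product.

Section normal_limits.
Context (R : realType) (mu F : probability (measurableTypeR R) R).
Hypothesis hmu : base_measure mu.
Hypothesis F0 : expect F (dpsi mu) = 0.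
Variables (theta : R) (p : nat -> R).
Hypothesis hp : forall n, (0 < n)%N -> 0 < p n <= 1.
Hypothesis hpn : (Num.sqrt n%:R)^-1 / p n @[n --> \oo] --> (0 : R).
Hypothesis htheta : `|theta| < 1.
Variables (lam : R) (q : forall n, 'I_n -> R).
Local Notation kappa := (mean_ddpsi mu F).
Hypothesis lamkappa0 : 0 < lam * kappa.
Hypothesis q1 : forall n, (0 < n)%N -> \sum_i q (n := n) i ^+ 2 = 1.
Hypothesis qmax : forall delta : R, 0 < delta ->
  \forall n \near \oo, forall i, `|q (n := n) i| <= delta.
Hypothesis qbias : forall eps : R, 0 < eps ->
  \forall n \near \oo, graph_bias mu F theta lam (q (n := n)) / p n <= eps.

Let rho := row_bound theta.

Let rho0 : 0 < rho.
Proof. by rewrite divr_gt0// ltr_pwDl. Qed.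

Let rho1 : rho < 1.
Proof. by rewrite /rho /row_bound; move: htheta; move: `|theta| => t; lra. Qed.

Lemma regular_near (delta eps : R) : 0 < delta -> 0 < eps -> \forall n \near \oo,
  exists B : set (n.-tuple (n.-tuple bool)),
    (erdos_renyi n (p n) B <= eps%:E)%E /\
    forall w, ~ B w -> regular_coupling mu F rho lam delta (2 / (n%:R * p n))
      (coupling theta (p n) w) (q (n := n)).
Proof.
move=> delta0 eps0; pose c := 6 * (lam * kappa * theta) ^+ 2.
pose K := degree_constant theta + (c + 6) / delta ^+ 2.
have d2 : 0 < delta ^+ 2 by rewrite exprn_gt0.
have c0 : 0 <= c by apply: mulr_ge0 => //; exact: sqr_ge0.
have D0 : 0 <= degree_constant theta.
  by apply: exprn_ge0; apply: divr_ge0 => //; exact: sqr_ge0.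
have K0 : 0 <= K by rewrite addr_ge0// divr_ge0 ?(ltW d2)// addr_ge0.
(* One threshold for both [r] and the bias over [p]: below 1, powers of [r] are at most [r];
   [delta ^+ 2 / 2] serves the field [regular_small]; the last term makes the probability at most
   [eps]. *)
pose s := Num.min (Num.min 1 (delta ^+ 2 / 2)) (eps / (1 + K)).
have K1 : 0 < 1 + K by rewrite ltr_pwDl.
have s0 : 0 < s by rewrite !lt_min ltr01 !divr_gt0.
have s1 : s <= 1 by rewrite !ge_min lexx.
have sd : s <= delta ^+ 2 / 2 by rewrite !ge_min lexx orbT.
have se : K * s <= eps.
  apply: (@le_trans _ _ ((1 + K) * (eps / (1 + K)))); last first.
    by rewrite mulrC divfK// gt_eqF.
  by apply: ler_pM => //; [exact: ltW|rewrite lerDr|rewrite !ge_min lexx orbT].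
have hs : \forall n \near \oo, (Num.sqrt n%:R)^-1 / p n <= s.
  move/cvgrPdist_le : hpn => /(_ _ s0); apply: filterS => n.
  by rewrite sub0r normrN => /(le_trans (ler_norm _)).
near=> n; have n0 : (0 < n)%N by near: n; exact: nbhs_infty_gt.
have rs : (Num.sqrt n%:R)^-1 / p n <= s by near: n; exact: hs.
have p01 := hp n0; have /andP[p0 p1] := p01.
pose r := (Num.sqrt n%:R)^-1 / p n.
rewrite -/r in rs; have r0 : 0 <= r by rewrite divr_ge0 ?invr_ge0 ?(ltW p0).
have bs : graph_bias mu F theta lam (q (n := n)) / p n <= s by near: n; exact: qbias.
have qd : forall i, `|q (n := n) i| <= delta by near: n; exact: qmax.
have [|B [PB reg]] := regular_coupling_whp mu F lam htheta n0 p01 delta0 (q1 n0) qd.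
  by rewrite -/r; lra.
exists B; split=> //; apply: (le_trans PB); rewrite lee_fin -/r -/c.
apply: le_trans se; rewrite /K [leRHS]mulrDl; apply: lerD.
  apply: ler_wpM2l => //; rewrite (le_trans _ rs)// exprS ler_piMr// exprn_ile1//.
  exact: le_trans rs s1.
rewrite [leRHS]mulrAC ler_wpM2r ?invr_ge0 ?(ltW d2)// [leRHS]mulrDl.
apply: lerD; last exact: ler_wpM2l.
rewrite ler_wpM2l// (le_trans _ rs)// expr2 ler_piMr//.
exact: le_trans rs s1.
Unshelve. all: by end_near. Qed.

Let linear_stat n (s : n.-tuple (measurableTypeR R)) : R := \sum_i q i * tnth s i.

Let bmeas_cdf t : bmeas (\1_(`]-oo, t]%classic) : measurableTypeR R -> R).
Proof. by apply: bmeas_indic; exact: measurable_itv. Qed.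

Let measurable_linear n : measurable_fun [set: n.-tuple (measurableTypeR R)] (@linear_stat n).
Proof.
apply: measurable_sum => i; apply: measurable_funM => //; exact: measurable_tnth.
Qed.

Lemma law_cdf n (A : 'M[R]_n) (c : n.-tuple R) (X : n.-tuple R -> R) t :
  measurable_fun [set: n.-tuple (measurableTypeR R)] (X : n.-tuple (measurableTypeR R) -> R) ->
  law_given_field mu A c X `]-oo, t]%classic =
  (gibbs_mean mu A c (fun s => \1_(`]-oo, t]%classic) (X (spins s))))%:E.
Proof.
move=> mX; have mB : measurable (X @^-1` `]-oo, t]%classic : set (n.-tuple (measurableTypeR R))).
  by rewrite -[X in measurable X]setTI; apply: mX => //; exact: measurable_itv.
by rewrite /law_given_field gibbsE.
Qed.

Lemma normal_given_field (u : forall n, 'M[R]_n -> n.-tuple R -> n.-tuple R) :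
  (forall n (A : 'M[R]_n) (c : n.-tuple R), mf_optimizer mu A c (u n A c)) ->
  cvg_normal_given_field mu F theta p (fun n A c s =>
    \sum_(i < n) q i * (tnth s i - tnth (u n A c) i)) (lam * kappa).
Proof.
move=> hu e e0; apply: cvge0_near => [n|eps eps0]; first exact: mu_ext_ge0.
pose b := Num.min e (eps / 2).
have b0 : 0 < b by rewrite lt_min e0 divr_gt0.
have [delta /andP[delta0 delta1] lim] := conditional_limit hmu F0 rho0 rho1 lamkappa0 b0.
have := regular_near delta0 b0; apply: filterS => n [B [PB reg]].
(* The exceptional set of fields depends on the graph, so one is chosen for each graph; over a bad
   graph [set0] serves as a placeholder. *)
have /choice[C HC] (w : n.-tuple (n.-tuple bool)) : exists C : set (n.-tuple (measurableTypeR R)),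
    ~ B w -> [/\ measurable C, (iid F n C <= b%:E)%E & forall c, ~ C c ->
    forall y, is_center mu (coupling theta (p n) w) (q (n := n)) lam c y -> forall t : R,
      `|gibbs_mean mu (coupling theta (p n) w) c (fun s => \1_(`]-oo, t]%classic)
          (\sum_i q i * tnth (spins s) i - y)) -
        cdf_of (gaussian_mean (lam * kappa)) t| <= b].
  have [Bw|Bw] := pselect (B w); first by exists set0.
  have [|C HC] := lim delta _ n _ _ _ (reg w Bw); first by rewrite delta0/=.
  by exists C.
apply: (@le_trans _ _ (mu_ext (erdos_renyi n (p n) \x iid F n)%E [set x | B x.1 \/ C x.1 x.2])).
  apply: le_mu_ext => -[w c] /= ks; apply: contrapT => /not_orP[nB nC].
  have [_ _ close] := HC w nB.
  move: ks; apply/negP; rewrite -leNgt.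
  pose A := coupling theta (p n) w; pose y := \sum_i q i * tnth (u n A c) i.
  have yc : is_center mu A (q (n := n)) lam c y.
    right; exists (u n A c) => //.
    move=> i; exact: (mf_optimizer_fixpoint hmu (coupling_sym_diag theta (p n) w) (hu n A c) i).
  have XE (s : n.-tuple R) : \sum_(i < n) q i * (tnth s i - tnth (u n A c) i) = linear_stat s - y.
    by rewrite /linear_stat /y -sumrB; apply: eq_bigr => i _; rewrite mulrBr.
  apply: (@le_trans _ _ b%:E); last by rewrite lee_fin ge_min lexx.
  apply: (ks_distance_le _ (gaussian_cdf (lam * kappa)) (close c nC y yc)) => t.
  rewrite law_cdf; last first.
    under eq_fun do rewrite XE.
    by apply: measurable_funB => //; exact: measurable_linear.
  by congr (_%:E); congr gibbs_mean; apply/funext => s; rewrite XE.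
apply: (@le_trans _ _ (b + b)%:E).
  apply: probability_graph_product => //; first exact: ltW.
  by move=> w /(HC w)[].
have be : b <= eps / 2 by rewrite ge_min lexx orbT.
by rewrite lee_fin; lra.
Qed.

Lemma normal_averaged : cvg_normal_averaged mu F theta p (fun n s =>
    \sum_(i < n) q i * tnth s i) (lam * kappa + lam ^+ 2 * mean_sqr_dpsi mu F).
Proof.
move=> e e0; apply: cvge0_near => [n|eps eps0]; first exact: mu_ext_ge0.
have [delta /andP[delta0 delta1] lim] := averaged_limit hmu F0 rho0 rho1 lamkappa0 e0.
have := regular_near delta0 eps0; apply: filterS => n [B [PB reg]].
have mB : measurable B by exact: measurable_graph.
apply: le_trans PB; rewrite -(measurable_mu_extE (erdos_renyi n (p n)) mB).
apply: le_mu_ext => w /= ks; apply: contrapT => nB.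
have d01 : 0 < delta <= delta by rewrite delta0/=.
have close := lim delta _ n _ _ d01 (reg w nB).
move: ks; apply/negP; rewrite -leNgt.
pose A := coupling theta (p n) w.
apply: (ks_distance_le _ (gaussian_cdf _) close) => t.
rewrite /law_averaged /averaged_mean -integral_expect; last first.
  apply: bmeas_averaged => //.
  have mX : measurable_fun [set: n.-tuple (measurableTypeR R)] (fun s => linear_stat (spins s)).
    exact: (measurableT_comp (@measurable_linear n) (@measurable_spins R n)).
  exact: (bmeas_comp_measurable (mX : measurable_fun _ (_ : _ -> measurableTypeR R)) (bmeas_cdf t)).
apply: eq_integral => c _.
have := @law_cdf n A c (@linear_stat n) t (@measurable_linear n).
by [].
Qed.

End normal_limits.

Theorem corollary2p7 (R : realType)
  (mu F : probability (measurableTypeR R) R) (theta : R) (p : nat -> R)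
  (u : forall n, 'M[R]_n -> n.-tuple R -> n.-tuple R)
  (hmu : base_measure mu)
  (hF : ('E_F[dpsi mu] = 0)%E)
  (hp : forall n, (0 < n)%N -> 0 < p n <= 1)
  (hpn : (Num.sqrt n%:R)^-1 / p n @[n --> \oo] --> (0 : R))
  (htheta : `|theta| < 1)
  (hu : forall n (A : 'M[R]_n) (c : n.-tuple R), mf_optimizer mu A c (u n A c)) :
  let kappa := fine ('E_F[ddpsi mu])%E in
  let tau := fine ('E_F[(fun x => dpsi mu x ^+ 2)%R])%E in
  [/\ cvg_normal_given_field mu F theta p
        (fun n A c s =>
           (Num.sqrt n%:R)^-1 * \sum_(i < n) (tnth s i - tnth (u n A c) i))
        (kappa / (1 - theta * kappa)),
      cvg_normal_averaged mu F theta p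
        (fun n s => (Num.sqrt n%:R)^-1 * \sum_(i < n) tnth s i)
        (kappa / (1 - theta * kappa) + tau / (1 - theta * kappa) ^+ 2)
    & forall q : forall n, n.-tuple R,
        (forall n, (0 < n)%N -> Num.sqrt (\sum_(i < n) tnth (q n) i ^+ 2) = 1) ->
        (\sum_(i < n) tnth (q n) i) / Num.sqrt (n%:R * p n)
          @[n --> \oo] --> (0 : R) ->
        \big[Num.max/0]_(i < n) `|tnth (q n) i| @[n --> \oo] --> (0 : R) ->
        cvg_normal_given_field mu F theta p
          (fun n A c s =>
             \sum_(i < n) tnth (q n) i * (tnth s i - tnth (u n A c) i))
          kappa /\
        cvg_normal_averaged mu F theta p
          (fun n s => \sum_(i < n) tnth (q n) i * tnth s i)
          (kappa + tau)].
Proof.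
move=> kappa tau.
have kappaE : kappa = mean_ddpsi mu F by rewrite /kappa unlock.
have tauE : tau = mean_sqr_dpsi mu F by rewrite /tau unlock.
have F0 : expect F (dpsi mu) = 0.
  by have := congr1 fine hF; rewrite unlock.
have k0 := mean_ddpsi_gt0 F hmu; have k1 := mean_ddpsi_le1 F hmu.
rewrite kappaE tauE; move: k0 k1; set k := mean_ddpsi mu F => k0 k1.
have tk : `|theta * k| < 1.
  by rewrite normrM (ger0_norm (ltW k0)) (le_lt_trans _ htheta)// ler_piMr.
have d0 : 0 < 1 - theta * k.
  by rewrite subr_gt0 (le_lt_trans (ler_norm _)).
pose r (n : nat) : R := (Num.sqrt n%:R)^-1 / p n.
have r_small (eps : R) : 0 < eps -> \forall n \near \oo, r n <= eps.
  move=> eps0; move/cvgrPdist_le : hpn => /(_ _ eps0); apply: filterS => n.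
  by rewrite sub0r normrN => /(le_trans (ler_norm _)).
have r_ge0 n : (0 < n)%N -> 0 <= r n.
  by move=> n0; rewrite divr_ge0 ?invr_ge0//; have /andP[/ltW] := hp n n0.
have n2p n : (0 < n)%N -> (n%:R ^+ 2 * p n)^-1 <= r n ^+ 2.
  move=> n0; have /andP[p0 p1] := hp n n0; have nR0 : 0 < n%:R :> R by rewrite ltr0n.
  rewrite /r exprMn !exprVn sqr_sqrtr ?(ltW nR0)// -invfM.
  rewrite lef_pV2 ?posrE ?mulr_gt0 ?exprn_gt0//.
  rewrite !expr2 -mulrA ler_wpM2l ?(ltW nR0)//.
  by apply: ler_pM; rewrite ?(ltW p0)// (le_trans p1)// ler1n.
have sqr_small (c eps : R) (x : nat -> R) : 0 <= c -> 0 < eps ->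
    (forall eps, 0 < eps -> \forall n \near \oo, `|x n| <= eps) ->
    \forall n \near \oo, c * x n ^+ 2 <= eps.
  move=> c0 eps0 xs; have e0 : 0 < Num.min 1 (eps / (1 + c)).
    by rewrite lt_min ltr01 divr_gt0// ltr_pwDl.
  apply: filterS (xs _ e0) => n; rewrite le_min => /andP[x1 xe].
  apply: (@le_trans _ _ ((1 + c) * (eps / (1 + c)))).
    apply: ler_pM => //; [exact: sqr_ge0|by rewrite lerDr|].
    by rewrite -real_normK ?num_real// (le_trans _ xe)// expr2 ler_piMr.
  by rewrite mulrC divfK// gt_eqF// ltr_pwDl.
have near_pos : \forall n \near \oo, (0 < n)%N by exact: nbhs_infty_gt.
have r_abs (eps : R) : 0 < eps -> \forall n \near \oo, `|r n| <= eps.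
  move=> eps0; near=> n; rewrite ger0_norm; first by near: n; exact: r_small.
  by apply: r_ge0; near: n.
pose q0 n (i : 'I_n) : R := (Num.sqrt n%:R)^-1.
(* With this value [(1 - lam) + lam * k * theta = 0], so the bias of the constant vector reduces to
   the correction for the missing diagonal, of order [n^-2]. *)
pose lam := (1 - theta * k)^-1.
have lam0 : 0 < lam by rewrite invr_gt0.
have q01 n : (0 < n)%N -> \sum_i q0 n i ^+ 2 = 1.
  move=> n0; have nR0 : 0 < n%:R :> R by rewrite ltr0n.
  rewrite /q0 sumr_const card_ord exprVn sqr_sqrtr ?(ltW nR0)// -[LHS]mulr_natl mulfV//.
  by rewrite gt_eqF.
have q0max (delta : R) : 0 < delta -> \forall n \near \oo, forall i, `|q0 n i| <= delta.
  move=> delta0; near=> n; have n0 : (0 < n)%N by near: n.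
  have /andP[p0 p1] := hp n n0.
  move=> i; rewrite ger0_norm ?invr_ge0// (@le_trans _ _ (r n))//; last first.
    by near: n; exact: r_small.
  by rewrite ler_peMr ?invr_ge0// invf_ge1.
have q0bias (eps : R) : 0 < eps ->
    \forall n \near \oo, graph_bias mu F theta lam (q0 n) / p n <= eps.
  move=> eps0; near=> n; have n0 : (0 < n)%N by near: n.
  have nR0 : 0 < n%:R :> R by rewrite ltr0n.
  have sn0 : 0 < Num.sqrt n%:R :> R by rewrite sqrtr_gt0.
  have -> : graph_bias mu F theta lam (q0 n) = (lam * k * theta) ^+ 2 / n%:R ^+ 2.
    rewrite /graph_bias -/k.
    have E (j : 'I_n) : (1 - lam) * q0 n j + lam * k * theta / n%:R * (\sum_i q0 n i - q0 n j) =
        - (lam * k * theta) / n%:R * (Num.sqrt n%:R)^-1.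
      have -> : \sum_i q0 n i = n%:R * (Num.sqrt n%:R)^-1.
        by rewrite /q0 sumr_const card_ord -[LHS]mulr_natl.
      by rewrite /q0 /lam; field; rewrite !gt_eqF.
    rewrite (eq_bigr _ (fun j _ => congr1 (fun x => x ^+ 2) (E j))).
    rewrite sumr_const card_ord -[LHS]mulr_natl exprMn [X in _ * (_ * X)]exprVn.
    by rewrite sqr_sqrtr ?(ltW nR0)//; field; rewrite gt_eqF.
  rewrite -[leLHS]mulrA -invfM.
  apply: (@le_trans _ _ ((lam * k * theta) ^+ 2 * r n ^+ 2)).
    by rewrite ler_wpM2l ?sqr_ge0// n2p.
  by near: n; apply: sqr_small => //; exact: sqr_ge0.
have lk0 : 0 < lam * k by exact: mulr_gt0.
split.
- have -> : k / (1 - theta * k) = lam * k by rewrite mulrC.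
  have -> : (fun n (A : 'M[R]_n) (c s : n.-tuple R) =>
      (Num.sqrt n%:R)^-1 * \sum_(i < n) (tnth s i - tnth (u n A c) i)) =
      fun n A c s => \sum_(i < n) q0 n i * (tnth s i - tnth (u n A c) i).
    apply: functional_extensionality_dep => n; apply/funext => A.
    by apply/funext => c; apply/funext => s; rewrite mulr_sumr.
  exact: (normal_given_field hmu F0 hp hpn htheta lk0 q01 q0max q0bias hu).
- have -> : k / (1 - theta * k) + mean_sqr_dpsi mu F / (1 - theta * k) ^+ 2 =
      lam * k + lam ^+ 2 * mean_sqr_dpsi mu F by rewrite /lam exprVn mulrC [X in _ + X]mulrC.
  have -> : (fun n (s : n.-tuple R) => (Num.sqrt n%:R)^-1 * \sum_(i < n) tnth s i) =
      fun n s => \sum_(i < n) q0 n i * tnth s i.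
    apply: functional_extensionality_dep => n.
    by apply/funext => s; rewrite mulr_sumr.
  exact: (normal_averaged hmu F0 hp hpn htheta lk0 q01 q0max q0bias).
move=> q qnorm qsum qm.
pose q2 n (i : 'I_n) : R := tnth (q n) i.
have q21 n : (0 < n)%N -> \sum_i q2 n i ^+ 2 = 1.
  move=> /qnorm qn; have S0 : 0 <= \sum_i q2 n i ^+ 2.
    by apply: sumr_ge0 => i _; exact: sqr_ge0.
  by rewrite -[LHS]sqr_sqrtr// qn expr1n.
have q2max (delta : R) : 0 < delta -> \forall n \near \oo, forall i, `|q2 n i| <= delta.
  move=> delta0; move/cvgrPdist_le : qm => /(_ _ delta0); apply: filterS => n.
  rewrite sub0r normrN => /(le_trans (ler_norm _)) qd i; apply: le_trans qd.
  exact: le_bigmax.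
have q2bias (eps : R) : 0 < eps ->
    \forall n \near \oo, graph_bias mu F theta 1 (q2 n) / p n <= eps.
  move=> eps0; pose C := 2 * (k * theta) ^+ 2.
  have C0 : 0 <= C by apply: mulr_ge0 => //; exact: sqr_ge0.
  pose v n := (\sum_i q2 n i) / Num.sqrt (n%:R * p n).
  have v_abs (eps' : R) : 0 < eps' -> \forall n \near \oo, `|v n| <= eps'.
    move=> e0; move/cvgrPdist_le : qsum => /(_ _ e0); apply: filterS => n.
    by rewrite sub0r normrN.
  have e20 : 0 < eps / 2 by rewrite divr_gt0.
  near=> n; have n0 : (0 < n)%N by near: n.
  have nR0 : 0 < n%:R :> R by rewrite ltr0n.
  have /andP[p0 p1] := hp n n0.
  have v1 : C * v n ^+ 2 <= eps / 2 by near: n; exact: sqr_small.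
  have r1 : C * r n ^+ 2 <= eps / 2 by near: n; exact: sqr_small.
  (* With [lam = 1] the term in [(1 - lam) * q j] disappears. After division by [p] the bound is [C]
     times [(sum_i q_i)^2 / (n p)], which vanishes by assumption, plus [C / (n^2 p)], at most
     [C * r^2]. *)
  have bias_le : graph_bias mu F theta 1 (q2 n) <=
      C * ((\sum_i q2 n i) ^+ 2 / n%:R + (n%:R ^+ 2)^-1).
    rewrite /graph_bias -/k; set S := \sum_i q2 n i.
    apply: (@le_trans _ _ (\sum_j (C / n%:R ^+ 2 * S ^+ 2 + C / n%:R ^+ 2 * q2 n j ^+ 2))).
      apply: ler_sum => j _; rewrite subrr mul0r add0r mul1r 2!exprMn exprVn.
      have -> : C / n%:R ^+ 2 = 2 * ((k * theta) ^+ 2 / n%:R ^+ 2) by rewrite /C mulrA.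
      have : 0 <= (k * theta) ^+ 2 / n%:R ^+ 2 by rewrite divr_ge0 ?sqr_ge0.
      move: (_ / _) (q2 n j) => c x c0; have := mulr_ge0 c0 (sqr_ge0 (S + x)); lra.
    rewrite big_split/= sumr_const card_ord -mulr_sumr q21// mulr1 -[X in X + _ <= _]mulr_natl.
    by rewrite le_eqVlt; apply/orP; left; apply/eqP; field; rewrite gt_eqF.
  have pV : 0 <= (p n)^-1 by rewrite invr_ge0 ltW.
  apply: (le_trans (ler_wpM2r pV bias_le)).
  rewrite (_ : C * _ / p n = C * v n ^+ 2 + C * (n%:R ^+ 2 * p n)^-1); last first.
    rewrite /v exprMn exprVn sqr_sqrtr ?mulr_ge0 ?(ltW nR0) ?(ltW p0)//.
    by field; rewrite !gt_eqF.
  have := ler_wpM2l C0 (n2p n n0); lra.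
have lk1 : 0 < 1 * k by rewrite mul1r.
have -> : k = 1 * k by rewrite mul1r.
split.
  exact: (normal_given_field hmu F0 hp hpn htheta lk1 q21 q2max q2bias hu).
have -> : mean_sqr_dpsi mu F = 1 ^+ 2 * mean_sqr_dpsi mu F by rewrite expr1n mul1r.
exact: (normal_averaged hmu F0 hp hpn htheta lk1 q21 q2max q2bias).
Unshelve. all: by end_near. Qed.
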